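(* Under the model, standing assumptions, Assumptions 1–5 and notation of the context, suppose there is a constant $0<c_2<1$ with $p=O(m^{c_2})$ and the initial estimator satisfies $\|\widehat\beta^{(0)}-\beta^*\|_2=O_{\mathbb P}\big((p/m)^{1/3}\big)$. Let $\widehat\beta^{(1)},\dots,\widehat\beta^{(T)}$ be the multiround smoothed maximum score iterates $$\widehat\beta^{(t)}=\widehat\beta^{(t-1)}-\big[\nabla^2F_{h_t}(\widehat\beta^{(t-1)})\big]^{-1}\nabla F_{h_t}(\widehat\beta^{(t-1)}),\qquad h_t=\max\Big\{(p/n)^{\frac1{2\alpha+1}},(p/m)^{\frac{2^t}{3\alpha}}\Big\},\quad t=1,\dots,T.$$ Then for $t=1,\dots,T$, $$\|\widehat\beta^{(t)}-\beta^*\|_2=O_{\mathbb P}\left(\Big(\frac pn\Big)^{\frac{\alpha}{2\alpha+1}}+\Big(\frac pm\Big)^{\frac{2^t}{3}}+\Big(\frac pm\Big)^{\frac{2^{t-1}}{3}}\Big(\frac pn\Big)^{\frac{\alpha-1}{2\alpha+1}}\sqrt{\log n}\right).$$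
   Context: Model. $Y=\mathrm{sign}(X+Z^\top\beta^*+\epsilon)\in\{-1,+1\}$ with $\beta^*\in\mathbb R^p$, $X,\epsilon$ real random variables and $Z$ an $\mathbb R^p$-valued random vector. One observes $(y_i,x_i,z_i)$, $i=1,\dots,n$, coming from i.i.d. copies of $(Y,X,Z,\epsilon)$, split over $L$ machines with $m=n/L$ observations each. The initial estimator $\widehat\beta^{(0)}$ may depend on the data. Standing (identifiability) assumptions: (a) $\mathrm{median}(\epsilon\mid X,Z)=0$; (b) the support of $(X,Z)$ is not contained in a proper linear subspace of $\mathbb R^{p+1}$; (c) $0<P(Y=-1\mid X,Z)<1$ for almost every $(X,Z)$; (d) the conditional distribution of $X$ given $Z$ has an a.e. positive density. Assumption 1 (kernel). $\alpha\ge2$ is an integer, $H:\mathbb R\to\mathbb R$, $H(x)=1$ for $x>1$, $H(x)=0$ for $x<-1$; $\pi_U:=\int_{-1}^1x^\alpha H'(x)\,dx\neq0$, $\int_{-1}^1x^kH'(x)\,dx=0$ for $k=1,\dots,\alpha-1$; $\pi_V:=\int_{-1}^1[H'(x)]^2dx<\infty$; $H''$ is bounded and Lipschitz continuous. Assumption 2. The conditional density $\rho(\cdot\mid Z)$ of $\zeta:=X+Z^\top\beta^*$ given $Z$ is positive and bounded uniformly for almost every $Z$; for $1\le k\le\alpha$ its $k$th derivative exists and is bounded for almost every $Z$. Assumption 3. $\epsilon$ and $X$ are independent given $Z$; the conditional c.d.f. $F(\cdot\mid Z)$ of $\epsilon$ given $Z$ has, for $1\le k\le\alpha+1$, a $k$th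 derivative bounded uniformly for almost every $Z$. Assumption 4. With $V:=2\,\mathbb E[\rho(0\mid Z)F'(0\mid Z)ZZ^\top]$ and $V_s:=\pi_V\,\mathbb E[\rho(0\mid Z)ZZ^\top]$, there is a constant $c_1>1$ such that all eigenvalues of $V$ and of $V_s$ lie in $(c_1^{-1},c_1)$. Assumption 5. There is $\eta>0$ with $\sup_{\|v\|_2=1}\mathbb E\,e^{\eta(v^\top Z)^2}<\infty$. Notation. $F_h(\beta)=\frac1n\sum_{i=1}^n(-y_i)H\big(\frac{x_i+z_i^\top\beta}{h}\big)$, so $\nabla F_h(\beta)=\frac1{nh}\sum_i(-y_i)H'\big(\frac{x_i+z_i^\top\beta}{h}\big)z_i$ and $\nabla^2F_h(\beta)=\frac1{nh^2}\sum_i(-y_i)H''\big(\frac{x_i+z_i^\top\beta}{h}\big)z_iz_i^\top$. (These are averages over machines of the local gradients and Hessians.) $T$ is a positive integer, the number of iterations. Asymptotics. $n\to\infty$ and $m\to\infty$; $p,m,L$ may depend on $n$, and all constants and bounds in the assumptions do not depend on $n$. *)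

(* Defs.v *)
From HB Require Import structures.
From mathcomp Require Import all_boot all_order all_algebra.
From mathcomp Require Import all_classical all_reals all_analysis.
From mathcomp Require Import ring.

Set Implicit Arguments.
Unset Strict Implicit.
Unset Printing Implicit Defensive.

Import Order.TTheory GRing.Theory Num.Theory.
Import numFieldNormedType.Exports.

Local Open Scope classical_set_scope.
Local Open Scope ring_scope.

(* The library norm `|v| on matrices is the sup norm, hence l2norm. *)
Definition l2norm (R : realType) (p : nat) (v : 'cV[R]_p) : R :=
  Num.sqrt (\sum_i v i 0 ^+ 2).

Definition dotp (R : realType) (p : nat) (u v : 'cV[R]_p) : R := (u^T *m v) 0 0.

(* R^p with its Borel sigma-algebra; the carrier is 'cV[R]_p. *)
Definition borel_cV (R : realType) (p : nat) :=
  g_sigma_algebraType (@open 'cV[R]_p).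

Section probability_notions.
Context d d' (T : measurableType d) (V : measurableType d') (R : realType).
Variable P : probability T R.
Local Open Scope ereal_scope.

(* Doob-Dynkin form of the conditional probability: q(W) = P(A | W) a.s. *)
Definition is_cond_prob (A : set T) (W : T -> V) (q : V -> R) : Prop :=
  [/\ measurable_fun setT q,
      P.-integrable setT (fun w => (q (W w))%:E) &
      forall B : set V, measurable B ->
        P (A `&` W @^-1` B) = \int[P]_(w in W @^-1` B) (q (W w))%:E].

(* f x z is the conditional density at x of X given W = z. *)
Definition is_cond_density (X : T -> R) (W : T -> V) (f : R -> V -> R) : Prop :=
  [/\ measurable_fun setT (fun xz : R * V => f xz.1 xz.2),
      {ae P, forall w, forall x, (0 <= f x (W w))%R} &
      forall (A : set R) (B : set V), measurable A -> measurable B ->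
        P (X @^-1` A `&` W @^-1` B) =
        \int[P]_(w in W @^-1` B)
          \int[@lebesgue_measure R]_(x in A) (f x (W w))%:E].

(* F u z is the conditional c.d.f. at u of X given W = z. *)
Definition is_cond_cdf (X : T -> R) (W : T -> V) (F : R -> V -> R) : Prop :=
  (forall u : R, is_cond_prob [set w | (X w <= u)%R] W (F u)) /\
  {ae P, forall w, [/\ {homo F^~ (W w) : u v / (u <= v)%R},
                       right_continuous (F^~ (W w)),
                       F u (W w) @[u --> -oo%R] --> (0 : R)%R &
                       F u (W w) @[u --> +oo%R] --> (1 : R)%R]}.

Definition cond_independent (X1 X2 : T -> R) (W : T -> V) : Prop :=
  forall A1 A2 : set R, measurable A1 -> measurable A2 ->
    exists q1 q2 : V -> R,
      [/\ is_cond_prob (X1 @^-1` A1) W q1,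
          is_cond_prob (X2 @^-1` A2) W q2 &
          is_cond_prob (X1 @^-1` A1 `&` X2 @^-1` A2) W (fun v => q1 v * q2 v)%R].

(* The conditional median is not required to be unique. *)
Definition cond_median0 (X : T -> R) (W : T -> V) : Prop :=
  exists q1 q2 : V -> R,
    [/\ is_cond_prob [set w | (X w <= 0)%R] W q1,
        is_cond_prob [set w | (0 <= X w)%R] W q2 &
        {ae P, forall w, (2^-1 <= q1 (W w))%R /\ (2^-1 <= q2 (W w))%R}].

Definition identically_distributed (W1 W2 : T -> V) : Prop :=
  forall B : set V, measurable B -> P (W1 @^-1` B) = P (W2 @^-1` B).

Definition mutually_independent (n : nat) (W : 'I_n -> T -> V) : Prop :=
  forall (J : {set 'I_n}) (B : 'I_n -> set V), (forall i, measurable (B i)) ->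
    P (\bigcap_(i in [set` J]) W i @^-1` B i) =
    \prod_(i in J) P (W i @^-1` B i).

(* Smallest closed set of full measure of the law of W. *)
Definition law_support (q : nat) (W : T -> 'cV[R]_q) : set 'cV[R]_q :=
  [set v | forall U, open_nbhs v U -> 0 < P (W @^-1` U)].

End probability_notions.

(* Stochastic boundedness relative to r, along a sequence of probability spaces. *)
Definition is_OP (R : realType) (disp : nat -> measure_display)
    (T : forall k, measurableType (disp k)) (P : forall k, probability (T k) R)
    (W : forall k, T k -> R) (r : nat -> R) : Prop :=
  forall e : R, 0 < e -> exists2 M : R, 0 < M &
    \forall k \near \oo, (P k [set w | (M * r k < `|W k w|)%R] <= e%:E)%E.

Definition bounded_derivatives (R : realType) (N : nat) (C : R) (f : R -> R) :=
  forall j : nat, (1 <= j <= N)%N ->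
    forall x : R, derivable (derive1n j.-1 f) x 1 /\ `|derive1n j f x| <= C.

(* The value of the sign at 0 is immaterial: the latent variable has a
   continuous distribution. *)
Definition sign_pm (R : realType) (u : R) : R := if u < 0 then -1 else 1.

Section smoothed_objective.
Context (R : realType) (n p : nat).
Variables (H : R -> R) (y x : 'I_n -> R) (z : 'I_n -> 'cV[R]_p).

Definition sms_obj (h : R) (b : 'cV[R]_p) : R :=
  n%:R^-1 * \sum_i - y i * H ((x i + dotp (z i) b) / h).

Definition sms_grad (h : R) (b : 'cV[R]_p) : 'cV[R]_p :=
  (n%:R * h)^-1 *: \sum_i (- y i * derive1 H ((x i + dotp (z i) b) / h)) *: z i.

Definition sms_hess (h : R) (b : 'cV[R]_p) : 'M[R]_p :=
  (n%:R * h ^+ 2)^-1 *: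
    \sum_i (- y i * derive1n 2 H ((x i + dotp (z i) b) / h)) *: (z i *m (z i)^T).

Definition newton_step (h : R) (b : 'cV[R]_p) : 'cV[R]_p :=
  b - invmx (sms_hess h b) *m sms_grad h b.

Fixpoint sms_iter (h : nat -> R) (b0 : 'cV[R]_p) (t : nat) : 'cV[R]_p :=
  if t is t'.+1 then newton_step (h t'.+1) (sms_iter h b0 t') else b0.

End smoothed_objective.

(* sms_grad and sms_hess are the gradient and the Hessian of sms_obj. *)
Section smoothed_objective_derivatives.
Context (R : realType) (p : nat).

Lemma dotpDr (u v w : 'cV[R]_p) : dotp u (v + w) = dotp u v + dotp u w.
Proof. by rewrite /dotp mulmxDr mxE. Qed.

Lemma dotpZr (u v : 'cV[R]_p) (a : R) : dotp u (a *: v) = a * dotp u v.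
Proof. by rewrite /dotp -scalemxAr mxE. Qed.

Lemma dotpC (u v : 'cV[R]_p) : dotp u v = dotp v u.
Proof.
by rewrite /dotp !mxE; apply: eq_bigr => i _; rewrite !mxE mulrC.
Qed.

Lemma dotp_sumr (I : Type) (r : seq I) (u : 'cV[R]_p) (F : I -> 'cV[R]_p) :
  dotp u (\sum_(i <- r) F i) = \sum_(i <- r) dotp u (F i).
Proof. by rewrite /dotp mulmx_sumr summxE. Qed.

Lemma is_derive_ridge (g : R -> R) (c h : R) (z b v : 'cV[R]_p) :
  derivable g ((c + dotp z b) / h) 1 ->
  is_derive b v (fun b' : 'cV[R]_p => g ((c + dotp z b') / h))
    (derive1 g ((c + dotp z b) / h) * (dotp z v / h)).
Proof.
set a := (c + dotp z b) / h => dg.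
pose s (t : R) : R := a + t * (dotp z v / h).
have ds : is_derive (0 : R) (1 : R) s (dotp z v / h).
  have -> : s = cst a + (dotp z v / h) \*: (@id R).
    by apply/funext => t; rewrite /s /= mulrC.
  have := is_deriveD (is_derive_cst a (0 : R) 1)
    (is_deriveZ (dotp z v / h) (is_derive_id (0 : R) (1 : R))).
  by move=> /is_derive_eq; apply; rewrite add0r -[_ *: 1]/(_ * 1) mulr1.
have s0 : s 0 = a by rewrite /s mul0r addr0.
have dgs : is_derive (s 0) (1 : R) g (derive1 g a).
  by rewrite s0 derive1E; apply: DeriveDef.
have dc := @is_derive1_comp R g s 0 _ _ dgs ds.
have E : (fun t : R => t^-1 *:
            (((fun b' : 'cV[R]_p => g ((c + dotp z b') / h)) \o shift b)
               (t *: v) - g a)) =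
         (fun t : R => t^-1 *: (((g \o s) \o shift 0) (t *: (1 : R)) - (g \o s) 0)).
  apply/funext => t /=; rewrite s0 addr0 /s.
  congr (_ *: (g _ - _)).
  by rewrite dotpDr dotpZr /a [t *: 1]mulr1 addrCA addrC mulrDl mulrA.
case: dc => dc1 dc2; split; first by rewrite /derivable E.
by rewrite /derive E -/(derive _ _ _) dc2.
Qed.

Lemma is_derive_ridge_sum (n : nat) (g : R -> R) (a c x : 'I_n -> R)
    (z : 'I_n -> 'cV[R]_p) (s h : R) (b v : 'cV[R]_p) :
  (forall u, derivable g u 1) ->
  is_derive b v
    (fun b' => s * \sum_i (a i * g ((x i + dotp (z i) b') / h)) * c i)
    (s * \sum_i (a i * derive1 g ((x i + dotp (z i) b) / h)) * (dotp (z i) v / h) * c i).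
Proof.
move=> dg.
have -> : (fun b' => s * \sum_i (a i * g ((x i + dotp (z i) b') / h)) * c i) =
    s \*: (\sum_i ((a i * c i) \*: (fun b' => g ((x i + dotp (z i) b') / h)))).
  apply/funext => b' /=; rewrite fct_sumE; congr (_ * _).
  by apply: eq_bigr => i _ /=; rewrite mulrAC.
rewrite -[s * \sum_i _]/(s *: \sum_i _).
apply: is_deriveZ.
have -> : \sum_i a i * derive1 g ((x i + dotp (z i) b) / h) * (dotp (z i) v / h) * c i =
    \sum_i (a i * c i) *: (derive1 g ((x i + dotp (z i) b) / h) * (dotp (z i) v / h)).
  apply: eq_bigr => i _.
  by rewrite -[_ *: _]/(_ * _); ring.
apply: is_derive_sum => i.
by apply: is_deriveZ; apply: is_derive_ridge; exact: dg.
Qed.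

Lemma sms_gradP (n : nat) (H : R -> R) (y x : 'I_n -> R)
    (z : 'I_n -> 'cV[R]_p) (h : R) (b v : 'cV[R]_p) :
  (forall u, derivable H u 1) ->
  is_derive b v (sms_obj H y x z h) (dotp v (sms_grad H y x z h b)).
Proof.
move=> dH.
have := @is_derive_ridge_sum n H (fun i => - y i) (fun=> 1) x z n%:R^-1 h b v dH.
under eq_fun do under eq_bigr do rewrite mulr1.
move=> /is_derive_eq; apply.
rewrite dotpZr dotp_sumr invfM -mulrA; congr (_ * _).
rewrite mulr_sumr; apply: eq_bigr => i _.
by rewrite dotpZr (dotpC v); ring.
Qed.

Lemma sms_hessP (n : nat) (H : R -> R) (y x : 'I_n -> R)
    (z : 'I_n -> 'cV[R]_p) (h : R) (b u v : 'cV[R]_p) :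
  (forall t, derivable (derive1 H) t 1) ->
  is_derive b v (fun b' => dotp u (sms_grad H y x z h b'))
    (dotp u (sms_hess H y x z h b *m v)).
Proof.
move=> dH.
have := @is_derive_ridge_sum n (derive1 H) (fun i => - y i) (fun i => dotp u (z i))
  x z (n%:R * h)^-1 h b v dH.
have -> : (fun b' => dotp u (sms_grad H y x z h b')) =
    (fun b' => (n%:R * h)^-1 *
       \sum_i - y i * derive1 H ((x i + dotp (z i) b') / h) * dotp u (z i)).
  apply/funext => b'; rewrite dotpZr dotp_sumr; congr (_ * _).
  by apply: eq_bigr => i _; rewrite dotpZr.
move=> /is_derive_eq; apply.
rewrite -scalemxAl dotpZr expr2 mulrA [(_ * h * h)^-1]invfM -mulrA; congr (_ * _).
rewrite mulmx_suml dotp_sumr mulr_sumr; apply: eq_bigr => i _.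
rewrite -scalemxAl dotpZr derive1nS derive1n1.
have -> : dotp u (z i *m (z i)^T *m v) = dotp u (z i) * dotp (z i) v.
  rewrite /dotp -mulmxA mulmxA [u^T *m z i]mx11_scalar mul_scalar_mx mxE.
  by rewrite !mxE eqxx mulr1n.
by ring.
Qed.

End smoothed_objective_derivatives.

Definition kernel_moment (R : realType) (H : R -> R) (k : nat) : R :=
  \int[@lebesgue_measure R]_(x in `[-1, 1]) (x ^+ k * derive1 H x).

Definition kernel_piV (R : realType) (H : R -> R) : \bar R :=
  (\int[@lebesgue_measure R]_(x in `[(-1)%R, 1%R]) ((derive1 H x) ^+ 2)%:E)%E.

Definition kernel_assumption (R : realType) (alpha : nat) (H : R -> R) : Prop :=
  (2 <= alpha)%N /\
  (forall x, 1 < x -> H x = 1) /\ (forall x, x < -1 -> H x = 0) /\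
  (forall x, derivable H x 1) /\ (forall x, derivable (derive1 H) x 1) /\
  kernel_moment H alpha != 0 /\
  (forall k, (1 <= k <= alpha.-1)%N -> kernel_moment H k = 0) /\
  (kernel_piV H < +oo)%E /\
  [bounded derive1n 2 H x | x in setT] /\ lipschitz (derive1n 2 H).

(* The probability space carries a generic copy (X, Z, eps), the n copies that
   generate the observations, and the initial estimator. *)
Record binary_response (R : realType) (n p : nat) := BinaryResponse {
  br_disp : measure_display;
  br_space : measurableType br_disp;
  br_prob : probability br_space R;
  br_beta : 'cV[R]_p;
  br_X : {RV br_prob >-> R};
  br_Z : {RV br_prob >-> borel_cV R p};
  br_eps : {RV br_prob >-> R};
  br_xs : 'I_n -> {RV br_prob >-> R};
  br_zs : 'I_n -> {RV br_prob >-> borel_cV R p};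
  br_es : 'I_n -> {RV br_prob >-> R};
  br_beta0 : {RV br_prob >-> borel_cV R p}
}.

Section model.
Context (R : realType) (n p : nat) (M : binary_response R n p).

Local Notation P := (br_prob M).
Local Notation X := (br_X M).
Local Notation Z := (br_Z M).
Local Notation eps := (br_eps M).
Local Notation beta := (br_beta M).

Definition br_zeta (w : br_space M) : R := X w + dotp (Z w) beta.

Definition br_Y (w : br_space M) : R := sign_pm (br_zeta w + eps w).

Definition br_XZ (w : br_space M) : R * borel_cV R p := (X w, Z w).

Definition br_ys (i : 'I_n) (w : br_space M) : R :=
  sign_pm (br_xs M i w + dotp (br_zs M i w) beta + br_es M i w).

Definition iid_sample : Prop :=
  let W i w : R * borel_cV R p * R := (br_xs M i w, br_zs M i w, br_es M i w) in
  mutually_independent P W /\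
  forall i, identically_distributed P (W i) (fun w => (X w, Z w, eps w)).

Definition identifiability : Prop :=
  [/\ cond_median0 P eps br_XZ,
      forall U : {vspace 'cV[R]_(1 + p)},
        law_support P (fun w => col_mx (X w)%:M (Z w : 'cV[R]_p))
          `<=` [set v | v \in U] -> U = fullv,
      exists2 q, is_cond_prob P [set w | br_Y w = -1] br_XZ q &
        {ae P, forall w, 0 < q (br_XZ w) < 1} &
      exists2 f, is_cond_density P X Z f &
        {ae P, forall w,
          {ae @lebesgue_measure R, forall x, 0 < f x (Z w)}}].

Definition density_assumption (alpha : nat) (C : R)
    (rho : R -> borel_cV R p -> R) : Prop :=
  is_cond_density P br_zeta Z rho /\
  {ae P, forall w, (forall t, 0 < rho t (Z w) <= C) /\
                   bounded_derivatives alpha C (rho^~ (Z w))}.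

Definition noise_assumption (alpha : nat) (C : R)
    (F : R -> borel_cV R p -> R) : Prop :=
  [/\ cond_independent P eps X Z, is_cond_cdf P eps Z F &
      {ae P, forall w, bounded_derivatives alpha.+1 C (F^~ (Z w))}].

Definition V_mx (rho F : R -> borel_cV R p -> R) : 'M[R]_p :=
  2 *: \matrix_(i, j) fine 'E_P[fun w =>
    rho 0 (Z w) * derive1 (F^~ (Z w)) 0 * ((Z w : 'cV[R]_p) *m (Z w)^T) i j].

Definition Vs_mx (H : R -> R) (rho : R -> borel_cV R p -> R) : 'M[R]_p :=
  fine (kernel_piV H) *: \matrix_(i, j) fine 'E_P[fun w =>
    rho 0 (Z w) * ((Z w : 'cV[R]_p) *m (Z w)^T) i j].

Definition eigenvalue_assumption (H : R -> R) (c1 : R)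
    (rho F : R -> borel_cV R p -> R) : Prop :=
  (forall a, eigenvalue (V_mx rho F) a -> c1^-1 < a < c1) /\
  (forall a, eigenvalue (Vs_mx H rho) a -> c1^-1 < a < c1).

Definition subgaussian_assumption (eta C : R) : Prop :=
  (ereal_sup [set 'E_P[fun w => expR (eta * dotp v (Z w) ^+ 2)]
               | v in [set v : 'cV[R]_p | l2norm v = 1%R]] <= C%:E)%E.

Definition msm_estimator (H : R -> R) (h : nat -> R) (t : nat)
    (w : br_space M) : 'cV[R]_p :=
  sms_iter H (fun i => br_ys i w) (fun i => br_xs M i w) (fun i => br_zs M i w)
    h (br_beta0 M w) t.

End model.

Definition bandwidth (R : realType) (alpha n m p t : nat) : R :=
  Num.max ((p%:R / n%:R) `^ (2 * alpha + 1)%:R^-1)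
          ((p%:R / m%:R) `^ ((2 ^ t)%:R / (3 * alpha)%:R)).

(* Main.v *)
Require Import Defs.
From HB Require Import structures.
From mathcomp Require Import all_boot all_order all_algebra.
From mathcomp Require Import all_classical all_reals all_analysis.
From mathcomp Require Import measurable_realfun.
From mathcomp Require Import ring lra.

Set Implicit Arguments.
Unset Strict Implicit.
Unset Printing Implicit Defensive.

Import Order.TTheory GRing.Theory Num.Theory.
Import numFieldNormedType.Exports.

Local Open Scope classical_set_scope.
Local Open Scope ring_scope.

(** One Newton step from a point at distance [r] of the true parameter [beta] ends at a distance at
    most a constant times [|grad F_h(beta)| + r (dev + r)], where [dev] is the deviation of the
    empirical Hessian from its mean, taken uniformly over the unit ball around [beta]. This is the
    mean value theorem for the gradient between [beta] and the current point, combined with the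
    coercivity that the Hessian inherits from [V] ([newton_step_bound]). Because [dev] is uniform,
    the same sample serves in every iteration and the initial estimator may depend on it.

    The means come from the conditional law. Given [Z] and [zeta = t], the mean of [-Y] is
    [2 F(-t|Z) - 1], so expectations become integrals against the signed density
    [q(t) = (2 F(-t|Z) - 1) rho(t|Z)] ([sign_formula], [density_formula], [bias_expectation]). The
    zero median gives [q(0) = 0], and with the vanishing moments of [H'] the mean gradient at [beta]
    is [O(h^alpha)] ([smooth_gradient_bias]). The function [H''] has integral 0 and first moment -1,
    so the mean Hessian is [V + O(h)] at [beta] and Lipschitz in the parameter, with a constant free
    of [h] ([smooth_bias], [smooth_bias_lip]).

    For the fluctuations, a summand at [beta + d] vanishes outside the slab [|zeta + d^T Z| < h], of
    probability [O(h)]. Gradient summands have size [1/h], hence variance [O(1/h)], and Markov's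
    inequality yields [sqrt(p/(n h))] ([grad_deviation]). Hessian summands have size [1/h^2], hence
    variance [O(h^-3)]; a Chernoff bound on a net of parameters and directions yields
    [dev = O(sqrt(p log n/(n h^3)))] ([hess_uniform]).

    Put [u = (p/n)^(1/(2 alpha + 1))], [v = (p/m)^(1/3)] and [D = u^(alpha-1) sqrt(log n)]. Since
    [h_t >= u], the two fluctuations are at most [u^alpha] and [D] up to constants, and [h_t^alpha]
    is the larger of [u^alpha] and [v^(2^t)]. The error therefore satisfies [r_t <= C (u^alpha +
    v^(2^t) + r_(t-1) D + r_(t-1)^2)] with [r_0 = v], and the announced rate is stable under this
    recursion ([error_rate_next]). The growth condition on [p] sends [u], [v] and
    [u^(2 alpha - 2) (log n)^5] to 0, which makes one step valid for large [n] ([asymptotic_regime],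
    [iterate_step]); induction on [t] concludes ([iterate_OP]). *)

(** * Integrals of functions that are not known to be measurable *)

Section ae_eq_nonmeasurable.
Local Open Scope ereal_scope.
Context d (T : measurableType d) (R : realType).
Variable mu : {measure set T -> \bar R}.
Import HBNNSimple.

(** The integral of a nonnegative function is a supremum over the simple functions below it,
    measurable or not. Cutting such a simple function off on the null set puts it below [g] and
    keeps its integral. This serves for fiberwise integrals and for [derive1 (F^~ z) 0], which come
    without a proof of measurability in [w]. *)
Lemma ae_le_integral_nonmeasurable (f g : T -> \bar R) :
  (forall w, 0 <= f w) -> (forall w, 0 <= g w) ->
  {ae mu, forall w, f w <= g w} -> \int[mu]_w f w <= \int[mu]_w g w.
Proof.
move=> f0 g0 [N [mN N0 sub]].
rewrite ge0_integralTE// [leRHS]ge0_integralTE//.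
apply: ge_ereal_sup => _ [h /= hf <-]; apply: ereal_sup_ubound => /=.
exists (proj_nnsfun h (measurableC mN)) => [w|].
  rewrite /= mindicE in_setC; have [wN|wN] := boolP (w \in N); rewrite /= ?mulr0// mulr1.
  apply: le_trans (hf w) _; apply: contrapT => fg.
  by move: wN; rewrite notin_setE; apply; apply: sub.
have E (k : {nnsfun T >-> R}) : sintegral mu k = \int[mu]_w (k w)%:E.
  by rewrite integral_nnsfun// patch_setT.
rewrite !E.
apply: ae_eq_integral => //.
- exact/measurable_EFinP.
- exact/measurable_EFinP.
exists N; split => // w /= wN; apply: contrapT => nw; apply: wN => _.
by rewrite mindicE in_setC memNset// mulr1.
Qed.

Lemma ae_eq_integral_nonmeasurable (f g : T -> \bar R) :
  {ae mu, forall w, f w = g w} -> \int[mu]_w f w = \int[mu]_w g w.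
Proof.
move=> fg; rewrite integralE [RHS]integralE.
have H (u v : T -> \bar R) : (forall w, 0 <= u w) -> (forall w, 0 <= v w) ->
    {ae mu, forall w, u w = v w} -> \int[mu]_w u w = \int[mu]_w v w.
  move=> u0 v0 uv; apply/eqP; rewrite eq_le !ae_le_integral_nonmeasurable//.
    by apply: filterS uv => w ->.
  by apply: filterS uv => w ->.
by congr (_ - _); apply: H => //; apply: filterS fg => w; rewrite ?funeposE ?funenegE => ->.
Qed.

End ae_eq_nonmeasurable.

(** * Equality of weighted image measures *)

Lemma measurable_weighted_indic d d' (T : measurableType d) (V : measurableType d')
    (R : realType) (a : T -> R) (W : T -> V) S :
  measurable_fun setT a -> measurable_fun setT W -> measurable S ->
  measurable_fun setT (fun x => (a x * \1_S (W x))%:E).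
Proof.
move=> ma mW mS; apply/measurable_EFinP/measurable_funM => //.
exact: measurableT_comp.
Qed.

Section weighted_laws.
Local Open Scope ereal_scope.
Context d1 d2 d (T1 : measurableType d1) (T2 : measurableType d2)
  (V : measurableType d) (R : realType).
Variables (m1 : {measure set T1 -> \bar R}) (m2 : {measure set T2 -> \bar R}).
Variables (a1 : T1 -> R) (a2 : T2 -> R) (W1 : T1 -> V) (W2 : T2 -> V).
Hypotheses (ma1 : measurable_fun setT a1) (ma2 : measurable_fun setT a2).
Hypotheses (mW1 : measurable_fun setT W1) (mW2 : measurable_fun setT W2).
Hypotheses (a10 : forall x, (0 <= a1 x)%R) (a20 : forall x, (0 <= a2 x)%R).
Import HBNNSimple.

Lemma weighted_nnsfun d' (T : measurableType d') (mu : {measure set T -> \bar R})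
    (a : T -> R) (W : T -> V) (g : {nnsfun V >-> R}) :
  measurable_fun setT a -> measurable_fun setT W -> (forall x, (0 <= a x)%R) ->
  \int[mu]_x (a x * g (W x))%:E =
  \sum_(k \in range g) k%:E * \int[mu]_x (a x * \1_(g @^-1` [set k]) (W x))%:E.
Proof.
move=> ma mW a0.
have mi k : measurable_fun setT (fun x => (a x * \1_(g @^-1` [set k]) (W x))%R).
  apply: measurable_funM => //; apply: measurableT_comp => //.
transitivity (\int[mu]_x \sum_(k \in range g)
    (k * (a x * \1_(g @^-1` [set k]) (W x)))%:E).
  apply: eq_integral => x _; rewrite [in LHS]fimfunE fsumEFin//; congr EFin.
  rewrite !fsbig_finite//= mulr_sumr; apply: eq_bigr => k _.
  by rewrite mulrCA.
have k0 k x : (0 <= k * (a x * \1_(g @^-1` [set k]) (W x)))%R.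
  by rewrite mulrCA mulr_ge0// -lee_fin EFinM nnfun_muleindic_ge0.
rewrite ge0_integral_fsum//; last 2 first.
- by move=> k; apply/measurable_EFinP; exact: measurable_funM.
- by move=> k x _; rewrite lee_fin.
apply: eq_fsbigr => k; rewrite inE => -[v _ gv].
under eq_integral do rewrite EFinM.
rewrite ge0_integralZl//.
- exact/measurable_EFinP.
- by move=> x _; rewrite lee_fin mulr_ge0.
- by rewrite lee_fin -gv fun_ge0.
Qed.

Hypothesis eq_sets : forall S, measurable S ->
  \int[m1]_x (a1 x * \1_S (W1 x))%:E = \int[m2]_x (a2 x * \1_S (W2 x))%:E.

Lemma weighted_lim d' (T : measurableType d') (mu : {measure set T -> \bar R})
    (a : T -> R) (W : T -> V) (g : V -> R) (mg : measurable_fun setT (EFin \o g)) :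
  measurable_fun setT a -> measurable_fun setT W -> (forall x, (0 <= a x)%R) ->
  (forall v, (0 <= g v)%R) ->
  \int[mu]_x (a x * g (W x))%:E =
  limn (fun n => \int[mu]_x (a x * nnsfun_approx measurableT mg n (W x))%:E).
Proof.
move=> ma mW a0 g0; rewrite -monotone_convergence//.
- apply: eq_integral => x _; apply/esym/cvg_lim => //.
  under eq_fun do rewrite EFinM.
  rewrite EFinM; apply: cvgeZl => //.
  by apply: (@cvg_nnsfun_approx _ _ _ _ _ (EFin \o g)) => // v _; rewrite lee_fin.
- move=> n; apply/measurable_EFinP/measurable_funM => //.
  exact: measurableT_comp.
- by move=> n x _; rewrite lee_fin mulr_ge0.
- move=> x _ n n' nn'; rewrite lee_fin ler_wpM2l//.
  exact/lefP/nd_nnsfun_approx.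
Qed.

Lemma ge0_weighted_ext (g : V -> R) : measurable_fun setT g ->
  (forall v, (0 <= g v)%R) ->
  \int[m1]_x (a1 x * g (W1 x))%:E = \int[m2]_x (a2 x * g (W2 x))%:E.
Proof.
move=> mg g0.
have mEg : measurable_fun setT (EFin \o g) by exact/measurable_EFinP.
rewrite !(weighted_lim _ mEg)//; congr (limn _); apply/funext => n.
rewrite !weighted_nnsfun//; apply: eq_fsbigr => k _; congr (_ * _).
by apply: eq_sets.
Qed.

(** Simple functions, then monotone limits, then positive and negative parts; since the weights are
    nonnegative, the parts of the product are the weight times the parts of [g]. *)
Lemma weighted_ext (g : V -> R) : measurable_fun setT g ->
  \int[m1]_x (a1 x * g (W1 x))%:E = \int[m2]_x (a2 x * g (W2 x))%:E.
Proof.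
move=> mg.
have posE (T : Type) (a : T -> R) (W : T -> V) : (forall x, (0 <= a x)%R) ->
    (fun x => (a x * g (W x))%:E)^\+ = (fun x => (a x * (Num.max (g (W x)) 0))%:E).
  by move=> a0; apply/funext => x; rewrite funeposE -EFin_max maxr_pMr// mulr0.
have negE (T : Type) (a : T -> R) (W : T -> V) : (forall x, (0 <= a x)%R) ->
    (fun x => (a x * g (W x))%:E)^\- = (fun x => (a x * (Num.max (- g (W x)) 0))%:E).
  move=> a0; apply/funext => x.
  by rewrite funenegE -EFinN -EFin_max -mulrN maxr_pMr// mulr0.
rewrite integralE [RHS]integralE !posE// !negE//; congr (_ - _).
- apply: (@ge0_weighted_ext (fun v => Num.max (g v) 0)%R).
    exact: measurable_maxr.
  by move=> v; rewrite le_max lexx orbT.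
- apply: (@ge0_weighted_ext (fun v => Num.max (- g v) 0)%R).
    by apply: measurable_maxr => //; exact: measurableT_comp.
  by move=> v; rewrite le_max lexx orbT.
Qed.

End weighted_laws.

Section weighted_generated.
Local Open Scope ereal_scope.
Context d1 d2 d (T1 : measurableType d1) (T2 : measurableType d2)
  (V : measurableType d) (R : realType).
Variables (m1 : {measure set T1 -> \bar R}) (m2 : {measure set T2 -> \bar R}).
Variables (a1 : T1 -> R) (a2 : T2 -> R) (W1 : T1 -> V) (W2 : T2 -> V).
Hypotheses (ma1 : measurable_fun setT a1) (ma2 : measurable_fun setT a2).
Hypotheses (mW1 : measurable_fun setT W1) (mW2 : measurable_fun setT W2).
Hypotheses (a10 : forall x, (0 <= a1 x)%R) (a20 : forall x, (0 <= a2 x)%R).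
Hypothesis fin1 : \int[m1]_x (a1 x)%:E < +oo.
Variable G : set (set V).
Hypotheses (mG : @measurable _ V = <<s G >>) (GI : setI_closed G) (GT : G setT).
Hypothesis eq_gen : forall S, G S ->
  \int[m1]_x (a1 x * \1_S (W1 x))%:E = \int[m2]_x (a2 x * \1_S (W2 x))%:E.

Let compl d' (T : measurableType d') (mu : {measure set T -> \bar R})
    (a : T -> R) (W : T -> V) S :
  measurable_fun setT a -> measurable_fun setT W -> (forall x, (0 <= a x)%R) ->
  measurable S -> \int[mu]_x (a x)%:E < +oo ->
  \int[mu]_x (a x * \1_(~` S) (W x))%:E =
  \int[mu]_x (a x)%:E - \int[mu]_x (a x * \1_S (W x))%:E.
Proof.
move=> ma mW a0 mS fin.
have le1 : \int[mu]_x (a x * \1_S (W x))%:E <= \int[mu]_x (a x)%:E.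
  apply: ge0_le_integral => //.
  - by move=> x _; rewrite lee_fin mulr_ge0.
  - by apply: measurable_weighted_indic.
  - exact/measurable_EFinP.
  - by move=> x _; rewrite lee_fin ler_piMr// indicE; case: (_ \in _).
have D : \int[mu]_x (a x)%:E =
    \int[mu]_x (a x * \1_(~` S) (W x))%:E + \int[mu]_x (a x * \1_S (W x))%:E.
  rewrite -ge0_integralD//.
  - apply: eq_integral => x _; rewrite -EFinD -mulrDr !indicE in_setC.
    by case: (_ \in S); rewrite /= ?add0r ?addr0 mulr1.
  - by move=> x _; rewrite lee_fin mulr_ge0.
  - exact/measurable_weighted_indic/measurableC.
  - by move=> x _; rewrite lee_fin mulr_ge0.
  - by apply: measurable_weighted_indic.
have F : \int[mu]_x (a x * \1_S (W x))%:E \is a fin_num.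
  rewrite ge0_fin_numE; first exact: le_lt_trans fin.
  by apply: integral_ge0 => x _; rewrite lee_fin mulr_ge0.
by rewrite D addeK.
Qed.

(** Pi-lambda argument. Complements are handled by subtraction from the total mass, which [fin1]
    makes finite and [GT] makes equal on both sides. *)
Lemma weighted_gen_sets S : measurable S ->
  \int[m1]_x (a1 x * \1_S (W1 x))%:E = \int[m2]_x (a2 x * \1_S (W2 x))%:E.
Proof.
move=> mS.
have TE d' (T : measurableType d') (mu : {measure set T -> \bar R})
    (a : T -> R) (W : T -> V) :
    \int[mu]_x (a x * \1_setT (W x))%:E = \int[mu]_x (a x)%:E.
  by apply: eq_integral => x _; rewrite indicE in_setT mulr1.
have E12 : \int[m1]_x (a1 x)%:E = \int[m2]_x (a2 x)%:E.
  by rewrite -(TE _ _ _ _ W1) -(TE _ _ _ _ W2) eq_gen.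
apply: (@dynkin_induction _ V G (fun S =>
  \int[m1]_x (a1 x * \1_S (W1 x))%:E = \int[m2]_x (a2 x * \1_S (W2 x))%:E)) => //.
- exact: eq_gen.
- by move=> A mA EA; rewrite !compl// ?EA ?E12 -?E12.
- move=> A mA tA EA.
  have bigE d' (T : measurableType d') (mu : {measure set T -> \bar R})
    (a : T -> R) (W : T -> V) : measurable_fun setT a -> measurable_fun setT W ->
    (forall x, (0 <= a x)%R) -> \int[mu]_x (a x * \1_(\bigcup_k A k) (W x))%:E =
      \sum_(k <oo) \int[mu]_x (a x * \1_(A k) (W x))%:E.
    move=> ma mW a0; rewrite -integral_nneseries//.
    + apply: eq_integral => x _.
      under eq_eseriesr do rewrite EFinM.
      rewrite nneseriesZl; last by move=> i _; rewrite lee_fin.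
      rewrite EFinM; congr (_ * _).
      by rewrite indic_bigcup.
    + by move=> k; exact: measurable_weighted_indic.
    + by move=> k x _; rewrite lee_fin mulr_ge0.
  rewrite !bigE//; apply: eq_eseriesr => k _; exact: EA.
- by move: mS; rewrite mG.
Qed.

End weighted_generated.

(** * Conditional probabilities in Doob-Dynkin form *)

Section conditional.
Local Open Scope ereal_scope.
Context d d' (T : measurableType d) (V : measurableType d') (R : realType).
Variable P : probability T R.

(** Source of the almost sure comparisons below: it is applied to the event where a comparison
    fails, with [f] the amount of the failure. *)
Lemma pos_integral_le0_null (D : set T) (f : T -> R) : measurable D ->
  P.-integrable D (EFin \o f) -> (forall w, D w -> (0 < f w)%R) ->
  \int[P]_(w in D) (f w)%:E <= 0 -> P D = 0.
Proof.
move=> mD intf f0 le0.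
have mf : measurable_fun D (EFin \o f) by case/integrableP: intf.
have I0 : \int[P]_(w in D) `|(EFin \o f) w| = 0.
  apply/eqP; rewrite eq_le; apply/andP; split; last exact: integral_ge0.
  apply: le_trans le0; rewrite le_eqVlt; apply/orP; left; apply/eqP.
  by apply: eq_integral => w /[!inE] Dw /=; rewrite gtr0_norm// f0.
have [N [mN N0 sub]] := (ae_eq_integral_abs P mD mf).1 I0.
apply: (@subset_measure0 _ _ _ P D N) => //.
move=> w Dw; apply: sub => /= /(_ Dw) [fw0].
by have := f0 _ Dw; rewrite fw0 ltxx.
Qed.

Lemma measurable_preimage d1 d2 (T1 : measurableType d1) (T2 : measurableType d2)
  (f : T1 -> T2) B : measurable_fun setT f -> measurable B -> measurable (f @^-1` B).
Proof. by move=> mf mB; rewrite -[_ @^-1` _]setTI; exact: mf. Qed.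

Variables (W : T -> V) (mW : measurable_fun setT W).

Lemma cond_prob_ge0 A q : measurable A -> is_cond_prob P A W q ->
  {ae P, forall w, (0 <= q (W w))%R}.
Proof.
move=> mA [mq iq Eq].
pose B := [set v | (q v < 0)%R].
have mB : measurable B.
  by rewrite -[B]setTI; apply: (measurable_fun_ltr mq (measurable_cst _)).
exists (W @^-1` B); split.
- exact: measurable_preimage.
- apply: (@pos_integral_le0_null _ (fun w => - q (W w))%R).
  + exact: measurable_preimage.
  + apply: integrableS (integrableN iq) => //; exact: measurable_preimage.
  + by move=> w /=; rewrite oppr_gt0.
  + under eq_integral do rewrite EFinN.
    have iS : P.-integrable (W @^-1` B) (fun w => (q (W w))%:E).
      by apply: integrableS iq => //; exact: measurable_preimage.
    rewrite integralN; last by apply: (integrable_add_def _ iS); exact: measurable_preimage.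
    by rewrite -Eq// oppe_le0 measure_ge0.
- by move=> w /= /negP; rewrite -ltNge.
Qed.

Lemma cond_prob_unique A q1 q2 : measurable A ->
  is_cond_prob P A W q1 -> is_cond_prob P A W q2 ->
  {ae P, forall w, q1 (W w) = q2 (W w)}.
Proof.
move=> mA h1 h2.
suff H q q' : is_cond_prob P A W q -> is_cond_prob P A W q' ->
    {ae P, forall w, (q (W w) <= q' (W w))%R}.
  by move: (H _ _ h1 h2) (H _ _ h2 h1); apply: filterS2 => w ? ?; apply/eqP;
    rewrite eq_le; apply/andP.
move=> [mq iq Eq] [mq' iq' Eq'].
pose B := [set v | (q' v < q v)%R].
have mB : measurable B.
  by rewrite -[B]setTI; apply: (measurable_fun_ltr mq' mq).
have mWB : measurable (W @^-1` B) by exact: measurable_preimage.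
have sI g : P.-integrable setT (fun w => (g (W w))%:E) ->
    P.-integrable (W @^-1` B) (EFin \o (g \o W)).
  by apply: integrableS.
exists (W @^-1` B); split => //.
- have iB := sI _ iq; have iB' := sI _ iq'.
  apply: (@pos_integral_le0_null _ (fun w => q (W w) - q' (W w))%R) => //.
  + exact: (integrableB mWB iB iB').
  + by move=> w /=; rewrite subr_gt0.
  + have -> := integralB_EFin mWB iB iB'.
    by rewrite -[X in X - _]Eq// -[X in _ - X]Eq'// subee// fin_num_measure//;
      exact: measurableI.
- by move=> w /= /negP; rewrite -ltNge.
Qed.

Lemma indic_preimageE (S : set V) w : (\1_S (W w) : R) = \1_(W @^-1` S) w.
Proof. by rewrite !indicE; congr ((_ : bool)%:R); apply/idP/idP; rewrite !inE. Qed.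

(** The defining identity of [q] is the case of an indicator [phi], and [weighted_ext] extends it.
    Truncation at 0 makes [q] a genuine weight; it changes [q (W w)] on a null set only. *)
Lemma cond_prob_weight A q (phi : V -> R) : measurable A -> is_cond_prob P A W q ->
  measurable_fun setT phi ->
  \int[P]_w (Num.max (q (W w)) 0 * phi (W w))%:E =
  \int[P]_w (\1_A w * phi (W w))%:E.
Proof.
move=> mA hq mphi; have [mq iq Eq] := hq.
have mqW : measurable_fun setT (fun w => q (W w)) by exact: measurableT_comp.
have mmq : measurable_fun setT (fun w => Num.max (q (W w)) 0)%R by exact: measurable_maxr.
apply: weighted_ext => //.
- by move=> w; rewrite le_max lexx orbT.
- move=> S mS.
  transitivity (\int[P]_w (q (W w) * \1_S (W w))%:E).
    apply: ae_eq_integral => //.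
    + exact: measurable_weighted_indic.
    + exact: measurable_weighted_indic.
    + apply: filterS (cond_prob_ge0 mA hq) => w q0 _ /=.
      by rewrite max_l.
  transitivity (\int[P]_(w in W @^-1` S) (q (W w))%:E).
    rewrite [RHS]integral_mkcond; apply: eq_integral => w _.
    rewrite patchE indic_preimageE indicE.
    by case: (_ \in _); rewrite ?mulr1 ?mulr0.
  have mAS : measurable (A `&` W @^-1` S).
    by apply: measurableI => //; exact: measurable_preimage.
  rewrite -Eq// -[_ `&` _]setIT -integral_indic//; apply: eq_integral => w _.
  by rewrite indic_preimageE indicI.
Qed.

End conditional.

(** * Countable discretisation of a random threshold *)

Section discretisation.
Context (R : realType).

(** [pickle] codes the integer cell number by a natural, so that sums over cells are series over
    [nat]. *)
Definition grid_index (N : nat) (t : R) : nat := pickle (Num.floor (t * N.+1%:R)).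
Definition grid_val (N : nat) (k : nat) : R :=
  (odflt 0 (unpickle k : option int))%:~R / N.+1%:R.

Lemma grid_valP N t :
  grid_val N (grid_index N t) <= t < grid_val N (grid_index N t) + N.+1%:R^-1.
Proof.
rewrite /grid_val /grid_index pickleK/=.
have N0 : 0 < N.+1%:R :> R by [].
rewrite ler_pdivrMr// floor_le/=.
by rewrite -[X in _ + X]mul1r -mulrDl ltr_pdivlMr// -[1]/(1%:~R) -intrD floorD1_gt.
Qed.

Lemma measurable_grid_index N k : measurable [set t : R | grid_index N t = k].
Proof.
have N0 : 0 < N.+1%:R :> R by [].
case E : (unpickle k : option int) => [j|]; last first.
  rewrite (_ : [set _ | _] = set0)//; apply/seteqP; split => // t /= tk.
  by move: E; rewrite -tk /grid_index pickleK.
have [kj|kj] := eqVneq k (pickle j); last first.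
  rewrite (_ : [set _ | _] = set0)//; apply/seteqP; split => // t /= tk.
  move: E kj; rewrite -tk /grid_index pickleK => -[<-].
  by rewrite eqxx.
rewrite (_ : [set _ | _] = `[j%:~R / N.+1%:R, (j + 1)%:~R / N.+1%:R[%classic)//.
apply/seteqP; split => t /=; rewrite in_itv/= kj /grid_index.
  move=> /(pcan_inj pickleK) <-.
  by rewrite ler_pdivrMr// ltr_pdivlMr// floor_le floorD1_gt.
rewrite ler_pdivrMr// ltr_pdivlMr// => /andP[h1 h2]; congr pickle.
by apply: floor_def; rewrite h1.
Qed.

Lemma measurable_index_comp d d' (T : measurableType d) (V : measurableType d')
    (kap : T -> nat) (f : nat -> T -> V) :
  (forall k, measurable [set w | kap w = k]) ->
  (forall k, measurable_fun setT (f k)) ->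
  measurable_fun setT (fun w => f (kap w) w).
Proof.
move=> mk mf _ B mB; rewrite setTI.
rewrite (_ : _ @^-1` _ = \bigcup_k ([set w | kap w = k] `&` (f k @^-1` B))).
  by apply: bigcupT_measurable => k; apply: measurableI => //; exact: measurable_preimage.
by apply/seteqP; split => [w Bw|w [k _ [/= <-]]//]; exists (kap w).
Qed.

End discretisation.

(** * Conditional law of the noise given the covariates *)

Section latent_sign.
Local Open Scope ereal_scope.
Context d d' (T : measurableType d) (V : measurableType d') (R : realType).
Variable P : probability T R.
Variables (X eps : T -> R) (Z : T -> V) (F : R -> V -> R) (CF : R).
Hypotheses (mX : measurable_fun setT X) (meps : measurable_fun setT eps)
  (mZ : measurable_fun setT Z).
Hypothesis hind : cond_independent P eps X Z.
Hypothesis hcdf : forall u, is_cond_prob P [set w | (eps w <= u)%R] Z (F u).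
Hypothesis hgood : {ae P, forall w,
  (forall u, 0 <= F u (Z w) <= 1)%R /\
  (forall u v, `|F u (Z w) - F v (Z w)| <= CF * `|u - v|)%R}.

Let mXZ : measurable_fun setT (fun w => (X w, Z w)).
Proof. exact: measurable_fun_pair. Qed.

Let mF u : measurable_fun setT (F u). Proof. by have [] := hcdf u. Qed.

Lemma measurable_le_level u : measurable [set w | (eps w <= u)%R].
Proof.
rewrite -[[set _ | _]]setTI.
exact: (measurable_fun_ler meps (measurable_cst u)) measurableT _ _.
Qed.

(** It suffices to test on rectangles [A x B]. There the joint conditional probability is [q1 q2];
    [cond_prob_weight] is used forwards for the joint event and backwards for [X in A], leaving
    [q1], which equals [F u] almost surely by uniqueness. *)
Lemma cdf_indicator u (S : set (R * V)) : measurable S ->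
  \int[P]_w (\1_[set w | (eps w <= u)%R] w * \1_S (X w, Z w))%:E =
  \int[P]_w (Num.max (F u (Z w)) 0 * \1_S (X w, Z w))%:E.
Proof.
set A1 := [set w | _]; have mA1 : measurable A1 := measurable_le_level u.
have mFZ : measurable_fun setT (fun w => Num.max (F u (Z w)) 0)%R.
  by apply: measurable_maxr => //; exact: measurableT_comp.
apply: (@weighted_gen_sets _ _ _ _ _ _ _ P P _ _ (fun w => (X w, Z w))
  (fun w => (X w, Z w)) _ _ _ _ _ _ _
  [set A `*` B | A in [set A : set R | measurable A] & B in [set B : set V | measurable B]]).
- exact: measurable_indic.
- exact: mFZ.
- by [].
- by [].
- by [].
- by move=> w; rewrite le_max lexx orbT.
- rewrite integral_indic// setIT; exact: (le_lt_trans (probability_le1 _ _)) (ltry _).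
- exact: measurable_prod_measurableType.
- move=> _ _ [A mA [B mB <-]] [A' mA' [B' mB' <-]].
  exists (A `&` A'); first exact: measurableI.
  by exists (B `&` B'); [exact: measurableI|rewrite setXI].
- exists setT; first exact: measurableT.
  by exists setT; [exact: measurableT|rewrite setXTT].
move=> _ [A mA [B mB <-]].
have [q1 [q2 [h1 h2 h12]]] := hind (measurable_itv `]-oo, u]) mA.
have A1E : eps @^-1` `]-oo, u]%classic = A1 by apply/seteqP; split => w; rewrite /= in_itv.
rewrite A1E in h1 h12.
have mA2 : measurable (X @^-1` A) by exact: measurable_preimage.
have XE w : (\1_(A `*` B) (X w, Z w) : R) = (\1_(X @^-1` A) w * \1_B (Z w))%R.
  by rewrite !indicE in_setX -natrM mulnb.
have mq1 : measurable_fun setT (fun v => Num.max (q1 v) 0)%R.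
  by case: (h1) => m _ _; exact: measurable_maxr.
have mq2 : measurable_fun setT (fun v => Num.max (q2 v) 0)%R.
  by case: (h2) => m _ _; exact: measurable_maxr.
have mq12 : measurable_fun setT (fun v => Num.max (q1 v * q2 v) 0)%R.
  by case: (h12) => m _ _; exact: measurable_maxr.
have mi S' : measurable S' -> measurable_fun setT (fun w => \1_S' (Z w) : R).
  by move=> ?; exact: measurableT_comp.
have mw (f : T -> R) : measurable_fun setT f -> measurable_fun setT (EFin \o f).
  by move=> ?; exact/measurable_EFinP.
transitivity (\int[P]_w (\1_(A1 `&` X @^-1` A) w * \1_B (Z w))%:E).
  by apply: eq_integral => w _; rewrite XE indicI mulrA.
have mA12 : measurable (A1 `&` X @^-1` A) by exact: measurableI.
rewrite -(cond_prob_weight mZ mA12 h12 (phi := \1_B))//.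
transitivity (\int[P]_w (Num.max (q2 (Z w)) 0 *
    (Num.max (q1 (Z w)) 0 * \1_B (Z w)))%:E).
  apply: ae_eq_integral => //.
  - apply: mw; apply: measurable_funM; last exact: mi.
    exact: (measurableT_comp mq12).
  - apply: mw; apply: measurable_funM; first exact: (measurableT_comp mq2).
    apply: measurable_funM; last exact: mi.
    exact: (measurableT_comp mq1).
  - apply: filterS2 (cond_prob_ge0 mZ mA1 h1) (cond_prob_ge0 mZ mA2 h2).
    move=> w q10 q20 _ /=; congr EFin.
    rewrite (max_l q10) (max_l q20) max_l ?mulr_ge0// mulrCA.
    by rewrite mulrA.
rewrite (cond_prob_weight mZ mA2 h2 (phi := fun v => Num.max (q1 v) 0 * \1_B v)%R);
  last exact: measurable_funM.
apply: ae_eq_integral => //.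
- apply: mw; apply: measurable_funM; first exact: measurable_indic.
  apply: measurable_funM; last exact: mi.
  exact: (measurableT_comp mq1).
- apply: mw; apply: measurable_funM => //.
  under eq_fun do rewrite XE.
  by apply: measurable_funM; [exact: measurable_indic|exact: mi].
apply: filterS (cond_prob_unique mZ mA1 h1 (hcdf u)) => w E _ /=.
by rewrite XE E mulrCA.
Qed.

(** The threshold is constant on each of the countably many cells [S_ k], where the identity for a
    fixed level applies. *)
Lemma cdf_indicator_index (kap : R * V -> nat) (s : nat -> R) (S : set (R * V)) :
  (forall k, measurable [set v | kap v = k]) -> measurable S ->
  \int[P]_w (\1_[set w | (eps w <= s (kap (X w, Z w)))%R] w * \1_S (X w, Z w))%:E =
  \int[P]_w (Num.max (F (s (kap (X w, Z w))) (Z w)) 0 * \1_S (X w, Z w))%:E.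
Proof.
move=> mk mS.
pose S_ k := S `&` [set v | kap v = k].
have mS_ k : measurable (S_ k) by exact: measurableI.
have SE : S = \bigcup_k S_ k.
  by apply/seteqP; split => [v Sv|v [k _ []]//]; exists (kap v).
have tS : trivIset setT S_ by move=> i j _ _ [v [[_ <-] [_ <-]]].
have mF' k : measurable_fun setT (fun w => Num.max (F (s k) (Z w)) 0)%R.
  by apply: measurable_maxr => //; exact: measurableT_comp.
have split_sum (g : nat -> T -> R) : (forall k, measurable_fun setT (g k)) ->
   (forall k w, (0 <= g k w)%R) ->
   \int[P]_w (g (kap (X w, Z w)) w * \1_S (X w, Z w))%:E =
   \sum_(k <oo) \int[P]_w (g k w * \1_(S_ k) (X w, Z w))%:E.
  move=> mg g0; rewrite -integral_nneseries//.
  - apply: eq_integral => w _; rewrite EFinM {1}SE indic_bigcup//.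
    have i0 k : 0 <= (\1_(S_ k) (X w, Z w))%:E :> \bar R by rewrite lee_fin.
    rewrite -nneseriesZl; last by move=> k _; exact: i0.
    apply: eq_eseriesr => k _; rewrite -EFinM; congr EFin.
    rewrite indicE; have [|] := boolP (_ \in S_ k); last by rewrite !mulr0.
    by rewrite /S_ inE => -[_ <-].
  - by move=> k; exact: measurable_weighted_indic.
  - by move=> k w _; rewrite lee_fin mulr_ge0.
rewrite (split_sum (fun k w => \1_[set w | (eps w <= s k)%R] w))//; last first.
  by move=> k; apply: measurable_indic; exact: measurable_le_level.
rewrite (split_sum (fun k w => Num.max (F (s k) (Z w)) 0%R))//; last first.
  by move=> k w; rewrite le_max lexx orbT.
by apply: eq_eseriesr => k _; exact: cdf_indicator.
Qed.

End latent_sign.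

Section cdf_modification.
Context d' (V : measurableType d') (R : realType) (F : R -> V -> R).

(* Jointly measurable version of a conditional c.d.f.: [F] itself is continuous in
   its first argument only outside a null set. *)
Definition cdf_mod (t : R) (z : V) : R :=
  Num.max 0 (Num.min 1 (fine (limn_esup
    (fun N => (F (grid_val R N (grid_index N t)) z)%:E)))).

Lemma cdf_mod_ge0 t z : 0 <= cdf_mod t z.
Proof. by rewrite le_max lexx. Qed.

Lemma cdf_mod_le1 t z : cdf_mod t z <= 1.
Proof. by rewrite ge_max ler01 ge_min lexx. Qed.

Lemma measurable_cdf_mod : (forall u, measurable_fun setT (F u)) ->
  measurable_fun setT (fun v : R * V => cdf_mod v.1 v.2).
Proof.
move=> mF; apply: measurable_maxr => //; apply: measurable_minr => //.
apply: measurableT_comp => //.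
apply: measurable_fun_limn_esup => N; apply/measurable_EFinP.
apply: (measurable_index_comp (kap := fun v : R * V => grid_index N v.1)
  (f := fun k (v : R * V) => F (grid_val R N k) v.2)).
- move=> k; apply: (measurable_preimage (f := fst) (B := [set t | grid_index N t = k])) => //.
  exact: measurable_grid_index.
- by move=> k; exact: measurableT_comp.
Qed.

Lemma cdf_modE (CF : R) z : (forall u, 0 <= F u z <= 1) ->
  (forall u v, `|F u z - F v z| <= CF * `|u - v|) -> forall t, cdf_mod t z = F t z.
Proof.
move=> F01 FL t; rewrite /cdf_mod.
have CF0 : 0 <= CF.
  by have := FL 1 0; rewrite subr0 normr1 mulr1; apply: le_trans.
have cv : (fun N => F (grid_val R N (grid_index N t)) z) @ \oo --> F t z.
  apply/cvgrPdist_le => e e0.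
  have h0 : 0 < e / (CF + 1) by rewrite divr_gt0// ltr_wpDl.
  apply: filterS (near_infty_natSinv_lt (PosNum h0)) => N /= hN.
  apply: le_trans (FL _ _) _; have /andP[h1 h2] := grid_valP N t.
  rewrite ger0_norm ?subr_ge0//.
  move: hN; rewrite ltr_pdivlMr ?ltr_wpDl// => hN.
  apply: (@le_trans _ _ (CF * N.+1%:R^-1)); first by rewrite ler_wpM2l// lerBlDl ltW.
  apply: le_trans (ltW hN); rewrite mulrC ler_wpM2l// lerDl ler01//.
have -> : limn_esup (fun N => (F (grid_val R N (grid_index N t)) z)%:E) = (F t z)%:E.
  have cvE : (fun N => (F (grid_val R N (grid_index N t)) z)%:E) @ \oo --> (F t z)%:E.
    by apply: cvg_EFin; [exact: nearW|exact: cv].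
  rewrite is_cvg_limn_esupE; last by apply/cvg_ex; eexists; exact: cvE.
  exact/cvg_lim.
have /andP[F0 F1] := F01 t.
by rewrite /= min_r// max_r.
Qed.

End cdf_modification.

Section sign_formula.
Local Open Scope ereal_scope.
Context d d' (T : measurableType d) (V : measurableType d') (R : realType).
Variable P : probability T R.
Variables (X eps : T -> R) (Z : T -> V) (F : R -> V -> R) (CF : R).
Hypotheses (mX : measurable_fun setT X) (meps : measurable_fun setT eps)
  (mZ : measurable_fun setT Z).
Hypothesis hind : cond_independent P eps X Z.
Hypothesis hcdf : forall u, is_cond_prob P [set w | (eps w <= u)%R] Z (F u).
Hypothesis hgood : {ae P, forall w,
  (forall u, 0 <= F u (Z w) <= 1)%R /\
  (forall u v, `|F u (Z w) - F v (Z w)| <= CF * `|u - v|)%R}.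
Variable (tau : R * V -> R).
Hypothesis mtau : measurable_fun setT tau.

Let mF u : measurable_fun setT (F u). Proof. by have [] := hcdf u. Qed.
Let mXZ : measurable_fun setT (fun w => (X w, Z w)).
Proof. exact: measurable_fun_pair. Qed.
Let tw w := tau (X w, Z w).
Let mtw : measurable_fun setT tw. Proof. exact: measurableT_comp. Qed.
Let mlt : measurable [set w | (eps w < tw w)%R].
Proof. by rewrite -[[set _ | _]]setTI; exact: measurable_fun_ltr. Qed.

Let kap N (v : R * V) := grid_index N (tau v).
Let mkap N k : measurable [set v | kap N v = k].
Proof.
apply: (measurable_preimage (f := tau) (B := [set t | grid_index N t = k])) => //.
exact: measurable_grid_index.
Qed.
Let gv N w := grid_val R N (kap N (X w, Z w)).
Let mgv N : measurable_fun setT (gv N).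
Proof.
apply: (measurable_index_comp (kap := fun w => kap N (X w, Z w))
  (f := fun k _ => grid_val R N k)) => // k.
exact: (measurable_preimage mXZ (mkap N k)).
Qed.
Let gvP N w : (gv N w <= tw w < gv N w + N.+1%:R^-1)%R.
Proof. exact: grid_valP. Qed.

Let cm w := cdf_mod F (tw w) (Z w).
Let mcm : measurable_fun setT cm.
Proof.
apply: (measurableT_comp (measurable_cdf_mod mF) (g := fun w => (tw w, Z w))).
exact: measurable_fun_pair.
Qed.

Let CF0 : (0 <= CF)%R.
Proof.
(* The sign of [CF] is read off at one good point; such a point exists because the whole space is
   not a null set. *)
have [w [_ L]] : exists w, ((forall u, 0 <= F u (Z w) <= 1)%R /\
  (forall u v, `|F u (Z w) - F v (Z w)| <= CF * `|u - v|)%R).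
  case: hgood => N [mN N0 sub]; apply: contrapT => /forallNP h.
  have NT : N = setT by apply/seteqP; split => // w _; apply: sub => /= /h.
  by move: N0; rewrite NT probability_setT => /eqP; rewrite onee_eq0.
by have := L 1%R 0%R; rewrite subr0 normr1 mulr1; apply: le_trans.
Qed.

Let shifted N (s : R) S : measurable S ->
  \int[P]_w (\1_[set w | (eps w <= gv N w + s)%R] w * \1_S (X w, Z w))%:E =
  \int[P]_w (Num.max (F (gv N w + s) (Z w)) 0 * \1_S (X w, Z w))%:E.
Proof.
move=> mS.
exact: (cdf_indicator_index mX meps mZ hind hcdf
  (kap := kap N) (fun k => grid_val R N k + s)%R).
Qed.

Let msh N s : measurable [set w | (eps w <= gv N w + s)%R].
Proof.
rewrite -[[set _ | _]]setTI; apply: measurable_fun_ler => //.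
exact: measurable_funD.
Qed.

Let mFsh N s : measurable_fun setT (fun w => Num.max (F (gv N w + s) (Z w)) 0%R).
Proof.
apply: measurable_maxr => //.
apply: (measurable_index_comp (kap := fun w => kap N (X w, Z w))
  (f := fun k w => F (grid_val R N k + s) (Z w))) => k.
  exact: (measurable_preimage mXZ (mkap N k)).
exact: measurableT_comp.
Qed.

Let mS1 S : measurable S -> measurable_fun setT (fun w => \1_S (X w, Z w) : R).
Proof. by move=> mS; exact: measurableT_comp. Qed.

Let gap (c : R) (a b : \bar R) :
  (forall N, a <= b + (c * N.+1%:R^-1)%:E) -> a <= b.
Proof.
move=> h; apply/lee_addgt0Pr => e e0.
have [c0|c0] := leP c 0%R.
  apply: le_trans (h 0%N) _; rewrite leeD2l// lee_fin.
  by rewrite (le_trans _ (ltW e0))// mulr_le0_ge0.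
have h0 : (0 < c^-1 * e)%R by rewrite mulr_gt0// invr_gt0.
have [N _ /(_ N (leqnn N))] := near_infty_natSinv_lt (PosNum h0); rewrite /=.
rewrite ltr_pdivlMl// => hN; apply: le_trans (h N) _.
by rewrite leeD2l// lee_fin ltW.
Qed.

(** Sandwich: [eps <= gv - 1/(N+1)] implies [eps < tau], which implies [eps <= gv + 1/(N+1)], and
    both outer thresholds take countably many values. They lie within two steps, respectively one
    step, of [tau], so the Lipschitz bound on [F] leaves errors [2 CF/(N+1)] and [CF/(N+1)], which
    vanish as [N] grows. *)
Lemma sign_formula_sets S : measurable S ->
  \int[P]_w (\1_[set w | (eps w < tw w)%R] w * \1_S (X w, Z w))%:E =
  \int[P]_w (cm w * \1_S (X w, Z w))%:E.
Proof.
move=> mS; have m1 := mS1 mS.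
have mE (f : T -> R) : measurable_fun setT f ->
    measurable_fun setT (fun w => (f w * \1_S (X w, Z w))%:E).
  by move=> mf; apply/measurable_EFinP; exact: measurable_funM.
have cS (c : R) : (0 <= c)%R -> \int[P]_w c%:E = c%:E.
  move=> c0; rewrite integral_cst//; have /= -> := probability_setT P.
  by rewrite mule1.
have Nge0 N : (0 <= (N.+1%:R : R)^-1)%R by rewrite invr_ge0.
have addc (c : R) (f : T -> R) : (0 <= c)%R -> measurable_fun setT f ->
    (forall w, (0 <= f w)%R) ->
    \int[P]_w (f w * \1_S (X w, Z w) + c)%:E =
    \int[P]_w (f w * \1_S (X w, Z w))%:E + c%:E.
  move=> c0 mf f0; under eq_integral do rewrite EFinD.
  rewrite ge0_integralD//; first by rewrite cS.
  - by move=> w _; rewrite lee_fin mulr_ge0.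
  - exact: mE.
apply/eqP; rewrite eq_le; apply/andP; split.
- apply: (gap (c := CF)) => N.
  apply: (@le_trans _ _ (\int[P]_w
      (\1_[set w | (eps w <= gv N w + N.+1%:R^-1)%R] w * \1_S (X w, Z w))%:E)).
    apply: ge0_le_integral; first exact: measurableT.
    + by move=> w _; rewrite lee_fin mulr_ge0.
    + by apply: mE; exact: measurable_indic.
    + by apply: mE; apply: measurable_indic; exact: msh.
    + move=> w _; rewrite lee_fin ler_wpM2r// !indicE ler_nat.
      case: (boolP (w \in _)) => //; rewrite inE /= => ew.
      rewrite mem_set//=; have /andP[_ h] := gvP N w.
      by rewrite (ltW (lt_trans ew h)).
  rewrite shifted// -addc ?mulr_ge0//; last by move=> w; exact: cdf_mod_ge0.
  apply: ae_ge0_le_integral; first exact: measurableT.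
  + by move=> w _; rewrite lee_fin mulr_ge0// le_max lexx orbT.
  + by apply: mE; exact: mFsh.
  + by move=> w _; rewrite lee_fin addr_ge0// ?mulr_ge0// cdf_mod_ge0.
  + by apply/measurable_EFinP; apply: measurable_funD => //; exact: measurable_funM.
  apply: filterS hgood => w [F01 FL] _; rewrite lee_fin /cm (cdf_modE F01 FL).
  have /andP[F0 _] := F01 (gv N w + N.+1%:R^-1)%R; rewrite max_l//.
  rewrite [leLHS](_ : _ = F (tw w) (Z w) * \1_S (X w, Z w) +
    (F (gv N w + N.+1%:R^-1) (Z w) - F (tw w) (Z w)) * \1_S (X w, Z w))%R; last by ring.
  rewrite lerD2l; apply: le_trans (ler_norm _) _; rewrite normrM.
  apply: (@le_trans _ _ (`|F (gv N w + N.+1%:R^-1) (Z w) - F (tw w) (Z w)| * 1)%R).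
    by rewrite ler_wpM2l// indicE; case: (_ \in _); rewrite ?normr1 ?normr0.
  rewrite mulr1; apply: le_trans (FL _ _) _; rewrite ler_wpM2l//.
  have /andP[h1 h2] := gvP N w.
  move: h1 h2 (Nge0 N); move: (gv N w) (tw w) (N.+1%:R^-1)%R => a b c h1 h2 c0.
  by rewrite ler_norml; apply/andP; split; lra.
- apply: (gap (c := CF * 2)) => N.
  apply: (@le_trans _ _ (\int[P]_w
      (\1_[set w | (eps w <= gv N w - N.+1%:R^-1)%R] w * \1_S (X w, Z w))%:E
      + (CF * 2 * N.+1%:R^-1)%:E)); last first.
    rewrite leeD2r//; apply: ge0_le_integral; first exact: measurableT.
    + by move=> w _; rewrite lee_fin mulr_ge0.
    + by apply: mE; apply: measurable_indic; exact: msh.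
    + by apply: mE; exact: measurable_indic.
    + move=> w _; rewrite lee_fin ler_wpM2r// !indicE ler_nat.
      case: (boolP (w \in _)) => //; rewrite inE /= => ew.
      rewrite mem_set//=; have /andP[h _] := gvP N w.
      apply: le_lt_trans ew _; apply: lt_le_trans h.
      by rewrite ltrBlDr ltrDl invr_gt0.
  rewrite shifted// -addc ?mulr_ge0//; last by move=> w; rewrite le_max lexx orbT.
  apply: ae_ge0_le_integral; first exact: measurableT.
  + by move=> w _; rewrite lee_fin mulr_ge0// cdf_mod_ge0.
  + exact: mE.
  + by move=> w _; rewrite lee_fin addr_ge0// ?mulr_ge0// le_max lexx orbT.
  + by apply/measurable_EFinP; apply: measurable_funD => //; exact: measurable_funM.
  apply: filterS hgood => w [F01 FL] _; rewrite lee_fin /cm (cdf_modE F01 FL).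
  have /andP[F0 _] := F01 (gv N w - N.+1%:R^-1)%R; rewrite max_l//.
  rewrite [leLHS](_ : _ = F (gv N w - N.+1%:R^-1) (Z w) * \1_S (X w, Z w) +
    (F (tw w) (Z w) - F (gv N w - N.+1%:R^-1) (Z w)) * \1_S (X w, Z w))%R; last by ring.
  rewrite lerD2l; apply: le_trans (ler_norm _) _; rewrite normrM.
  apply: (@le_trans _ _ (`|F (tw w) (Z w) - F (gv N w - N.+1%:R^-1) (Z w)| * 1)%R).
    by rewrite ler_wpM2l// indicE; case: (_ \in _); rewrite ?normr1 ?normr0.
  rewrite mulr1; apply: le_trans (FL _ _) _; rewrite -mulrA ler_wpM2l//.
  have /andP[h1 h2] := gvP N w.
  move: h1 h2 (Nge0 N); move: (gv N w) (tw w) (N.+1%:R^-1)%R => a b c h1 h2 c0.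
  by rewrite ler_norml; apply/andP; split; lra.
Qed.

Lemma sign_formula (g : R * V -> R) : measurable_fun setT g ->
  \int[P]_w (\1_[set w | (eps w < tau (X w, Z w))%R] w * g (X w, Z w))%:E =
  \int[P]_w (cdf_mod F (tau (X w, Z w)) (Z w) * g (X w, Z w))%:E.
Proof.
move=> mg; apply: (weighted_ext (W1 := fun w => (X w, Z w)) (W2 := fun w => (X w, Z w))) => //.
- by move=> w; exact: cdf_mod_ge0.
- exact: sign_formula_sets.
Qed.

End sign_formula.

(** * Integration against the conditional density *)

Section density_formula.
Local Open Scope ereal_scope.
Context d d' (T : measurableType d) (V : measurableType d') (R : realType).
Variable P : probability T R.
Local Notation mu := (@lebesgue_measure R).
Variables (zeta : T -> R) (Z : T -> V) (rho : R -> V -> R).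
Hypotheses (mzeta : measurable_fun setT zeta) (mZ : measurable_fun setT Z).
Hypothesis hrho : is_cond_density P zeta Z rho.

(** [rho] is nonnegative only for almost every value of [Z]; truncation makes it a weight on the
    whole product space. *)
Definition dens_weight (wt : T * R) : R := Num.max (rho wt.2 (Z wt.1)) 0%R.

Lemma measurable_swap_comp (g : R * V -> R) : measurable_fun setT g ->
  measurable_fun setT (fun wt : T * R => g (wt.2, Z wt.1)).
Proof.
move=> mg; apply: (measurableT_comp mg (g := fun wt : T * R => (wt.2, Z wt.1))).
by apply: measurable_fun_pair => //; exact: measurableT_comp.
Qed.

Lemma measurable_dens_weight : measurable_fun setT dens_weight.
Proof.
have [mr _ _] := hrho; apply: measurable_maxr => //.
exact: (measurable_swap_comp mr).
Qed.

Lemma dens_weight_ge0 wt : (0 <= dens_weight wt)%R.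
Proof. by rewrite le_max lexx orbT. Qed.

Lemma density_formula (g : R * V -> R) : measurable_fun setT g ->
  \int[P]_w (g (zeta w, Z w))%:E =
  \int[P \x mu]_wt (dens_weight wt * g (wt.2, Z wt.1))%:E.
Proof.
move=> mg; have [mr r0 hr] := hrho.
have mpair : measurable_fun setT (fun w => (zeta w, Z w)) by exact: measurable_fun_pair.
have mswap : measurable_fun setT (fun wt : T * R => (wt.2, Z wt.1)).
  by apply: measurable_fun_pair => //; exact: measurableT_comp.
transitivity (\int[P]_w (1 * g (zeta w, Z w))%:E).
  by apply: eq_integral => w _; rewrite mul1r.
apply: (@weighted_ext _ _ _ _ _ _ _ P (P \x mu) (fun=> 1%R) dens_weight
  (fun w => (zeta w, Z w)) (fun wt => (wt.2, Z wt.1))) => //.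
- exact: measurable_dens_weight.
- exact: dens_weight_ge0.
apply: (@weighted_gen_sets _ _ _ _ _ _ _ P (P \x mu) (fun=> 1%R) dens_weight
  (fun w => (zeta w, Z w)) (fun wt => (wt.2, Z wt.1)) _ _ _ _ _ _ _
  [set A `*` B | A in [set A : set R | measurable A] & B in [set B : set V | measurable B]]).
- exact: measurable_cst.
- exact: measurable_dens_weight.
- exact: mpair.
- exact: mswap.
- by move=> w; exact: ler01.
- exact: dens_weight_ge0.
- rewrite integral_cst//; have /= -> := probability_setT P.
  by rewrite mule1 ltry.
- exact: measurable_prod_measurableType.
- move=> _ _ [A mA [B mB <-]] [A' mA' [B' mB' <-]].
  exists (A `&` A'); first exact: measurableI.
  by exists (B `&` B'); [exact: measurableI|rewrite setXI].
- exists setT; first exact: measurableT.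
  by exists setT; [exact: measurableT|rewrite setXTT].
move=> _ [A mA [B mB <-]].
have mZB : measurable (Z @^-1` B) by exact: measurable_preimage.
have mzA : measurable (zeta @^-1` A) by exact: measurable_preimage.
transitivity (P (zeta @^-1` A `&` Z @^-1` B)).
  rewrite -[X in P X]setIT -integral_indic//; last exact: measurableI.
  apply: eq_integral => w _; rewrite mul1r indicI !indicE in_setX/= -mulnb natrM.
  by congr (_ * _)%:E; rewrite ?indicE; congr ((_ : bool)%:R); apply/idP/idP; rewrite !inE.
rewrite hr// fubini_tonelli1; last 2 first.
- apply/measurable_EFinP/measurable_funM; first exact: measurable_dens_weight.
  apply: (measurable_swap_comp (g := \1_(A `*` B))).
  by apply: measurable_indic; exact: measurableX.
- by move=> wt; rewrite lee_fin mulr_ge0// dens_weight_ge0.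
(* Truncated and original densities have equal fiber integrals for almost every [w]; no
   measurability in [w] has been established for the latter. *)
rewrite integral_mkcond; apply: ae_eq_integral_nonmeasurable.
apply: filterS r0 => w rw; rewrite patchE.
have XE t : (\1_(A `*` B) (t, Z w) : R) = (\1_A t * \1_(Z @^-1` B) w)%R.
  by rewrite !indicE in_setX -mulnb natrM.
rewrite /fubini_F /dens_weight /=; under [RHS]eq_integral do rewrite XE max_l//.
rewrite indicE; case: (w \in _); last first.
  by under eq_integral do rewrite !mulr0; rewrite integral0.
rewrite [LHS]integral_mkcond; apply: eq_integral => t _; rewrite patchE mulr1 indicE.
by case: (t \in A); rewrite ?mulr1 ?mulr0.
Qed.

End density_formula.

(** * Mean value and Taylor estimates *)

Section calculus.
Context (R : realType).
Implicit Types f g : R -> R.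

Lemma derivable_is_derive f x : derivable f x 1 -> is_derive x 1 f (derive1 f x).
Proof. by move=> df; rewrite derive1E; exact: DeriveDef. Qed.

Lemma derivable_continuous f : (forall x, derivable f x 1) -> continuous f.
Proof. by move=> df x; apply: differentiable_continuous; exact/derivable1_diffP. Qed.

Lemma mvt_between f x y : (forall x, derivable f x 1) ->
  exists2 c, f y - f x = derive1 f c * (y - x) & `|c - x| <= `|y - x|.
Proof.
move=> df.
have cf a b : {within `[a, b], continuous f}.
  by apply: continuous_subspaceT; exact: derivable_continuous.
have [xy|yx] := leP x y.
  have [c] := MVT_segment xy (fun z _ => derivable_is_derive (df z)) (cf _ _).
  rewrite in_itv/= => /andP[xc cy] E; exists c => //.
  by rewrite !ger0_norm ?subr_ge0// lerB.
have [c] := MVT_segment (ltW yx) (fun z _ => derivable_is_derive (df z)) (cf _ _).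
rewrite in_itv/= => /andP[yc cx] E; exists c.
  by rewrite -opprB E -mulrN opprB.
by rewrite distrC [leRHS]distrC !ger0_norm ?subr_ge0 ?(ltW yx)// lerB.
Qed.

Lemma derive1_bound_lip f L : (forall x, derivable f x 1) ->
  (forall x, `|derive1 f x| <= L) -> forall x y, `|f x - f y| <= L * `|x - y|.
Proof.
move=> df fL x y; have [c -> _] := mvt_between y x df.
by rewrite normrM ler_wpM2r.
Qed.

Lemma bounded_derivativesS N C f : bounded_derivatives N.+1 C f ->
  bounded_derivatives N C (derive1 f).
Proof.
move=> h [//|j] jN x; have := h j.+2 jN x.
by rewrite -[j.+2.-1]/(j.+1) -[j.+1.-1]/j !derive1Sn.
Qed.

Definition taylor f N x : R := \sum_(k < N) derive1n k f 0 / (k`!)%:R * x ^+ k.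

(** Induction on the order: the derivative of the remainder of [f] is the remainder of [f'], and the
    mean value theorem adds one factor [|x|]. The usual factorial is given up in the constant. *)
Lemma taylor_bound n C f : bounded_derivatives n.+1 C f -> forall x,
  `|f x - taylor f n.+1 x| <= C * `|x| ^+ n.+1.
Proof.
elim: n f => [|n IH] f hf x.
  rewrite /taylor big_ord1 expr0 mulr1 fact0 divr1 expr1 -[`|x|]subr0 -[in leRHS](subr0 x) subr0.
  apply: derive1_bound_lip => y; first by have [] := hf 1%N isT y.
  by have [_ +] := hf 1%N isT y; rewrite derive1n1.
have dT y : is_derive y (1 : R) (taylor f n.+2) (taylor (derive1 f) n.+1 y).
  rewrite /taylor.
  have -> : (fun x => \sum_(k < n.+2) derive1n k f 0 / (k`!)%:R * x ^+ k) =
     \sum_(k < n.+2) ((derive1n k f 0 / (k`!)%:R) \*: (fun x : R => x ^+ k)).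
    by apply/funext => z; rewrite fct_sumE.
  have dX k : is_derive y (1 : R) (fun x : R => x ^+ k) (k%:R * y ^+ k.-1).
    apply: DeriveDef; first exact: exprn_derivable.
    by rewrite exp_derive [LHS]mulr1.
  have := is_derive_sum (fun k : 'I_n.+2 =>
    is_deriveZ (derive1n k f 0 / (k`!)%:R) (dX k)).
  move=> /is_derive_eq; apply; rewrite /taylor big_ord_recl/= mul0r scaler0 add0r.
  apply: eq_bigr => k _; rewrite -derive1Sn factS natrM /= -[_ *: _]/(_ * _).
  rewrite /bump/= add1n [derive1 _]/(derive1n k.+1 f).
  have k0 : (k`!)%:R != 0 :> R by rewrite pnatr_eq0 -lt0n fact_gt0.
  by field; rewrite k0 nat1r pnatr_eq0.
pose g y := f y - taylor f n.+2 y.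
have dg y : is_derive y (1 : R) g (derive1 f y - taylor (derive1 f) n.+1 y).
  apply: is_deriveB; apply: derivable_is_derive.
  by have [] := hf 1%N isT y.
have dg1 y : derivable g y 1 by have [] := dg y.
have [c] := mvt_between 0 x dg1.
rewrite !subr0 => E cx.
have g0 : g 0 = 0.
  rewrite /g /taylor big_ord_recl/= expr0 mulr1 fact0 divr1 big1 ?addr0 ?subrr//.
  by move=> i _; rewrite expr0n/= mulr0.
rewrite -/(g x) -[g x]subr0 -g0 E normrM derive1E.
have [_ ->] := dg c.
apply: (@le_trans _ _ (C * `|c| ^+ n.+1 * `|x|)).
  by rewrite ler_wpM2r//; apply: IH; exact: bounded_derivativesS.
have C0 : 0 <= C by have [_] := hf 1%N isT 0; apply: le_trans.
rewrite -mulrA ler_wpM2l// [leRHS]exprSr ler_wpM2r//.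
by apply: lerXn2r; rewrite ?nnegrE.
Qed.

End calculus.

(** * Support and moments of the kernel derivatives *)

Section kernel_facts.
Context (R : realType).
Local Notation mu := (@lebesgue_measure R).

Definition int11 (f : R -> R) : R := \int[mu]_(s in `[-1, 1]) f s.

Lemma integrable11 (f : R -> R) : continuous f -> mu.-integrable `[-1, 1] (EFin \o f).
Proof.
move=> cf; apply: continuous_compact_integrable; first exact: segment_compact.
exact: continuous_subspaceT.
Qed.

Lemma int11D (f g : R -> R) : continuous f -> continuous g ->
  int11 (fun s => f s + g s) = int11 f + int11 g.
Proof. by move=> cf cg; apply: RintegralD => //; exact: integrable11. Qed.

Lemma int11B (f g : R -> R) : continuous f -> continuous g ->
  int11 (fun s => f s - g s) = int11 f - int11 g.
Proof. by move=> cf cg; apply: RintegralB => //; exact: integrable11. Qed.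

Lemma int11Z (c : R) (f : R -> R) : continuous f -> int11 (fun s => c * f s) = c * int11 f.
Proof. by move=> cf; apply: RintegralZl => //; exact: integrable11. Qed.

Lemma continuous_sum_ord n (f : 'I_n -> R -> R) : (forall i, continuous (f i)) ->
  continuous (fun s => \sum_i f i s).
Proof.
elim: n f => [|n IH] f cf x.
  by under eq_fun do rewrite big_ord0; exact: cvg_cst.
under eq_fun do rewrite big_ord_recl.
rewrite ?big_ord_recl; apply: cvgD; first exact: cf.
by apply: (IH (fun i s => f (lift ord0 i) s)) => i; exact: cf.
Qed.

Lemma int11_sum n (f : 'I_n -> R -> R) : (forall i, continuous (f i)) ->
  int11 (fun s => \sum_i f i s) = \sum_i int11 (f i).
Proof.
elim: n f => [|n IH] f cf.
  rewrite big_ord0 /int11 /Rintegral; under eq_integral do rewrite big_ord0.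
  by rewrite integral0.
rewrite big_ord_recl -IH// -int11D//.
  by congr int11; apply/funext => s; rewrite big_ord_recl.
by apply: continuous_sum_ord => i; exact: cf.
Qed.

Lemma int11_bound (f : R -> R) B : continuous f -> (forall s, -1 <= s <= 1 -> `|f s| <= B) ->
  `|int11 f| <= B * 2.
Proof.
move=> cf fB; apply: le_trans (le_normr_Rintegral _ _) _ => //.
  exact: integrable11.
have -> : B * 2 = \int[mu]_(s in `[-1, 1]) B.
  rewrite Rintegral_cst//= lebesgue_measure_itv/= lte_fin.
  have -> : (-1 < 1 :> R) by lra.
  by rewrite /=; congr (_ * _); ring.
apply: le_Rintegral => //.
- by apply: (integrable11 (f := fun s => `|f s|)) => x; apply: cvg_norm; exact: cf.
- by apply: (integrable11 (f := fun=> B)) => x; exact: cvg_cst.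
Qed.

Lemma int11_FTC (F f : R -> R) : (forall x, is_derive x (1 : R) F (f x)) ->
  continuous f -> int11 f = F 1 - F (-1).
Proof.
move=> dF cf.
have dF1 x : derivable F x 1 by have [] := dF x.
have cF : continuous F := derivable_continuous dF1.
rewrite /int11 /Rintegral (@continuous_FTC2 _ f F)//.
- exact: continuous_subspaceT.
- split => //.
  + exact/cvg_at_right_filter/cF.
  + exact/cvg_at_left_filter/cF.
- by move=> x _; rewrite derive1E; have [_ ->] := dF x.
Qed.

Lemma le_lim0 (a L : R) : 0 <= L -> (forall e, 0 < e -> `|a| <= L * e) -> a = 0.
Proof.
move=> L0 h; apply/eqP; rewrite -normr_le0; apply/ler_addgt0Pr => e e0.
rewrite add0r; have e1 : 0 < e / (L + 1) by rewrite divr_gt0// ltr_wpDl.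
apply: le_trans (h _ e1) _; rewrite mulrCA; apply: ler_piMr; first exact: ltW.
by rewrite ler_pdivrMr ?ltr_wpDl// mul1r lerDl.
Qed.

(** [H] is prescribed for [|x| > 1] only, so its derivatives are first known to vanish there.
    Comparing [x] with a point pushed outwards by [e] reaches [|x| = 1]. *)
Lemma vanish_boundary (f : R -> R) L : 0 <= L ->
  (forall x y, `|f x - f y| <= L * `|x - y|) ->
  (forall x, 1 < `|x| -> f x = 0) -> forall x, 1 <= `|x| -> f x = 0.
Proof.
move=> L0 lf f0 x x1; apply: (le_lim0 L0) => e e0.
have x0 : 0 < `|x| by rewrite (lt_le_trans _ x1).
have xn : x != 0 by rewrite -normr_gt0.
have := lf x (x + Num.sg x * e).
rewrite [f (x + _)]f0 ?subr0.
  by rewrite opprD addNKr normrN normrM normr_sg xn mul1r (gtr0_norm e0).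
rewrite {1}(numEsg x) -mulrDr normrM normr_sg xn mul1r gtr0_norm ?addr_gt0//.
by apply: (le_lt_trans x1); rewrite ltrDl.
Qed.

Record kernel_bounds (alpha : nat) (H : R -> R) (K : R) : Prop := KernelBounds {
  kb_K : 1 <= K;
  kb_d1 : forall x, derivable H x 1;
  kb_d2 : forall x, derivable (derive1 H) x 1;
  kb_c1 : continuous (derive1 H);
  kb_c2 : continuous (derive1n 2 H);
  kb_b1 : forall x, `|derive1 H x| <= K;
  kb_b2 : forall x, `|derive1n 2 H x| <= K;
  kb_l2 : forall x y, `|derive1n 2 H x - derive1n 2 H y| <= K * `|x - y|;
  kb_s1 : forall x, 1 <= `|x| -> derive1 H x = 0;
  kb_s2 : forall x, 1 <= `|x| -> derive1n 2 H x = 0;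
  kb_m : forall k, (1 <= k <= alpha.-1)%N -> int11 (fun s => s ^+ k * derive1 H s) = 0;
  kb_i0 : int11 (derive1n 2 H) = 0;
  kb_i1 : int11 (fun s => s * derive1n 2 H s) = -1
}.

Lemma locally_constant_derive1 (f : R -> R) c x :
  (\forall y \near x, f y = c) -> derive1 f x = 0.
Proof.
move=> h; rewrite derive1E (@near_eq_derive _ _ _ f (cst c))//.
by rewrite derive_cst.
Qed.

(** A bounded [H''] makes [H'] Lipschitz, so [H'] vanishes for [|x| >= 1] and is bounded; then [H]
    is Lipschitz, with [H 1 = 1] and [H (-1) = 0]. The integral of [H''] is the increment of [H'],
    namely 0. Its first moment is the increment of the primitive [s H' - H], namely -1. *)
Lemma kernel_boundsP alpha H : kernel_assumption alpha H ->
  exists K, kernel_bounds alpha H K.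
Proof.
move=> [a2 [H1 [H0 [dH [dH1 [_ [km [_ [bH2 lH2]]]]]]]]].
have [K1 K1p bK1] : exists2 K, 0 <= K & forall x, `|derive1n 2 H x| <= K.
  have [M [_ hM]] := bH2; exists (`|M| + 1); first by rewrite addr_ge0.
  have M1 : M < `|M| + 1 by rewrite (le_lt_trans (ler_norm M))// ltrDl.
  by move=> x; have := hM _ M1 x; apply.
have [K2 K2p lK2] : exists2 K, 0 <= K &
    forall x y, `|derive1n 2 H x - derive1n 2 H y| <= K * `|x - y|.
  have [M [_ hM]] := lH2; exists (`|M| + 1); first by rewrite addr_ge0.
  have M1 : M < `|M| + 1 by rewrite (le_lt_trans (ler_norm M))// ltrDl.
  by move=> x y; have := hM _ M1 (x, y); apply.
have d2E x : derive1 (derive1 H) x = derive1n 2 H x by rewrite derive1nS derive1n1.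
have l1 x y : `|derive1 H x - derive1 H y| <= K1 * `|x - y|.
  by apply: derive1_bound_lip => // z; rewrite d2E.
have z1 x : 1 < `|x| -> derive1 H x = 0.
  move=> x1; have [x0|x0] := leP 0 x.
    rewrite ger0_norm// in x1; apply: (@locally_constant_derive1 _ 1).
    by near=> y; apply: H1; near: y; apply: (cvgr_gt x) => //; exact: cvg_id.
  rewrite ltr0_norm// ltrNr in x1; apply: (@locally_constant_derive1 _ 0).
  by near=> y; apply: H0; near: y; apply: (cvgr_lt x) => //; exact: cvg_id.
have z1' := vanish_boundary K1p l1 z1.
have z2 x : 1 < `|x| -> derive1n 2 H x = 0.
  move=> x1; rewrite -d2E; apply: (@locally_constant_derive1 _ 0).
  have [x0|x0] := leP 0 x.
    rewrite ger0_norm// in x1; near=> y; apply: z1.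
    by rewrite (lt_le_trans _ (ler_norm y))//; near: y; apply: (cvgr_gt x) => //; exact: cvg_id.
  rewrite ltr0_norm// ltrNr in x1; near=> y; apply: z1.
  rewrite -normrN (lt_le_trans _ (ler_norm _))// ltrNr.
  by near: y; apply: (cvgr_lt x) => //; exact: cvg_id.
have z2' := vanish_boundary K2p lK2 z2.
(* The factor 3 comes from comparison with the point 2, where [H'] vanishes and which is at distance
   at most 3 from [x] when [|x| < 1]. *)
have b1 x : `|derive1 H x| <= K1 * 3.
  have [x1|x1] := leP 1 `|x|; first by rewrite z1' ?normr0 ?mulr_ge0.
  have z22 : derive1 H 2 = 0 by apply: z1'; rewrite ger0_norm ?ler1n.
  have := l1 x 2; rewrite z22 subr0.
  move=> h; apply: le_trans h _; rewrite ler_wpM2l//.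
  by move: x1; rewrite ltr_norml => /andP[h1 h2]; rewrite ler_norml; apply/andP; split; lra.
have lH x y : `|H x - H y| <= K1 * 3 * `|x - y| by exact: derive1_bound_lip.
have K3p : 0 <= K1 * 3 by rewrite mulr_ge0.
have HE1 : H 1 = 1.
  apply/eqP; rewrite -subr_eq0; apply/eqP; apply: (le_lim0 K3p) => e e0.
  have := lH 1 (1 + e); rewrite [H (1 + e)]H1 ?ltrDl//.
  by rewrite opprD addNKr normrN (gtr0_norm e0).
have HE0 : H (-1) = 0.
  apply: (le_lim0 K3p) => e e0.
  have := lH (-1) (-1 - e); rewrite [H (-1 - e)]H0 ?ltrBlDr ?ltrDl// subr0.
  by rewrite opprB addrCA addrN addr0 (gtr0_norm e0).
have cH1 : continuous (derive1 H) := derivable_continuous dH1.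
have cH2 : continuous (derive1n 2 H).
  move=> x; apply/cvgrPdist_le => e e0; near=> y.
  apply: le_trans (lK2 _ _) _.
  apply: (@le_trans _ _ ((K2 + 1) * `|x - y|)); first by rewrite ler_wpM2r// lerDl.
  rewrite -ler_pdivlMl ?ltr_wpDl//; near: y.
  by apply: cvgr_dist_le; rewrite // mulr_gt0// invr_gt0 ltr_wpDl.
exists (1 + K1 * 3 + K1 + K2); split => //.
- by rewrite -!addrA lerDl !addr_ge0.
- by move=> x; apply: le_trans (b1 x) _; rewrite -addrA -addrA addrCA lerDl !addr_ge0.
- by move=> x; apply: le_trans (bK1 x) _; rewrite addrAC lerDr !addr_ge0.
- by move=> x y; apply: le_trans (lK2 x y) _; rewrite ler_wpM2r// lerDr !addr_ge0.
- have dF x : is_derive x (1 : R) (derive1 H) (derive1n 2 H x).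
    by rewrite -d2E; exact: derivable_is_derive.
  by rewrite (int11_FTC dF cH2) !z1' ?subrr// ?normrN normr1.
- have dF x : is_derive x (1 : R) (fun s => s * derive1 H s - H s) (x * derive1n 2 H x).
    have dH2 := derivable_is_derive (dH1 x); rewrite d2E in dH2.
    have := is_deriveB (is_deriveM (is_derive_id x 1) dH2) (derivable_is_derive (dH x)).
    move=> /is_derive_eq; apply.
    by rewrite /= -[X in _ + X - _]/(_ * _) mulr1 addrK.
  rewrite (int11_FTC dF); last by move=> x; apply: cvgM => //; exact: cH2.
  by rewrite !z1' ?normrN ?normr1// HE1 HE0 !mulr0 !subr0 sub0r.
Unshelve. all: by end_near. Qed.

End kernel_facts.

(** * Kernel integrals at scale [h] *)

Section substitution.
Context (R : realType).
Local Notation mu := (@lebesgue_measure R).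
Variables (q G : R -> R) (a h : R).
Hypotheses (cq : continuous q) (cG : continuous G) (h0 : 0 < h).
Hypothesis G0 : forall s, 1 <= `|s| -> G s = 0.

Let k (t : R) := q t * G ((t + a) / h).

Lemma continuous_affine (b c : R) : continuous (fun t : R => (t + b) * c).
Proof.
by move=> x; apply: cvgMl => //; apply: cvgD; [exact: cvg_id|exact: cvg_cst].
Qed.

Lemma continuous_rescaled : continuous k.
Proof.
move=> x; apply: cvgM; first exact: cq.
apply: (@continuous_comp _ _ _ (fun t : R => (t + a) / h) G).
  exact: continuous_affine.
exact: cG.
Qed.

Lemma rescaled_patch : k = k \_ `[- h - a, h - a].
Proof.
apply/funext => t; rewrite patchE; case: ifPn => //.
rewrite notin_setE /= in_itv/= => ht; rewrite /k G0 ?mulr0//.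
rewrite normrM normfV (gtr0_norm h0) ler_pdivlMr// mul1r leNgt.
apply/negP; rewrite ltr_norml => /andP[h1 h2]; apply: ht.
by apply/andP; split; lra.
Qed.

Lemma integrable_rescaled : mu.-integrable setT (EFin \o k).
Proof.
rewrite rescaled_patch -restrict_EFin -integrable_mkcond//.
apply: continuous_compact_integrable; first exact: segment_compact.
by apply: continuous_subspaceT; exact: continuous_rescaled.
Qed.

Lemma integral_rescaled :
  \int[mu]_t k t = h * int11 (fun s => q (h * s - a) * G s).
Proof.
pose F s : R := h * s - a.
have dF s : is_derive s (1 : R) F h.
  have := is_deriveB (is_deriveZ h (is_derive_id s (1 : R))) (is_derive_cst a s (1 : R)).
  by move=> /is_derive_eq; apply; rewrite subr0 -[_ *: _]/(_ * _) mulr1.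
have F'E : derive1 F = fun=> h by apply/funext => s; rewrite derive1E; have [_ ->] := dF s.
have dF1 s : derivable F s 1 by have [] := dF s.
have cF : continuous F := derivable_continuous dF1.
have cqG : continuous (fun s => q (h * s - a) * G s).
  move=> s; apply: cvgM; last exact: cG.
  by apply: (@continuous_comp _ _ _ F q); [exact: cF|exact: cq].
rewrite [in LHS]rescaled_patch -Rintegral_mkcond /Rintegral.
have -> : - h - a = F (-1) by rewrite /F mulrN1.
have -> : h - a = F 1 by rewrite /F mulr1.
rewrite (@integration_by_substitution_increasing _ F k (-1) 1).
- rewrite -RintegralZl//; last exact: integrable11.
  congr fine; apply: eq_integral => s _; congr EFin; rewrite F'E.
  transitivity (k (F s) * h); first by [].
  by rewrite /k /F subrK [h * s / h]mulrAC divff ?gt_eqF// mul1r mulrC.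
- by lra.
- by move=> x y _ _ xy; rewrite /F ltrD2r ltr_pM2l.
- by rewrite F'E => x _; exact: cvg_cst.
- by rewrite F'E; exact: is_cvg_cst.
- by rewrite F'E; exact: is_cvg_cst.
- split => //.
  + exact/cvg_at_right_filter/cF.
  + exact/cvg_at_left_filter/cF.
- by apply: continuous_subspaceT; exact: continuous_rescaled.
Qed.

End substitution.

Section smooth_bias.
Context (R : realType).
Local Notation mu := (@lebesgue_measure R).
Variables (q q1 G : R -> R) (L K : R).
Hypothesis dq : forall t, is_derive t (1 : R) q (q1 t).
Hypothesis lq1 : forall x y, `|q1 x - q1 y| <= L * `|x - y|.
Hypotheses (L0 : 0 <= L) (K0 : 0 <= K).
Hypothesis cG : continuous G.
Hypothesis G0 : forall s, 1 <= `|s| -> G s = 0.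
Hypothesis bG : forall s, `|G s| <= K.
Hypothesis G_i0 : int11 G = 0.
Hypothesis G_i1 : int11 (fun s => s * G s) = -1.

Let ddq t : derivable q t 1. Proof. by have [] := dq t. Qed.
Let q'E t : derive1 q t = q1 t. Proof. by rewrite derive1E; have [_ ->] := dq t. Qed.
Let cq : continuous q := derivable_continuous ddq.
Let E h b (h0 : 0 < h) : \int[mu]_t (q t * G ((t + b) / h)) =
    h * int11 (fun s => q (h * s - b) * G s).
Proof. exact: (@integral_rescaled R q G b h cq cG h0 G0). Qed.

(** The factor [1/h^2] is compensated completely. One [h] comes from the substitution. The other
    comes from [D x = q (x - a) - q (x - a')], which has Lipschitz constant [L |a - a'|]: as [G] has
    integral 0, [D (h s)] may be replaced by [D (h s) - D 0], of size [O(h)]. *)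
Lemma smooth_bias_lip h a a' : 0 < h ->
  `| \int[mu]_t (q t * (G ((t + a) / h) - G ((t + a') / h))) / h ^+ 2 |
    <= L * K * 2 * `|a - a'|.
Proof.
move=> h0.
have -> : (fun t => q t * (G ((t + a) / h) - G ((t + a') / h))) =
  (fun t => q t * G ((t + a) / h) - q t * G ((t + a') / h)).
  by apply/funext => t; rewrite mulrBr.
rewrite RintegralB; last 3 first.
- exact: measurableT.
- exact: (@integrable_rescaled R q G a h cq cG h0 G0).
- exact: (@integrable_rescaled R q G a' h cq cG h0 G0).
rewrite (E a h0) (E a' h0) -mulrBr.
pose D x := q (x - a) - q (x - a').
have cqa b : continuous (fun s : R => q (h * s - b)).
  move=> x; apply: (@continuous_comp _ _ _ (fun s : R => h * s - b) q); last exact: cq.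
  by apply: cvgB; [apply: cvgMr; exact: cvg_id|exact: cvg_cst].
have cqH b : continuous (fun s : R => q (h * s - b) * G s).
  by move=> x; apply: cvgM; [exact: cqa|exact: cG].
rewrite -int11B//.
have -> : int11 (fun s => q (h * s - a) * G s - q (h * s - a') * G s) =
    int11 (fun s => (D (h * s) - D 0) * G s).
  have E0 : int11 (fun s => D 0 * G s) = 0 by rewrite (int11Z _ cG) G_i0 mulr0.
  rewrite -[LHS]subr0 -[X in _ - X]E0 -int11B.
  - congr int11; apply/funext => s; rewrite [D (h * s)]/D.
    by rewrite !mulrBl.
  - by move=> x; apply: cvgB; exact: cqH.
  - by move=> x; apply: cvgMr; exact: cG.
have dD x : is_derive x (1 : R) D (q1 (x - a) - q1 (x - a')).
  have dsh b : is_derive x (1 : R) (fun x => q (x - b)) (q1 (x - b)).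
    have := @is_derive1_comp R q (fun x => x - b) x _ _ (dq (x - b))
      (is_deriveB (is_derive_id x 1) (is_derive_cst b x 1)).
    by move=> /is_derive_eq; apply; rewrite subr0 mulr1.
  exact: is_deriveB.
have dD1 x : derivable D x 1 by have [] := dD x.
have bD x : `|D x - D 0| <= L * `|a - a'| * `|x|.
  rewrite -[x in leRHS]subr0; apply: derive1_bound_lip => // y.
  rewrite derive1E; have [_ ->] := dD y.
  apply: le_trans (lq1 _ _) _; rewrite distrC.
  by have -> : y - a' - (y - a) = a - a' by ring.
rewrite normrM normfV [`|h ^+ 2|]ger0_norm ?sqr_ge0// normrM (gtr0_norm h0).
rewrite ler_pdivrMr ?exprn_gt0//.
have -> : L * K * 2 * `|a - a'| * h ^+ 2 = h * (L * `|a - a'| * h * K * 2) by ring.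
rewrite ler_pM2l//; apply: int11_bound.
  move=> x; apply: cvgM; last exact: cG.
  by apply: cvgB; [apply: cvgB; exact: cqa|exact: cvg_cst].
move=> s s1; rewrite normrM; apply: ler_pM => //.
apply: le_trans (bD _) _; rewrite normrM (gtr0_norm h0) mulrA ler_piMr//.
  by rewrite !mulr_ge0// ltW.
by rewrite ler_norml.
Qed.

(** Expand [q (h s)] at 0: the constant term integrates to 0 by [G_i0], the linear term to
    [- h q1 0] by [G_i1], and the remainder is [O(h^2)] because [q1] is Lipschitz. *)
Lemma smooth_bias h : 0 < h ->
  `| \int[mu]_t (q t * G (t / h)) / h ^+ 2 + q1 0 | <= L * K * 2 * h.
Proof.
move=> h0.
have -> : \int[mu]_t (q t * G (t / h)) = h * int11 (fun s => q (h * s) * G s).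
  rewrite [X in h * int11 X](_ : _ = fun s => q (h * s - 0) * G s).
    by rewrite -(E 0 h0); congr Rintegral; apply/funext => t; rewrite addr0.
  by apply/funext => s; rewrite subr0.
have cqa : continuous (fun s : R => q (h * s)).
  move=> x; apply: (@continuous_comp _ _ _ (fun s : R => h * s) q); last exact: cq.
  by apply: cvgMr; exact: cvg_id.
have csH : continuous (fun s : R => s * G s).
  by move=> x; apply: cvgM; [exact: cvg_id|exact: cG].
have cR : continuous (fun s : R => (q (h * s) - q 0 - q1 0 * (h * s)) * G s).
  move=> x; apply: cvgM; last exact: cG.
  apply: cvgB; first by apply: cvgB; [exact: cqa|exact: cvg_cst].
  by apply: cvgMr; apply: cvgMr; exact: cvg_id.
have -> : int11 (fun s => q (h * s) * G s) =
   int11 (fun s => (q (h * s) - q 0 - q1 0 * (h * s)) * G s) - h * q1 0.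
  have -> : - (h * q1 0) =
     int11 (fun s => q 0 * G s) + int11 (fun s => (q1 0 * h) * (s * G s)).
    by rewrite !int11Z// G_i0 G_i1; ring.
  rewrite -!int11D//.
  - by congr int11; apply/funext => s; ring.
  - by move=> x; apply: cvgD; apply: cvgMr; [exact: cG|exact: csH].
  - by move=> x; apply: cvgMr; exact: cG.
  - by move=> x; apply: cvgMr; exact: csH.
set I := int11 _.
have -> : h * (I - h * q1 0) / h ^+ 2 + q1 0 = I / h by field; rewrite gt_eqF.
rewrite normrM normfV (gtr0_norm h0) ler_pdivrMr//.
have -> : L * K * 2 * h * h = L * h ^+ 2 * K * 2 by ring.
apply: int11_bound => // s s1; rewrite normrM; apply: ler_pM => //.
have [c] := mvt_between 0 (h * s) ddq; rewrite !subr0 q'E => -> hc.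
rewrite -mulrBl normrM; apply: (@le_trans _ _ (L * `|h * s| * `|h * s|)).
  rewrite ler_wpM2r//; apply: le_trans (lq1 _ _) _.
  by rewrite ler_wpM2l// subr0.
rewrite -mulrA -expr2 ler_wpM2l// real_normK ?num_real// exprMn ler_piMr ?sqr_ge0//.
by rewrite -real_normK ?num_real// exprn_ile1// ler_norml.
Qed.

End smooth_bias.


(** * The signed density of the response and the bias of order [h^alpha] *)

Section sgn_dens.
Context (R : realType).
Local Notation mu := (@lebesgue_measure R).

(* Given Z and zeta = t, the signed density: E[-Y | zeta, Z] = 2 F(-zeta | Z) - 1. *)
Definition sgn_dens (f r : R -> R) (t : R) : R := (2 * f (- t) - 1) * r t.
(** Bound on the second derivative of [sgn_dens]: [2 CF Cr] from [f'' r], [4 CF Cr] from [f' r'],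
    and [Cr] from [(2 f - 1) r'']. *)
Definition sgn_lip (CF Cr : R) := 6 * CF * Cr + Cr.

Section first_order.
Variables (f f1 f2 r r1 r2 : R -> R) (CF Cr : R).
Hypotheses (df : forall x, is_derive x (1 : R) f (f1 x))
  (df1 : forall x, is_derive x (1 : R) f1 (f2 x))
  (dr : forall x, is_derive x (1 : R) r (r1 x))
  (dr1 : forall x, is_derive x (1 : R) r1 (r2 x)).
Hypothesis f01 : forall u, 0 <= f u <= 1.
Hypotheses (bf1 : forall x, `|f1 x| <= CF) (bf2 : forall x, `|f2 x| <= CF)
  (br : forall x, `|r x| <= Cr) (br1 : forall x, `|r1 x| <= Cr)
  (br2 : forall x, `|r2 x| <= Cr).
Local Notation q := (sgn_dens f r).

Definition sgn_dens1 (t : R) : R := - (2 * f1 (- t)) * r t + (2 * f (- t) - 1) * r1 t.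
Let q2 (t : R) : R := 2 * f2 (- t) * r t - 4 * f1 (- t) * r1 t + (2 * f (- t) - 1) * r2 t.

Let is_derive_opp (g g1 : R -> R) t : is_derive (- t) (1 : R) g (g1 (- t)) ->
  is_derive t (1 : R) (fun t => g (- t)) (- g1 (- t)).
Proof.
move=> dg.
have := @is_derive1_comp R g -%R t _ _ dg (is_deriveN (is_derive_id t 1)).
by move=> /is_derive_eq; apply; rewrite mulrN1.
Qed.

Let dfo t : is_derive t (1 : R) (fun t => 2 * f (- t) - 1) (2 * - f1 (- t) - 0).
Proof.
exact: (is_deriveB (is_deriveZ (2 : R) (is_derive_opp (df (- t))))
  (is_derive_cst (1 : R) t (1 : R))).
Qed.

Lemma is_derive_sgn_dens t : is_derive t (1 : R) q (sgn_dens1 t).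
Proof.
have := is_deriveM (dfo t) (dr t).
move=> /is_derive_eq; apply.
transitivity ((2 * f (- t) - 1) * r1 t + r t * (2 * - f1 (- t) - 0)); first by [].
by rewrite /sgn_dens1; ring.
Qed.

Let dq1 t : is_derive t (1 : R) sgn_dens1 (q2 t).
Proof.
have d3 := is_deriveN (is_deriveZ (2 : R) (is_derive_opp (df1 (- t)))).
have := is_deriveD (is_deriveM d3 (dr t)) (is_deriveM (dfo t) (dr1 t)).
move=> /is_derive_eq; apply.
transitivity (- (2 * f1 (- t)) * r1 t + r t * - (2 * - f2 (- t)) +
  ((2 * f (- t) - 1) * r2 t + r1 t * (2 * - f1 (- t) - 0))); first by [].
by rewrite /q2; ring.
Qed.

Lemma norm_sgn_le1 x : `|2 * f (- x) - 1| <= 1.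
Proof. by rewrite ler_norml; have /andP[h1 h2] := f01 (- x); apply/andP; split; lra. Qed.

Lemma sgn_dens1_lip x y : `|sgn_dens1 x - sgn_dens1 y| <= sgn_lip CF Cr * `|x - y|.
Proof.
have CF0 : 0 <= CF by apply: le_trans (bf1 0).
apply: derive1_bound_lip => t; first by have [] := dq1 t.
rewrite derive1E; have [_ ->] := dq1 t.
have bnd (c u v : R) : 0 <= c -> `|u| <= CF -> `|v| <= Cr -> `|c * u * v| <= c * CF * Cr.
  move=> c0 hu hv; rewrite 2!normrM (ger0_norm c0); apply: ler_pM => //.
    by rewrite mulr_ge0.
  by rewrite ler_wpM2l.
rewrite /q2 /sgn_lip; apply: le_trans (ler_normD _ _) _; apply: lerD.
  have -> : 6 * CF * Cr = 2 * CF * Cr + 4 * CF * Cr by ring.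
  apply: le_trans (ler_normB _ _) _.
  by apply: lerD; apply: bnd.
have := ler_pM (normr_ge0 _) (normr_ge0 _) (norm_sgn_le1 t) (br2 t).
by rewrite mul1r -normrM.
Qed.

End first_order.

Lemma bounded_derivativesW N N' C (f : R -> R) : (N <= N')%N ->
  bounded_derivatives N' C f -> bounded_derivatives N C f.
Proof. by move=> NN h j /andP[j1 jN]; apply: h; rewrite j1 (leq_trans jN). Qed.

Lemma taylor_bound_gt0 N C (f : R -> R) : (0 < N)%N -> bounded_derivatives N C f ->
  forall x, `|f x - taylor f N x| <= C * `|x| ^+ N.
Proof. by case: N => // N _ hf x; exact: taylor_bound. Qed.

Section gradient.
Variables (alpha : nat) (G : R -> R) (K : R) (f r : R -> R) (CF Cr : R).
Hypothesis alpha2 : (2 <= alpha)%N.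
Hypotheses (cG : continuous G) (G0 : forall s, 1 <= `|s| -> G s = 0)
  (bG : forall s, `|G s| <= K)
  (mG : forall k, (1 <= k <= alpha.-1)%N -> int11 (fun s => s ^+ k * G s) = 0).
Hypotheses (hf : bounded_derivatives alpha CF f) (f0 : f 0 = 2^-1)
  (hr : bounded_derivatives alpha Cr r) (br : forall x, `|r x| <= Cr).
Hypothesis cq : continuous (sgn_dens f r).

Let a0 : (0 < alpha)%N. Proof. exact: ltnW. Qed.
Let b1 : (1 <= 1 <= alpha)%N. Proof. by rewrite a0. Qed.
Let CF0 : 0 <= CF. Proof. by have [_] := hf b1 0; apply: le_trans. Qed.
Let Cr0 : 0 <= Cr. Proof. by apply: le_trans (br 0). Qed.

Let a (k : nat) : R := 2 * (derive1n k f 0 / (k`!)%:R * (-1) ^+ k).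
Let b (k : nat) : R := derive1n k r 0 / (k`!)%:R.
(** [a] and [b] are the Taylor coefficients at 0 of [2 f(-x) - 1] and of [r]; [P] is the product of
    the two expansions cut below degree [alpha]. It has no constant term because [f 0 = 1/2]. *)
Let P (x : R) := \sum_(k < alpha.-1) \sum_(j < alpha - k.+1)
  (a k.+1 * b j) * x ^+ (k.+1 + j).

Let a_bound k : (1 <= k <= alpha)%N -> `|a k| <= 2 * CF.
Proof.
move=> hk; rewrite /a normrM ger0_norm// ler_pM2l// !normrM normrX normrN1 expr1n mulr1.
have [_ h] := hf hk 0; apply: le_trans h; rewrite ler_piMr// normfV invf_le1//.
  by rewrite ger0_norm// ler1n fact_gt0.
by rewrite normr_gt0 pnatr_eq0 -lt0n fact_gt0.
Qed.

(** Expand the first factor to order [alpha], then, in its term of degree [k+1], expand [r] to order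
    [alpha - (k+1)] only. Every error is then of order [|x|^alpha] and no derivative beyond order
    [alpha] enters. There are [alpha] errors, each with constant [2 CF Cr]. *)
Lemma sgn_dens_poly x : `|sgn_dens f r x - P x| <= (2 * CF * Cr *+ alpha) * `|x| ^+ alpha.
Proof.
pose e := (2 * f (- x) - 1) - \sum_(k < alpha.-1) a k.+1 * x ^+ k.+1.
pose ek k := r x - taylor r (alpha - k.+1) x.
have he : `|e| <= 2 * CF * `|x| ^+ alpha.
  have -> : e = 2 * (f (- x) - taylor f alpha (- x)).
    have -> : taylor f alpha (- x) = 2^-1 + \sum_(k < alpha.-1)
        derive1n k.+1 f 0 / ((k.+1)`!)%:R * (- x) ^+ k.+1.
      rewrite /taylor -[in LHS](prednK a0) big_ord_recl/= expr0 mulr1 fact0 divr1 f0.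
      by congr (_ + _); apply: eq_bigr => k _; rewrite /bump.
    rewrite /e mulrBr mulrDr divff// opprD addrA; congr (_ - _).
    rewrite mulr_sumr; apply: eq_bigr => k _; rewrite /a [(- x) ^+ _]exprNn.
    by rewrite -!mulrA.
  rewrite normrM ger0_norm// -mulrA ler_pM2l//.
  by have := taylor_bound_gt0 a0 hf (- x); rewrite normrN.
have hek k : (k < alpha.-1)%N -> `|ek k| <= Cr * `|x| ^+ (alpha - k.+1).
  move=> ka; apply: taylor_bound_gt0.
    by rewrite subn_gt0 -(prednK a0).
  by apply: bounded_derivativesW hr; exact: leq_subr.
have -> : sgn_dens f r x - P x =
    e * r x + \sum_(k < alpha.-1) a k.+1 * x ^+ k.+1 * ek k.
  have -> : P x = \sum_(k < alpha.-1) a k.+1 * x ^+ k.+1 * taylor r (alpha - k.+1) x.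
    apply: eq_bigr => k _; rewrite mulr_sumr; apply: eq_bigr => j _.
    by rewrite exprD /b; ring.
  rewrite /ek; under [in RHS]eq_bigr do rewrite mulrBr.
  rewrite sumrB -mulr_suml addrA -mulrDl /e subrK.
  by rewrite /sgn_dens.
have nE (u : R) : u *+ alpha = u + u *+ alpha.-1 by rewrite -mulrS prednK.
rewrite nE [X in _ <= X]mulrDl; apply: le_trans (ler_normD _ _) _; apply: lerD.
  by rewrite normrM mulrAC; apply: ler_pM.
apply: le_trans (ler_norm_sum _ _ _) _.
apply: (@le_trans _ _ (\sum_(k < alpha.-1) 2 * CF * Cr * `|x| ^+ alpha)); last first.
  by rewrite sumr_const card_ord [X in _ <= X]mulrnAl.
apply: ler_sum => k _; rewrite normrM [`|a _ * _|]normrM normrX.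
have ka : (k.+1 <= alpha)%N by rewrite (leq_trans (ltn_ord k))// leq_pred.
have -> : 2 * CF * Cr * `|x| ^+ alpha =
   2 * CF * `|x| ^+ k.+1 * (Cr * `|x| ^+ (alpha - k.+1)).
  by rewrite -[in LHS](subnKC ka) exprD; ring.
apply: ler_pM; [by rewrite mulr_ge0 ?exprn_ge0|by []| |exact: hek].
by apply: ler_wpM2r; [exact: exprn_ge0|exact: a_bound].
Qed.

(** The polynomial [P] contributes nothing: its degrees run from 1 to [alpha - 1], exactly where the
    moments of [G] vanish. What remains is the error of [sgn_dens_poly] at [h s] with [|s| <= 1]. *)
Lemma smooth_gradient_bias h : 0 < h ->
  `| \int[mu]_t (sgn_dens f r t * G (t / h)) / h |
    <= (2 * CF * Cr *+ alpha) * K * 2 * h ^+ alpha.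
Proof.
move=> h0.
have -> : \int[mu]_t (sgn_dens f r t * G (t / h)) =
    h * int11 (fun s => sgn_dens f r (h * s) * G s).
  have E := @integral_rescaled R _ G 0 h cq cG h0 G0.
  rewrite [X in h * int11 X](_ : _ = fun s => sgn_dens f r (h * s - 0) * G s).
    by rewrite -E; congr Rintegral; apply/funext => t; rewrite addr0.
  by apply/funext => s; rewrite subr0.
rewrite mulrAC divff ?gt_eqF// mul1r.
have csk k : continuous (fun s : R => s ^+ k * G s).
  by move=> x; apply: cvgM; [exact: exprn_continuous|exact: cG].
have cterm k : continuous (fun s : R => \sum_(j < alpha - k.+1)
    (a k.+1 * b j * h ^+ (k.+1 + j)) * (s ^+ (k.+1 + j) * G s)).
  by apply: continuous_sum_ord => j x; apply: cvgMr; exact: csk.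
have PE : (fun s => P (h * s) * G s) = (fun s => \sum_(k < alpha.-1)
    \sum_(j < alpha - k.+1) (a k.+1 * b j * h ^+ (k.+1 + j)) * (s ^+ (k.+1 + j) * G s)).
  apply/funext => s; rewrite mulr_suml; apply: eq_bigr => k _.
  rewrite mulr_suml; apply: eq_bigr => j _.
  by rewrite exprMn; ring.
have P0 : int11 (fun s => P (h * s) * G s) = 0.
  rewrite PE (int11_sum (fun k : 'I_alpha.-1 => cterm k)) big1// => k _.
  rewrite int11_sum; last by move=> j x; apply: cvgMr; exact: csk.
  rewrite big1// => j _; rewrite (int11Z _ (@csk _)) mG ?mulr0//.
  rewrite addSn /= -ltnS prednK//; have := ltn_ord j; rewrite ltn_subRL.
  by rewrite addSn.
have cP : continuous (fun s => P (h * s) * G s).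
  by rewrite PE; apply: continuous_sum_ord => k; exact: cterm.
have cqG : continuous (fun s => sgn_dens f r (h * s) * G s).
  move=> x; apply: cvgM; last exact: cG.
  apply: (@continuous_comp _ _ _ (fun s : R => h * s) (sgn_dens f r)); last exact: cq.
  by apply: cvgMr; exact: cvg_id.
rewrite -[int11 _]subr0 -P0 -int11B//.
have -> : 2 * CF * Cr *+ alpha * K * 2 * h ^+ alpha =
  2 * CF * Cr *+ alpha * h ^+ alpha * K * 2 by ring.
apply: int11_bound; first by move=> x; apply: cvgB; [exact: cqG|exact: cP].
move=> s s1; rewrite -mulrBl normrM; apply: ler_pM => //.
apply: le_trans (sgn_dens_poly _) _; rewrite ler_wpM2l ?mulrn_wge0 ?mulr_ge0//.
rewrite normrM exprMn (gtr0_norm h0) ler_piMr ?exprn_ge0 ?(ltW h0)//.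
by rewrite exprn_ile1// ler_norml.
Qed.

End gradient.

End sgn_dens.

(** * From fiberwise integrals to expectations *)

Section bias_expectation.
Local Open Scope ereal_scope.
Context d d' (T : measurableType d) (V : measurableType d') (R : realType).
Variable P : probability T R.
Local Notation mu := (@lebesgue_measure R).
Variables (X eps : T -> R) (Z : T -> V) (c : V -> R) (F rho : R -> V -> R) (CF : R).
Hypotheses (mX : measurable_fun setT X) (meps : measurable_fun setT eps)
  (mZ : measurable_fun setT Z) (mc : measurable_fun setT c).
Let zeta w := (X w + c (Z w))%R.
Hypothesis hind : cond_independent P eps X Z.
Hypothesis hcdf : forall u, is_cond_prob P [set w | (eps w <= u)%R] Z (F u).
Hypothesis hgood : {ae P, forall w,
  (forall u, 0 <= F u (Z w) <= 1)%R /\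
  (forall u v, `|F u (Z w) - F v (Z w)| <= CF * `|u - v|)%R}.
Hypothesis hrho : is_cond_density P zeta Z rho.
Variable g : R * V -> R.
Hypothesis mg : measurable_fun setT g.
Hypothesis ig : P.-integrable setT (fun w => (g (zeta w, Z w))%:E).

Let mF u : measurable_fun setT (F u). Proof. by have [] := hcdf u. Qed.
Let mzeta : measurable_fun setT zeta.
Proof. by apply: measurable_funD => //; exact: measurableT_comp. Qed.
Let mzZ : measurable_fun setT (fun w => (zeta w, Z w)).
Proof. exact: measurable_fun_pair. Qed.

Definition sign_weight (v : R * V) : R := 2 * cdf_mod F (- v.1)%R v.2 - 1.

Lemma measurable_cdf_modN : measurable_fun setT (fun v : R * V => cdf_mod F (- v.1)%R v.2).
Proof.
apply: (measurableT_comp (measurable_cdf_mod mF) (g := fun v : R * V => (- v.1, v.2)%R)).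
by apply: measurable_fun_pair => //; exact: measurableT_comp.
Qed.

Lemma measurable_sign_weight : measurable_fun setT sign_weight.
Proof.
apply: measurable_funB => //; apply: measurable_funM => //.
exact: measurable_cdf_modN.
Qed.

Lemma sign_weight_le1 v : (`|sign_weight v| <= 1)%R.
Proof.
have h0 := cdf_mod_ge0 F (- v.1)%R v.2; have h1 := cdf_mod_le1 F (- v.1)%R v.2.
by rewrite /sign_weight ler_norml; apply/andP; split; lra.
Qed.

Lemma integrable_weighted (a : T -> R) : measurable_fun setT a ->
  (forall w, `|a w| <= 1)%R -> P.-integrable setT (fun w => (a w * g (zeta w, Z w))%:E).
Proof.
move=> ma a1; apply: le_integrable ig => //.
  by apply/measurable_EFinP/measurable_funM => //; exact: (measurableT_comp mg mzZ).
by move=> w _; rewrite /= lee_fin normrM ler_piMl.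
Qed.

Let ms : measurable [set w | (eps w < - zeta w)%R].
Proof.
by rewrite -[[set _ | _]]setTI; apply: measurable_fun_ltr => //; exact: measurableT_comp.
Qed.

(** The inequality in the event is strict because [sign_pm] takes the value 1 at 0. *)
Lemma neg_signE w : (- sign_pm (zeta w + eps w) =
  2 * \1_[set w | eps w < - zeta w]%R w - 1)%R.
Proof.
rewrite /sign_pm indicE; case: ifPn => h.
  by rewrite mem_set/=; [lra|move: h; lra].
by rewrite memNset/=; [lra|move: h; lra].
Qed.

(** [sign_formula] with the threshold [- zeta] replaces the indicator by [F(-zeta|Z)], and
    [density_formula] then integrates [zeta] out. *)
Lemma signed_formula :
  \int[P]_w (- sign_pm (zeta w + eps w) * g (zeta w, Z w))%:E =
  \int[P \x mu]_wt (dens_weight Z rho wt * (sign_weight (wt.2, Z wt.1) * g (wt.2, Z wt.1)))%:E.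
Proof.
pose cm w := cdf_mod F (- zeta w) (Z w).
have mcm : measurable_fun setT cm by exact: (measurableT_comp measurable_cdf_modN mzZ).
have i1 : P.-integrable setT
    (fun w => (\1_[set w | (eps w < - zeta w)%R] w * g (zeta w, Z w))%:E).
  apply: integrable_weighted; first exact: measurable_indic.
  by move=> w; rewrite indicE; case: (_ \in _); rewrite ?normr1 ?normr0.
have i2 : P.-integrable setT (fun w => (cm w * g (zeta w, Z w))%:E).
  apply: integrable_weighted => // w.
  by rewrite ger0_norm ?cdf_mod_ge0 ?cdf_mod_le1.
have E1 : \int[P]_w (- sign_pm (zeta w + eps w) * g (zeta w, Z w))%:E =
    2%:E * \int[P]_w (\1_[set w | (eps w < - zeta w)%R] w * g (zeta w, Z w))%:E
    - \int[P]_w (g (zeta w, Z w))%:E.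
  rewrite -integralZl// -integralB//; last exact: integrableZl.
  apply: eq_integral => w _; rewrite neg_signE -EFinM -EFinB; congr EFin.
  by ring.
have E2 : \int[P]_w (sign_weight (zeta w, Z w) * g (zeta w, Z w))%:E =
    2%:E * \int[P]_w (cm w * g (zeta w, Z w))%:E - \int[P]_w (g (zeta w, Z w))%:E.
  rewrite -integralZl// -integralB//; last exact: integrableZl.
  apply: eq_integral => w _; rewrite -EFinM -EFinB; congr EFin.
  by rewrite /sign_weight /cm /=; ring.
have := density_formula mzeta mZ hrho (measurable_funM measurable_sign_weight mg).
rewrite /= => <-; rewrite E1 E2; congr (_ * _ - _).
pose tau (v : R * V) := (- (v.1 + c v.2))%R.
have mpair : measurable_fun setT (fun v : R * V => (v.1 + c v.2)%R).
  by apply: measurable_funD => //; exact: measurableT_comp.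
have mtau : measurable_fun setT tau by exact: measurableT_comp.
have mg' : measurable_fun setT (fun v : R * V => g (v.1 + c v.2, v.2)%R).
  by apply: (measurableT_comp mg); exact: measurable_fun_pair.
exact: (sign_formula mX meps mZ hind hcdf hgood mtau mg').
Qed.

Lemma integrable_signed : (P \x mu)%E.-integrable setT
  (fun wt => (dens_weight Z rho wt * (sign_weight (wt.2, Z wt.1) * g (wt.2, Z wt.1)))%:E).
Proof.
have mk : measurable_fun setT (fun wt : T * R =>
    (dens_weight Z rho wt * (sign_weight (wt.2, Z wt.1) * g (wt.2, Z wt.1)))%R).
  apply: measurable_funM; first exact: (measurable_dens_weight mZ hrho).
  exact: (measurable_swap_comp mZ (measurable_funM measurable_sign_weight mg)).
have mk' : measurable_fun setT (fun wt : T * R =>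
    (dens_weight Z rho wt * `|g (wt.2, Z wt.1)|)%R).
  apply: measurable_funM; first exact: (measurable_dens_weight mZ hrho).
  by apply: measurableT_comp => //; exact: (measurable_swap_comp mZ mg).
apply/integrableP; split; first exact/measurable_EFinP.
apply: (@le_lt_trans _ _ (\int[P \x mu]_wt (dens_weight Z rho wt * `|g (wt.2, Z wt.1)|)%:E)).
  apply: ge0_le_integral => //.
  - by apply/measurable_EFinP; exact: measurableT_comp.
  - exact/measurable_EFinP.
  - move=> wt _; rewrite /= lee_fin normrM ger0_norm ?dens_weight_ge0//.
    by rewrite ler_wpM2l ?dens_weight_ge0// normrM ler_piMl// sign_weight_le1.
rewrite -(density_formula mzeta mZ hrho (g := fun v => `|g v|%R)); last exact: measurableT_comp.
by case/integrableP : ig.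
Qed.

Variables (kap B : T -> R).
Hypotheses (ikap : P.-integrable setT (EFin \o kap)) (iB : P.-integrable setT (EFin \o B)).
Hypothesis hbias : {ae P, forall w,
  (`| (\int[mu]_t (sgn_dens (F^~ (Z w)) (rho^~ (Z w)) t * g (t, Z w)))%R - kap w | <= B w)%R}.
Hypothesis rho0 : {ae P, forall w, forall t, (0 <= rho t (Z w))%R}.

(** Fubini turns the signed expectation into the mean over [Z] of the one-dimensional integrals
    against [sgn_dens]. An analytic estimate for almost every value of [Z], with target [kap] and
    error [B], thus passes to expectations. *)
Lemma bias_expectation :
  (`| \int[P]_w (- sign_pm (zeta w + eps w) * g (zeta w, Z w)) - \int[P]_w kap w |
    <= \int[P]_w B w)%R.
Proof.
have isg := integrable_signed.
pose J w := \int[mu]_t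
  (dens_weight Z rho (w, t) * (sign_weight (t, Z w) * g (t, Z w)))%:E.
have JE : \int[P]_w (- sign_pm (zeta w + eps w) * g (zeta w, Z w))%:E = \int[P]_w J w.
  by rewrite signed_formula -(integral12_prod_meas1 isg).
have iJ : P.-integrable setT J := integrable_fubini_F isg.
have iJk : P.-integrable setT (fun w => J w - (kap w)%:E) := integrableB measurableT iJ ikap.
have fJ := integrable_fin_num measurableT iJ.
have fk := integrable_fin_num measurableT ikap.
have fB := integrable_fin_num measurableT iB.
rewrite -lee_fin {1}/Rintegral JE.
rewrite -[X in X <= _]/(`|_%:E|) EFinB fineK// /Rintegral !fineK//.
rewrite -integralB//; apply: le_trans (le_abse_integral _ _ _) _ => //.
  by case/integrableP : iJk.
have [miJk _] := integrableP _ _ _ iJk.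
rewrite -[leRHS](ae_eq_integral_nonmeasurable (f := fun w => `|(B w)%:E|)).
  apply: ae_ge0_le_integral => //.
  - exact: measurableT_comp.
  - by apply: measurableT_comp => //; case/integrableP: iB.
  have aeJ := integrable_ae measurableT iJ.
  apply: filterS2 (filterI hgood rho0) (filterI hbias aeJ).
  move=> w [[F01 FL] r0] [hb /(_ I) fJw] _.
  have JwE : J w = (\int[mu]_t (sgn_dens (F^~ (Z w)) (rho^~ (Z w)) t * g (t, Z w))%R%:E).
    apply: eq_integral => t _; congr EFin.
    rewrite /dens_weight /sign_weight /= max_l// (cdf_modE F01 FL) /sgn_dens.
    by ring.
  move: fJw hb; rewrite JwE /Rintegral => fJw hb.
  have B0 : (0 <= B w)%R := le_trans (normr_ge0 _) hb.
  rewrite -(fineK fJw) -EFinB [leRHS]gee0_abs ?lee_fin//.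
by apply: filterS hbias => w hb; rewrite gee0_abs// lee_fin (le_trans _ hb).
Qed.

End bias_expectation.

(** * Exponential moments of i.i.d. sums *)

Section exp_bounds.
Context (R : realType).

Lemma expR_taylor2 (x : R) : expR x <= 1 + x + x ^+ 2 * expR `|x|.
Proof.
pose f (y : R) : R := expR y - y.
have df y : is_derive y (1 : R) f (expR y - 1).
  exact: (is_deriveB (is_derive_expR y) (is_derive_id y 1)).
have df1 y : derivable f y 1 by have [] := df y.
have dfE y : derive1 f y = expR y - 1 by rewrite derive1E; have [_ ->] := df y.
have de y : derivable (@expR R) y 1 by have [] := is_derive_expR y.
have deE y : derive1 (@expR R) y = expR y by rewrite derive1E; have [_ ->] := is_derive_expR y.
have [c] := mvt_between 0 x df1; rewrite dfE /f expR0 !subr0 => E cx.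
have [c'] := mvt_between 0 c de; rewrite deE expR0 !subr0 => E' cx'.
rewrite -lerBlDl (_ : expR x - (1 + x) = expR x - x - 1); last by ring.
rewrite E E'; apply: le_trans (ler_norm _) _; rewrite !normrM.
rewrite (gtr0_norm (expR_gt0 _)) -[x ^+ 2]real_normK ?num_real//.
have -> : `|x| ^+ 2 * expR `|x| = expR `|x| * `|x| * `|x| by ring.
rewrite ler_wpM2r//; apply: ler_pM; rewrite ?expR_ge0// ler_expR.
by rewrite (le_trans (ler_norm _))// (le_trans cx').
Qed.

Lemma sqr_le_expR (x : R) : x ^+ 2 <= 2 * (expR x + expR (- x)).
Proof.
have h := expR_ge1Dxn 1 (normr_ge0 x); rewrite real_normK ?num_real// in h.
have h2 : expR `|x| <= expR x + expR (- x).
  by case: (ger0P x) => _; rewrite ?lerDl ?lerDr expR_ge0.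
have -> : x ^+ 2 = 2 * (x ^+ 2 / 2`!%:R) by rewrite (_ : 2`! = 2%N)//; field.
by rewrite ler_pM2l// (le_trans _ h2)// (le_trans _ h)// lerDr.
Qed.

End exp_bounds.

Section iid_products.
Local Open Scope ereal_scope.
Context d d' (T : measurableType d) (V : measurableType d') (R : realType).
Variable P : probability T R.
Variables (n : nat) (W : 'I_n -> T -> V).
Hypothesis mW : forall i, measurable_fun setT (W i).
Hypothesis hind : mutually_independent P W.

(** The factors of index at least [k] are indicators, the others general, and [k] increases. To free
    factor [k], both sides are read as weighted integrals of a function of [W k], with the product
    of the other factors as weight on the left and the product of their expectations on the
    right. *)
Lemma independent_prod_step (k : nat) (g : 'I_n -> V -> R) :
  (forall i, measurable_fun setT (g i)) -> (forall i v, (0 <= g i v)%R) ->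
  (forall i, \int[P]_w (g i (W i w))%:E < +oo) ->
  (forall i : 'I_n, (k <= i)%N -> exists2 B, measurable B & g i = \1_B) ->
  \int[P]_w (\prod_i g i (W i w))%:E = \prod_i \int[P]_w (g i (W i w))%:E.
Proof.
elim: k g => [|k IH] g mg g0 fg hg.
  have [B hB] : {B : 'I_n -> set V & forall i, measurable (B i) /\ g i = \1_(B i)}.
    apply: (@choice _ _ (fun i B => measurable B /\ g i = \1_B)) => i.
    by have [B mB E] := hg i (leq0n i); exists B.
  have mB i : measurable (B i) by have [] := hB i.
  have gE i : g i = \1_(B i) by have [] := hB i.
  have := hind (finset.setTfor 'I_n) mB.
  under [X in _ = X -> _]eq_bigl do rewrite finset.in_setT.
  have mWB i : measurable (W i @^-1` B i) by exact: measurable_preimage.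
  have PE i : P (W i @^-1` B i) = \int[P]_w (g i (W i w))%:E.
    rewrite -[X in P X]setIT -integral_indic//; apply: eq_integral => w _.
    by rewrite gE indic_preimageE.
  under [X in _ = X -> _]eq_bigr do rewrite PE.
  move=> <-.
  set C := \bigcap_(i in _) _.
  have mC : measurable C.
    apply: fin_bigcap_measurable => //; exact: finite_finset.
  rewrite -[X in P X]setIT -integral_indic//; apply: eq_integral => w _; congr EFin.
  rewrite indicE; have [wC|wC] := boolP (w \in C).
    rewrite big1// => i _; rewrite gE indicE mem_set//.
    by move: wC; rewrite inE => /(_ i); apply; rewrite /= finset.in_setT.
  move: wC; rewrite notin_setE /C => h.
  have [i hi] : exists i, ~ B i (W i w).
    by apply: contrapT => /forallNP hn; apply: h => i _; apply: contrapT; exact: hn.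
  by rewrite (bigD1 i)//= gE indicE memNset// mul0r.
have [kn|kn] := leqP n k.
  by apply: IH => // i ki; move: (ltn_ord i); rewrite ltnNge (leq_trans kn ki).
pose j := Ordinal kn.
pose a w := (\prod_(i | i != j) g i (W i w))%R.
pose c := \prod_(i | i != j) \int[P]_w (g i (W i w))%:E.
have ge0I i : 0 <= \int[P]_w (g i (W i w))%:E.
  by apply: integral_ge0 => w _; rewrite lee_fin.
have fI i : \int[P]_w (g i (W i w))%:E \is a fin_num by rewrite ge0_fin_numE.
have fc : c \is a fin_num.
  by apply: (@big_ind _ (fun x => x \is a fin_num)) => // x y; exact: fin_numM.
have c0 : 0 <= c.
  by apply: (@big_ind _ (fun x => 0 <= x)) => // x y; exact: mule_ge0.
have ma : measurable_fun setT a.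
  rewrite /a; under eq_fun do rewrite big_mkcond.
  apply: measurable_prod => i _; case: (i != j) => //; exact: measurableT_comp.
have a0 w : (0 <= a w)%R by apply: prodr_ge0.
transitivity (\int[P]_w (a w * g j (W j w))%:E).
  by apply: eq_integral => w _; rewrite (bigD1 j)//= mulrC.
transitivity (\int[P]_w (fine c * g j (W j w))%:E); last first.
  rewrite [RHS](bigD1 j)//= -/c muleC -[in RHS](fineK fc).
  rewrite -ge0_integralZl ?fine_ge0//.
  - by apply/measurable_EFinP; exact: measurableT_comp.
  - by move=> w _; rewrite lee_fin.
  - by rewrite lee_fin fine_ge0.
apply: (@weighted_ext _ _ _ _ _ _ _ P P a (fun=> fine c) (W j) (W j)) => //.
  by move=> _; exact: fine_ge0.
move=> S mS.
(* With the freed factor replaced by an indicator, the family falls under the induction hypothesis;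
   this is the agreement on sets required by [weighted_ext]. *)
pose g' i := if i == j then \1_S else g i.
have mS' : measurable_fun setT (\1_S : V -> R) by exact: measurable_indic.
have := IH g' _ _ _ _.
rewrite (bigD1 j)//= /g' eqxx.
have -> : \prod_(i | i != j) \int[P]_w ((if i == j then \1_S else g i) (W i w))%:E = c.
  by apply: eq_bigr => i /negbTE ->.
have -> : \int[P]_w (\prod_i (if i == j then \1_S else g i) (W i w))%:E =
    \int[P]_w (a w * \1_S (W j w))%:E.
  apply: eq_integral => w _; rewrite (bigD1 j)//= eqxx mulrC; congr (_ * _)%:E.
  by apply: eq_bigr => i /negbTE ->.
move=> ->.
- rewrite muleC -(fineK fc) -ge0_integralZl ?fine_ge0//.
  + by apply/measurable_EFinP; exact: measurableT_comp.
  + by rewrite lee_fin fine_ge0.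
- by move=> i; case: (i == j).
- by move=> i v; case: (i == j).
- move=> i; case: (i == j) => //.
  apply: (@le_lt_trans _ _ (\int[P]_w 1)); last first.
    by rewrite integral_cst//; have /= -> := probability_setT P; rewrite mule1 ltry.
  apply: ge0_le_integral; first exact: measurableT.
  + by move=> w _; rewrite lee_fin.
  + by apply/measurable_EFinP; exact: measurableT_comp.
  + exact: measurable_cst.
  + by move=> w _; rewrite lee_fin indicE; case: (_ \in _).
- move=> i ki; have [ij|ij] := eqVneq i j; first by exists S.
  by apply: hg; rewrite ltn_neqAle ki andbT; apply: contra ij => /eqP e; apply/eqP/val_inj.
Qed.

Lemma independent_prod (g : 'I_n -> V -> R) :
  (forall i, measurable_fun setT (g i)) -> (forall i v, (0 <= g i v)%R) ->
  (forall i, \int[P]_w (g i (W i w))%:E < +oo) ->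
  \int[P]_w (\prod_i g i (W i w))%:E = \prod_i \int[P]_w (g i (W i w))%:E.
Proof.
move=> mg g0 fg; apply: (independent_prod_step (k := n)) => // i.
by rewrite leqNgt ltn_ord.
Qed.

End iid_products.

Section iid_mgf.
Local Open Scope ereal_scope.
Context d d' (T : measurableType d) (V : measurableType d') (R : realType).
Variable P : probability T R.
Variables (n : nat) (W : 'I_n -> T -> V) (W0 : T -> V).
Hypothesis mW : forall i, measurable_fun setT (W i).
Hypothesis mW0 : measurable_fun setT W0.
Hypothesis hind : mutually_independent P W.
Hypothesis hid : forall i, identically_distributed P (W i) W0.

Lemma identically_distributed_integral i (g : V -> R) : measurable_fun setT g ->
  \int[P]_w (g (W i w))%:E = \int[P]_w (g (W0 w))%:E.
Proof.
move=> mg.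
have H (f : V -> R) (W' : T -> V) :
    \int[P]_w (f (W' w))%:E = \int[P]_w (1 * f (W' w))%:E.
  by apply: eq_integral => w _; rewrite mul1r.
rewrite (H g (W i)) (H g W0).
apply: (@weighted_ext _ _ _ _ _ _ _ P P (fun=> 1%R) (fun=> 1%R) (W i) W0) => //.
move=> S mS; rewrite -!H.
have E (W' : T -> V) : measurable_fun setT W' -> \int[P]_w (\1_S (W' w))%:E = P (W' @^-1` S).
  move=> mW'; have mp := measurable_preimage mW' mS.
  rewrite -[X in _ = P X]setIT -integral_indic//.
by rewrite !E// hid.
Qed.

Variables (g : V -> R) (l0 s2 : R).
Hypothesis mg : measurable_fun setT g.
Hypothesis ig : P.-integrable setT (fun w => (g (W0 w))%:E).
Hypothesis hs2 : \int[P]_w (g (W0 w) ^+ 2 * expR (l0 * `|g (W0 w)|))%:E <= s2%:E.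
Let m : R := (\int[P]_w g (W0 w))%R.
Definition centered_sum w : R := (\sum_i (g (W i w) - m))%R.

Let mgW0 : measurable_fun setT (fun w => g (W0 w)). Proof. exact: measurableT_comp. Qed.
Let mgW i : measurable_fun setT (fun w => g (W i w)). Proof. exact: measurableT_comp. Qed.

Lemma measurable_centered_sum : measurable_fun setT centered_sum.
Proof. by apply: measurable_sum => i; apply: measurable_funB. Qed.

(** From [e^x <= 1 + x + x^2 e^|x|] at [x = l g] one gets [E e^(l g) <= 1 + l m + l^2 s2 <= e^(l m +
    l^2 s2)]; the mean cancels afterwards, so [s2] may refer to the uncentred [g]. *)
Lemma mgf_le l : (`|l| <= l0)%R ->
  \int[P]_w (expR (l * (g (W0 w) - m)))%:E <= (expR (l ^+ 2 * s2))%:E.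
Proof.
move=> ll0.
pose k w : R := (g (W0 w) ^+ 2 * expR (l0 * `|g (W0 w)|))%R.
have mk : measurable_fun setT k.
  apply: measurable_funM; first exact: measurable_funX.
  apply: measurableT_comp => //; apply: measurable_funM => //.
  exact: measurableT_comp.
have k0 w : (0 <= k w)%R by rewrite mulr_ge0 ?sqr_ge0 ?expR_ge0.
have ik : P.-integrable setT (EFin \o k).
  apply/integrableP; split; first exact/measurable_EFinP.
  under eq_integral do rewrite /= ger0_norm//.
  exact: le_lt_trans hs2 (ltry _).
have ml : measurable_fun setT (fun w => expR (l * g (W0 w))).
  by apply: measurableT_comp => //; exact: measurable_funM.
have h1 : \int[P]_w (expR (l * g (W0 w)))%:E <= (1 + l * m + l ^+ 2 * s2)%:E.
  apply: (@le_trans _ _ (\int[P]_w (1 + l * g (W0 w) + l ^+ 2 * k w)%:E)).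
    have pw w : (expR (l * g (W0 w)) <= 1 + l * g (W0 w) + l ^+ 2 * k w)%R.
      apply: le_trans (expR_taylor2 _) _; rewrite lerD2l exprMn -mulrA.
      rewrite ler_wpM2l ?sqr_ge0// ler_wpM2l ?sqr_ge0// ler_expR normrM.
      by rewrite ler_wpM2r.
    apply: ge0_le_integral; first exact: measurableT.
    - by move=> w _; rewrite lee_fin expR_ge0.
    - exact/measurable_EFinP.
    - apply/measurable_EFinP; apply: measurable_funD; last exact: measurable_funM.
      by apply: measurable_funD => //; exact: measurable_funM.
    - by move=> w _; rewrite lee_fin.
  under eq_integral do rewrite EFinD EFinD EFinM [(_ ^+ 2 * _)%:E]EFinM.
  have i1 : P.-integrable setT (fun w => l%:E * (g (W0 w))%:E) by exact: integrableZl.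
  have i0 : P.-integrable setT (fun w : T => 1%:E).
    exact: (finite_measure_integrable_cst P 1%R measurableT).
  have i2 : P.-integrable setT (fun w => (l ^+ 2)%:E * (k w)%:E) by exact: integrableZl.
  rewrite integralD//; last exact: integrableD.
  rewrite integralD// integralZl// integralZl// integral_cst//.
  have /= -> := probability_setT P; rewrite mule1.
  have -> : \int[P]_w (g (W0 w))%:E = m%:E.
    by rewrite /m /Rintegral fineK//; exact: integrable_fin_num.
  rewrite EFinD; apply: leeD; first by rewrite EFinD EFinM.
  by rewrite [(_ * s2)%:E]EFinM lee_wpmul2l// lee_fin sqr_ge0.
have -> : (fun w => (expR (l * (g (W0 w) - m)))%:E) =
    (fun w => (expR (- (l * m)))%:E * (expR (l * g (W0 w)))%:E).
  by apply/funext => w; rewrite -EFinM -expRD mulrBr addrC.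
rewrite ge0_integralZl; [|exact: measurableT|exact/measurable_EFinP
  |by move=> w _; rewrite lee_fin expR_ge0|by rewrite lee_fin expR_ge0].
apply: (@le_trans _ _ ((expR (- (l * m)))%:E * (1 + l * m + l ^+ 2 * s2)%:E)).
  by rewrite lee_wpmul2l// lee_fin expR_ge0.
rewrite -EFinM lee_fin.
have := expR_ge1Dx (l * m + l ^+ 2 * s2); rewrite addrA => h2.
have -> : expR (l ^+ 2 * s2) = (expR (- (l * m)) * expR (l * m + l ^+ 2 * s2))%R.
  by rewrite -expRD addrA addNr add0r.
by rewrite ler_wpM2l ?expR_ge0.
Qed.

Lemma iid_mgf l : (`|l| <= l0)%R ->
  \int[P]_w (expR (l * centered_sum w))%:E <= (expR (n%:R * l ^+ 2 * s2))%:E.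
Proof.
move=> ll0; pose e v : R := (expR (l * (g v - m)))%R.
have me : measurable_fun setT e.
  by apply: measurableT_comp => //; apply: measurable_funM => //; exact: measurable_funB.
have eE i : \int[P]_w (e (W i w))%:E = \int[P]_w (e (W0 w))%:E.
  exact: identically_distributed_integral.
have e0 v : (0 <= e v)%R by exact: expR_ge0.
have le1 := mgf_le ll0.
have -> : (fun w => (expR (l * centered_sum w))%:E) = (fun w => (\prod_i e (W i w))%:E).
  by apply/funext => w; rewrite /centered_sum mulr_sumr expR_sum.
rewrite (independent_prod mW hind (g := fun=> e))//; last first.
  by move=> i; rewrite eE; exact: le_lt_trans le1 (ltry _).
under eq_bigr do rewrite eE.
have I0 : 0 <= \int[P]_w (e (W0 w))%:E by apply: integral_ge0 => w _; rewrite lee_fin.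
have fI : \int[P]_w (e (W0 w))%:E \is a fin_num.
  by rewrite ge0_fin_numE//; exact: le_lt_trans le1 (ltry _).
rewrite -(fineK fI) prodEFin prodr_const card_ord lee_fin.
rewrite -mulrA expRM_natl lerXn2r ?nnegrE ?fine_ge0 ?expR_ge0//.
by rewrite -lee_fin fineK.
Qed.

Lemma iid_tail l s : (0 < l <= l0)%R ->
  P [set w | (n%:R * s <= `|centered_sum w|)%R] <=
  (2 * expR (n%:R * l ^+ 2 * s2 - l * (n%:R * s)))%:E.
Proof.
move=> /andP[l00 ll0].
have mS := measurable_centered_sum.
set A := [set w | _].
have mA : measurable A.
  rewrite -[A]setTI; apply: (measurable_fun_ler (measurable_cst _)) => //.
  exact: measurableT_comp.
have me c : measurable_fun setT (fun w => expR (c * centered_sum w)).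
  by apply: measurableT_comp => //; exact: measurable_funM.
have h1 := iid_mgf (l := l); have h2 := iid_mgf (l := (- l)%R).
have : (expR (l * (n%:R * s)))%:E * P A <=
    \int[P]_w (expR (l * centered_sum w) + expR (- l * centered_sum w))%:E.
  rewrite -[P A]/(P A) -[X in P X]setIT -integral_indic//.
  rewrite -ge0_integralZl ?lee_fin ?expR_ge0//; last first.
    exact/measurable_EFinP.
  apply: ge0_le_integral; first exact: measurableT.
  - by move=> w _; rewrite -EFinM lee_fin mulr_ge0 ?expR_ge0.
  - by apply/measurable_EFinP; exact: measurable_funM.
  - by apply/measurable_EFinP; exact: measurable_funD.
  move=> w _; rewrite -EFinM lee_fin indicE; have [wA|wA] := boolP (w \in A); last first.
    by rewrite mulr0 addr_ge0 ?expR_ge0.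
  rewrite mulr1; move: wA; rewrite inE /A /= => wA.
  have : (expR (l * (n%:R * s)) <= expR (l * `|centered_sum w|))%R.
    by rewrite ler_expR ler_wpM2l// ltW.
  move/le_trans; apply; case: (ger0P (centered_sum w)) => _.
    by rewrite lerDl expR_ge0.
  by rewrite mulrN -mulNr lerDr expR_ge0.
under eq_integral do rewrite EFinD.
rewrite ge0_integralD; [|exact: measurableT|by move=> w _; rewrite lee_fin expR_ge0
  |exact/measurable_EFinP|by move=> w _; rewrite lee_fin expR_ge0|exact/measurable_EFinP].
move=> h.
have {}h := le_trans h (leeD (h1 _) (h2 _)).
have fP : P A \is a fin_num by rewrite fin_num_measure.
rewrite -(fineK fP) lee_fin expRB mulrA ler_pdivlMr ?expR_gt0//.
have : (expR (l * (n%:R * s)))%:E * P A <=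
  (expR (n%:R * l ^+ 2 * s2))%:E + (expR (n%:R * (- l) ^+ 2 * s2))%:E.
  by apply: h; rewrite ?normrN gtr0_norm.
rewrite -(fineK fP) -EFinM -EFinD lee_fin sqrrN => h3.
by rewrite mulrC (le_trans h3)// mulr2n mulrDl mul1r.
Qed.

(** Obtained from [x^2 <= 2 (e^x + e^-x)] at [x = l S]. With [l = (n s2)^(-1/2)] this is the usual
    variance bound up to a constant. *)
Lemma iid_second_moment l : (0 < l <= l0)%R ->
  \int[P]_w (centered_sum w ^+ 2)%:E <= (4 * expR (n%:R * l ^+ 2 * s2) / l ^+ 2)%:E.
Proof.
move=> /andP[l00 ll0].
have mS := measurable_centered_sum.
have me c : measurable_fun setT (fun w => expR (c * centered_sum w)).
  by apply: measurableT_comp => //; exact: measurable_funM.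
have mS2 : measurable_fun setT (fun w => centered_sum w ^+ 2)%R by exact: measurable_funX.
have h : (l ^+ 2)%:E * \int[P]_w (centered_sum w ^+ 2)%:E <=
   2%:E * \int[P]_w (expR (l * centered_sum w) + expR (- l * centered_sum w))%:E.
  rewrite -ge0_integralZl; [|exact: measurableT|exact/measurable_EFinP
    |by move=> w _; rewrite lee_fin sqr_ge0|by rewrite lee_fin sqr_ge0].
  rewrite -ge0_integralZl; [|exact: measurableT
    |by apply/measurable_EFinP; exact: measurable_funD
    |by move=> w _; rewrite lee_fin addr_ge0 ?expR_ge0|by rewrite lee_fin].
  apply: ge0_le_integral; first exact: measurableT.
  - by move=> w _; rewrite -EFinM lee_fin mulr_ge0 ?sqr_ge0.
  - by apply/measurable_EFinP; exact: measurable_funM.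
  - by apply/measurable_EFinP; apply: measurable_funM => //; exact: measurable_funD.
  move=> w _; rewrite -!EFinM lee_fin -exprMn mulNr.
  exact: sqr_le_expR.
have l2 : (0 < l ^+ 2)%R by rewrite exprn_gt0.
have h2 : \int[P]_w (expR (l * centered_sum w) + expR (- l * centered_sum w))%:E
    <= (2 * expR (n%:R * l ^+ 2 * s2))%:E.
  under eq_integral do rewrite EFinD.
  rewrite ge0_integralD; [|exact: measurableT|by move=> w _; rewrite lee_fin expR_ge0
    |exact/measurable_EFinP|by move=> w _; rewrite lee_fin expR_ge0|exact/measurable_EFinP].
  have := leeD (iid_mgf (l := l) _) (iid_mgf (l := (- l)%R) _).
  rewrite normrN gtr0_norm// sqrrN => /(_ ll0 ll0) h3.
  by apply: le_trans h3 _; rewrite -EFinD lee_fin mulr2n mulrDl mul1r.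
rewrite EFinM muleC lee_pdivlMl//; apply: le_trans h _.
have -> : (4 * expR (n%:R * l ^+ 2 * s2) = 2 * (2 * expR (n%:R * l ^+ 2 * s2)))%R by ring.
by rewrite [leRHS]EFinM lee_wpmul2l// lee_fin.
Qed.

End iid_mgf.

(** * Euclidean norm, coercive matrices and the smallest eigenvalue *)

Section euclidean.
Context (R : realType) (p : nat).
Implicit Types (u v w : 'cV[R]_p) (A B : 'M[R]_p) (a b c : R).

Lemma dotpE u v : dotp u v = \sum_i u i 0 * v i 0.
Proof. by rewrite /dotp mxE; apply: eq_bigr => i _; rewrite mxE. Qed.

Lemma dotpDl u v w : dotp (u + v) w = dotp u w + dotp v w.
Proof. by rewrite dotpC dotpDr !(dotpC w). Qed.
Lemma dotpZl a u v : dotp (a *: u) v = a * dotp u v.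
Proof. by rewrite dotpC dotpZr dotpC. Qed.
Lemma dotpNr u v : dotp u (- v) = - dotp u v.
Proof. by rewrite -scaleN1r dotpZr mulN1r. Qed.
Lemma dotpBr u v w : dotp u (v - w) = dotp u v - dotp u w.
Proof. by rewrite dotpDr dotpNr. Qed.
Lemma dotpBl u v w : dotp (u - v) w = dotp u w - dotp v w.
Proof. by rewrite dotpC dotpBr !(dotpC w). Qed.
Lemma dotp0r u : dotp u 0 = 0.
Proof. by rewrite -(scale0r 0) dotpZr mul0r. Qed.

Lemma sqr_l2norm u : l2norm u ^+ 2 = dotp u u.
Proof.
rewrite /l2norm sqr_sqrtr; last by apply: sumr_ge0 => i _; exact: sqr_ge0.
by rewrite dotpE; apply: eq_bigr => i _; rewrite expr2.
Qed.

Lemma l2norm_ge0 u : 0 <= l2norm u. Proof. exact: sqrtr_ge0. Qed.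

Lemma dotp_ge0 u : 0 <= dotp u u. Proof. by rewrite -sqr_l2norm sqr_ge0. Qed.

Lemma l2norm0_eq0 u : l2norm u = 0 -> u = 0.
Proof.
move=> u0; have : dotp u u = 0 by rewrite -sqr_l2norm u0 expr0n.
rewrite dotpE => /eqP; rewrite psumr_eq0 => [|i _]; last by rewrite -expr2 sqr_ge0.
move=> /allP h; apply/colP => i; rewrite mxE.
have := h i (mem_index_enum i); rewrite -expr2 sqrf_eq0 => /eqP //.
Qed.

Lemma l2normZ a u : l2norm (a *: u) = `|a| * l2norm u.
Proof.
apply/eqP; rewrite -(@eqrXn2 _ 2)// ?mulr_ge0 ?l2norm_ge0//.
by rewrite exprMn !sqr_l2norm dotpZl dotpZr mulrA -expr2 real_normK ?num_real.
Qed.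

Lemma cauchy_schwarz u v : `|dotp u v| <= l2norm u * l2norm v.
Proof.
have [v0|vn0] := eqVneq (l2norm v) 0.
  by rewrite v0 mulr0 (l2norm0_eq0 v0) dotp0r normr0.
have vp : 0 < l2norm v by rewrite lt_def vn0 l2norm_ge0.
rewrite -(@ler_pXn2r _ 2)// ?nnegrE ?mulr_ge0 ?l2norm_ge0//.
rewrite real_normK ?num_real// exprMn !sqr_l2norm.
have dv : 0 < dotp v v by rewrite -sqr_l2norm exprn_gt0.
have := dotp_ge0 (u - (dotp u v / dotp v v) *: v).
rewrite !dotpBr !dotpBl !dotpZl !dotpZr ?dotpZl (dotpC v u).
set x := dotp u v; set y := dotp v v; set z := dotp u u => h.
have : 0 <= (z - x / y * x - (x / y * (x - x / y * y))) * y.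
  by rewrite mulr_ge0 ?(ltW dv)//; move: h; congr (_ <= _); field; rewrite gt_eqF.
have -> : (z - x / y * x - (x / y * (x - x / y * y))) * y = z * y - x ^+ 2.
  by field; rewrite gt_eqF.
by rewrite subr_ge0.
Qed.

Lemma ler_l2normD u v : l2norm (u + v) <= l2norm u + l2norm v.
Proof.
rewrite -(@ler_pXn2r _ 2)// ?nnegrE ?addr_ge0 ?l2norm_ge0//.
rewrite sqrrD !sqr_l2norm !dotpDr !dotpDl (dotpC v u).
have := le_trans (ler_norm _) (cauchy_schwarz u v).
by move: (dotp u v) (l2norm u * l2norm v) => s t h; rewrite mulr2n; lra.
Qed.

Lemma coord_le_l2norm u i : `|u i 0| <= l2norm u.
Proof.
rewrite -(@ler_pXn2r _ 2)// ?nnegrE ?l2norm_ge0//.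
rewrite real_normK ?num_real// sqr_l2norm dotpE (bigD1 i)//= -expr2 lerDl.
by apply: sumr_ge0 => j _; rewrite -expr2 sqr_ge0.
Qed.

(* Dual characterisation of the Euclidean norm. *)
Lemma l2norm_dual v c : 0 <= c ->
  (forall u, l2norm u <= 1 -> dotp u v <= c) -> l2norm v <= c.
Proof.
move=> c0 h; have [->//|vn0] := eqVneq (l2norm v) 0.
have vp : 0 < l2norm v by rewrite lt_def vn0 l2norm_ge0.
have := h ((l2norm v)^-1 *: v).
rewrite l2normZ gtr0_norm ?invr_gt0// mulVf// lexx dotpZl -sqr_l2norm expr2 mulKf//.
exact.
Qed.

(* Coercive matrices are invertible, with the expected bound on the inverse. *)
Lemma coercive_inverse A c : 0 < c ->
  (forall u, c * l2norm u ^+ 2 <= dotp u (A *m u)) ->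
  A \in unitmx /\ forall v, l2norm (invmx A *m v) <= c^-1 * l2norm v.
Proof.
move=> c0 h.
have uA : A \in unitmx.
  rewrite -unitmx_tr -row_free_unit -kermx_eq0; apply/eqP/row_matrixP => i.
  rewrite row0; set w := row i _.
  have kw : w *m A^T = 0 by apply/sub_kermxP; exact: row_sub.
  have Aw : A *m w^T = 0 by rewrite -[A]trmxK -trmx_mul kw trmx0.
  have := h w^T; rewrite Aw dotp0r pmulr_rle0// => w0.
  have : l2norm w^T = 0 by apply/eqP; rewrite -sqrf_eq0 eq_le w0 sqr_ge0.
  by move=> /l2norm0_eq0 /(congr1 trmx); rewrite trmxK trmx0.
split => // v; set u := invmx A *m v.
have Au : A *m u = v by rewrite mulKVmx.
have := h u; rewrite Au => h1.
have h2 := le_trans h1 (le_trans (ler_norm _) (cauchy_schwarz u v)).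
rewrite ler_pdivlMl//.
have [->|un0] := eqVneq (l2norm u) 0; first by rewrite mulr0 l2norm_ge0.
have up : 0 < l2norm u by rewrite lt_def un0 l2norm_ge0.
by rewrite -(ler_pM2l up) mulrCA -expr2.
Qed.

End euclidean.

Section rayleigh.
Context (R : realType) (p : nat) (A : 'M[R]_p) (c : R).
Hypothesis symA : A^T = A.
Hypothesis eigA : forall a, eigenvalue A a -> c < a.

(** Row vectors, the form in which [rV_compact] and [eigenvalueP] apply. *)
Let E : topologicalType := 'rV[R]_p.
Let Q (v : E) : R := \sum_i \sum_j v 0 i * A i j * v 0 j.
Let N (v : E) : R := \sum_i v 0 i ^+ 2.

Let continuous_sum_cV (f : 'I_p -> E -> R) :
  (forall i, continuous (f i)) -> continuous (fun s => \sum_i f i s).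
Proof.
move=> cf; have : forall r : seq 'I_p, continuous (fun s => \sum_(i <- r) f i s).
  elim=> [|i r IH].
    rewrite (_ : (fun s => _) = fun=> 0); last by apply/funext => s; rewrite big_nil.
    exact: cst_continuous.
  rewrite (_ : (fun s => _) = fun s => f i s + \sum_(i <- r) f i s); last first.
    by apply/funext => s; rewrite big_cons.
  by move=> x; apply: cvgD; [exact: nbhs_filter|exact: cf|exact: IH].
exact.
Qed.

Let cM (f g : E -> R) : continuous f -> continuous g ->
  continuous (fun v => f v * g v).
Proof. by move=> cf cg x; apply: cvgM; [exact: nbhs_filter|exact: cf|exact: cg]. Qed.

Let cC i : continuous (fun v : E => v 0 i : R).
Proof. exact: coord_continuous. Qed.

Let cQ : continuous Q.
Proof.
apply: continuous_sum_cV => i; apply: continuous_sum_cV => j.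
apply: (cM (f := fun v : E => v 0 i * A i j)) => //.
by apply: (cM (g := fun=> A i j)) => //; exact: cst_continuous.
Qed.

Let cN : continuous N.
Proof.
apply: continuous_sum_cV => i.
rewrite (_ : (fun v => _) = fun v : E => v 0 i * v 0 i); first exact: cM.
by apply/funext => v; rewrite expr2.
Qed.

Let QE v : Q v = dotp v^T (A *m v^T).
Proof.
rewrite dotpE; apply: eq_bigr => i _; rewrite !mxE mulr_sumr.
by apply: eq_bigr => j _; rewrite !mxE mulrA.
Qed.

Let NE v : N v = dotp v^T v^T.
Proof. by rewrite dotpE; apply: eq_bigr => i _; rewrite !mxE expr2. Qed.

Let sphere := [set v : E | N v = 1].

Let compact_sphere : compact sphere.
Proof.
have -> : sphere = [set v : 'rV[R]_p | forall i, `[(-1 : R), 1]%classic (v ord0 i)]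
    `&` N @^-1` [set 1].
  apply/seteqP; split => v /=; last by case.
  move=> Nv; split => // i; rewrite /= in_itv/= -ler_norml.
  rewrite -(@expr_le1 _ 2)// real_normK ?num_real// -Nv /N (bigD1 i)//= lerDl.
  by apply: sumr_ge0 => j _; exact: sqr_ge0.
apply: compact_closedI.
  apply: (@rV_compact R p (fun=> `[(-1 : R), 1]%classic)) => i.
  exact: segment_compact.
apply: closed_comp; last exact: closed_eq.
by move=> x _; exact: cN.
Qed.

(** The quadratic form attains its minimum [a] on the compact unit sphere, at some [x]. Along the
    residual [y = A x - a x], the nonnegative form [w^T A w - a |w|^2] takes at [x + t y] the value
    [2 t |y|^2 + t^2 b], which forces [y = 0]. So [a] is an eigenvalue and exceeds [c]. *)
Lemma rayleigh_ge (u : 'cV[R]_p) : c * dotp u u <= dotp u (A *m u).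
Proof.
have [u0|un0] := eqVneq (l2norm u) 0.
  by rewrite (l2norm0_eq0 u0) mulmx0 !dotp0r mulr0.
have normed (w : 'cV[R]_p) : l2norm w != 0 -> sphere ((l2norm w)^-1 *: w)^T.
  move=> wn0; rewrite /sphere /= NE trmxK dotpZl dotpZr -sqr_l2norm.
  by rewrite expr2 mulKf// mulVf.
have [v vS vmin] : exists2 v, v \in sphere & forall t, t \in sphere -> Q v <= Q t.
  apply: compact_EVT_min => //; first by eexists; exact: normed un0.
  by apply: continuous_subspaceT.
move: vS; rewrite inE /sphere /= NE => Nv.
pose a := Q v.
have Qa w : a * dotp w w <= dotp w (A *m w).
  have [w0|wn0] := eqVneq (l2norm w) 0.
    by rewrite (l2norm0_eq0 w0) mulmx0 !dotp0r mulr0.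
  have := vmin ((l2norm w)^-1 *: w)^T; rewrite inE => /(_ (normed _ wn0)).
  rewrite !QE trmxK -scalemxAr dotpZl dotpZr -QE -/a -sqr_l2norm mulrA -invfM -expr2.
  have wp : 0 < l2norm w ^+ 2 by rewrite exprn_gt0// lt_def wn0 l2norm_ge0.
  by rewrite mulrC ler_pdivlMr.
pose x := v^T.
have [y yE] : exists y, y = A *m x - a *: x by eexists.
have symd w z : dotp w (A *m z) = dotp z (A *m w).
  by rewrite dotpC /dotp trmx_mul symA -mulmxA.
have xx : dotp x x = 1 := Nv.
have xAx : dotp x (A *m x) = a by rewrite /a QE.
have xy : dotp x y = 0 by rewrite yE dotpBr dotpZr xAx xx mulr1 subrr.
pose b := dotp y (A *m y) - a * dotp y y.
have lin t : 0 <= 2 * t * dotp y y + t ^+ 2 * b.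
  have := Qa (x + t *: y); rewrite -subr_ge0.
  rewrite mulmxDr -scalemxAr !dotpDr !dotpDl !dotpZr !dotpZl (symd x y) (dotpC y x) xy xx xAx.
  have -> : dotp y (A *m x) = dotp y y.
    have Ax : A *m x = y + a *: x by rewrite yE subrK.
    rewrite Ax dotpDr dotpZr (dotpC y x) xy.
    by rewrite mulr0 addr0.
  by congr (_ <= _); rewrite /b; ring.
have b0 : 0 <= b by rewrite subr_ge0; exact: Qa.
have y0 : dotp y y = 0.
  apply/eqP; rewrite eq_le dotp_ge0 andbT leNgt; apply/negP => yp.
  (* A small negative [t] gives a contradiction; the shift to [b + 1] keeps the denominator positive
     when [b = 0]. *)
  have := lin (- (dotp y y / (b + 1))).
  set d := dotp y y in yp *.
  have -> : 2 * - (d / (b + 1)) * d + (- (d / (b + 1))) ^+ 2 * b =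
     - (d / (b + 1)) ^+ 2 * (b + 2) by field; rewrite gt_eqF// ltr_wpDl.
  apply/negP; rewrite -ltNge mulNr oppr_lt0 mulr_gt0// ?ltr_wpDl//.
  by rewrite exprn_gt0// divr_gt0// ltr_wpDl.
have eig : eigenvalue A a.
  apply/eigenvalueP; exists v; last first.
    apply/eqP => v0; move: Nv; rewrite v0 trmx0 dotp0r => /esym/eqP.
    by rewrite oner_eq0.
  have : y = 0 by apply: l2norm0_eq0; apply/eqP; rewrite -sqrf_eq0 sqr_l2norm y0.
  rewrite yE => /eqP; rewrite subr_eq0 => /eqP /(congr1 trmx).
  by rewrite trmx_mul symA linearZ/= trmxK.
apply: le_trans (Qa u); rewrite ler_wpM2r ?dotp_ge0// ltW//.
exact: eigA.
Qed.

End rayleigh.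

(** * Regularity of the conditional c.d.f. and the slab estimate *)

Section conditional_bounds.
Local Open Scope ereal_scope.
Context d d' (T : measurableType d) (V : measurableType d') (R : realType).
Variable P : probability T R.
Variables (Z : T -> V) (mZ : measurable_fun setT Z).

Lemma cond_prob_le A q (c : R) : is_cond_prob P A Z q ->
  (forall B, measurable B -> P (A `&` Z @^-1` B) <= c%:E * P (Z @^-1` B)) ->
  {ae P, forall w, (q (Z w) <= c)%R}.
Proof.
move=> [mq iq Eq] h; pose B := [set v | (c < q v)%R].
have mB : measurable B.
  by rewrite -[B]setTI; apply: (measurable_fun_ltr (measurable_cst _) mq).
have mZB : measurable (Z @^-1` B) by exact: measurable_preimage.
have iqB : P.-integrable (Z @^-1` B) (fun w => (q (Z w))%:E) by exact: integrableS iq.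
have icB : P.-integrable (Z @^-1` B) (fun w => c%:E).
  exact: (finite_measure_integrable_cst P c mZB).
exists (Z @^-1` B); split => //.
- apply: (@pos_integral_le0_null _ _ _ P _ (fun w => q (Z w) - c)%R) => //.
  + exact: (integrableB mZB iqB icB).
  + by move=> w /=; rewrite subr_gt0.
  + have -> := integralB_EFin mZB iqB icB.
    rewrite -[X in X - _]Eq// integral_cst//.
    by rewrite sube_le0 h.
- by move=> w /= /negP; rewrite -ltNge.
Qed.

Lemma cond_prob_ge A q (c : R) : is_cond_prob P A Z q ->
  (forall B, measurable B -> c%:E * P (Z @^-1` B) <= P (A `&` Z @^-1` B)) ->
  {ae P, forall w, (c <= q (Z w))%R}.
Proof.
move=> [mq iq Eq] h; pose B := [set v | (q v < c)%R].
have mB : measurable B.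
  by rewrite -[B]setTI; apply: (measurable_fun_ltr mq (measurable_cst _)).
have mZB : measurable (Z @^-1` B) by exact: measurable_preimage.
have iqB : P.-integrable (Z @^-1` B) (fun w => (q (Z w))%:E) by exact: integrableS iq.
have icB : P.-integrable (Z @^-1` B) (fun w => c%:E).
  exact: (finite_measure_integrable_cst P c mZB).
exists (Z @^-1` B); split => //.
- apply: (@pos_integral_le0_null _ _ _ P _ (fun w => c - q (Z w))%R) => //.
  + exact: (integrableB mZB icB iqB).
  + by move=> w /=; rewrite subr_gt0.
  + have -> := integralB_EFin mZB icB iqB.
    rewrite -[X in _ - X]Eq// integral_cst//.
    by rewrite sube_le0 h.
- by move=> w /= /negP; rewrite -ltNge.
Qed.

Variables (X eps : T -> R) (F : R -> V -> R) (CF : R) (N : nat).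
Hypotheses (mX : measurable_fun setT X) (meps : measurable_fun setT eps).
Hypothesis hmed : cond_median0 P eps (fun w => (X w, Z w)).
Hypothesis hcdf : is_cond_cdf P eps Z F.
Hypothesis hder : {ae P, forall w, bounded_derivatives N.+1 CF (F^~ (Z w))}.

Let mXZ : measurable_fun setT (fun w => (X w, Z w)).
Proof. exact: measurable_fun_pair. Qed.

(** The median condition is given [(X, Z)]; testing on [setT x B] integrates [X] out. *)
Let half_le (A : set T) (q : R * V -> R) :
  is_cond_prob P A (fun w => (X w, Z w)) q ->
  {ae P, forall w, (2^-1 <= q (X w, Z w))%R} ->
  forall B, measurable B -> (2^-1)%:E * P (Z @^-1` B) <= P (A `&` Z @^-1` B).
Proof.
move=> [mq iq Eq] h B mB.
have mTB : measurable (setT `*` B : set (R * V)) by exact: measurableX.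
have ZE : (fun w => (X w, Z w)) @^-1` (setT `*` B) = Z @^-1` B.
  by apply/seteqP; split => w /=; [case|split].
have mZB : measurable (Z @^-1` B) by exact: measurable_preimage.
have := Eq _ mTB; rewrite ZE => ->.
rewrite -(integral_cst P mZB); apply: (@le_trans _ _
    (\int[P]_(w in Z @^-1` B) (Num.max (q (X w, Z w)) 0)%:E)).
  apply: ae_ge0_le_integral => //.
  - by move=> w _; rewrite lee_fin.
  - by move=> w _; rewrite lee_fin le_max lexx orbT.
  - apply/measurable_EFinP; apply: measurable_funTS; apply: measurable_maxr => //.
    exact: measurableT_comp.
  - by apply: filterS h => w h _; rewrite lee_fin le_max h.
rewrite le_eqVlt; apply/orP; left; apply/eqP; apply: ae_eq_integral => //.
- apply/measurable_EFinP; apply: measurable_funTS; apply: measurable_maxr => //.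
  exact: measurableT_comp.
- by apply/measurable_EFinP; apply: measurable_funTS; exact: measurableT_comp.
- apply: filterS h => w h _; congr EFin; apply: max_l.
  by rewrite (le_trans _ h).
Qed.

Definition good_cdf (f : R -> R) : Prop :=
  [/\ forall u, (0 <= f u <= 1)%R, forall u v, (`|f u - f v| <= CF * `|u - v|)%R,
      f 0%R = 2^-1%R & bounded_derivatives N.+1 CF f].

(** The median yields [F(0|Z) >= 1/2], and [F(-1/(k+1)|Z) <= 1/2] for all [k]; Lipschitz continuity
    squeezes [F(0|Z)] to [1/2]. The bounds 0 and 1 come from monotonicity and the limits at
    infinity. *)
Lemma good_cdf_ae : {ae P, forall w, good_cdf (F^~ (Z w))}.
Proof.
have [hF hlim] := hcdf.
have [q1 [q2 [h1 h2 h12]]] := hmed.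
have mle u : measurable [set w | (eps w <= u)%R] by exact: measurable_le_level.
have lo : {ae P, forall w, (2^-1 <= F 0%R (Z w))%R}.
  apply: (cond_prob_ge (hF 0%R)); apply: (half_le h1).
  by apply: filterS h12 => w [].
have mge : measurable [set w | (0 <= eps w)%R].
  by rewrite -[[set _ | _]]setTI; exact: (measurable_fun_ler (measurable_cst _) meps).
(* Strictly negative levels are used because [eps <= u] excludes [0 <= eps] only when [u < 0]. *)
have up k : {ae P, forall w, (F (- k.+1%:R^-1) (Z w) <= 2^-1)%R}.
  apply: (cond_prob_le (hF _)) => B mB.
  have mZB : measurable (Z @^-1` B) by exact: measurable_preimage.
  have h : (2^-1)%:E * P (Z @^-1` B) <= P ([set w | (0 <= eps w)%R] `&` Z @^-1` B).
    by apply: (half_le h2) => //; apply: filterS h12 => w [].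
  set A := [set w | (eps w <= _)%R]; set C := [set w | (0 <= eps w)%R] in h *.
  have mA : measurable A := mle _.
  have : P (A `&` Z @^-1` B) + P (C `&` Z @^-1` B) <= P (Z @^-1` B).
    rewrite -measureU; [| exact: measurableI | exact: measurableI |].
      by apply: le_measure; rewrite ?inE//; [apply: measurableU; exact: measurableI|
        move=> w [[]|[]]].
    apply/seteqP; split => // w [[/= a _] [/= b _]].
    have := le_trans b a; rewrite oppr_ge0 leNgt invr_gt0.
    by rewrite ltr0n.
  have f1 : P (A `&` Z @^-1` B) \is a fin_num.
    by rewrite fin_num_measure//; exact: measurableI.
  have f2 : P (C `&` Z @^-1` B) \is a fin_num.
    by rewrite fin_num_measure//; exact: measurableI.
  have f3 : P (Z @^-1` B) \is a fin_num by rewrite fin_num_measure.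
  move: h; rewrite -(fineK f1) -(fineK f2) -(fineK f3) -!EFinM -EFinD !lee_fin.
  by move: (fine _) (fine _) (fine _) => a b c h h'; lra.
have upall := ae_foralln up.
apply: filterS2 (filterI hlim hder) (filterI lo upall) => w [[hom _ lNy ly] hd] [l0 u0].
have dF x : derivable (F^~ (Z w)) x 1 by have [] := hd 1%N isT x.
have lipF u v : (`|F u (Z w) - F v (Z w)| <= CF * `|u - v|)%R.
  apply: (derive1_bound_lip dF) => x.
  by have [_] := hd 1%N isT x.
have CF0 : (0 <= CF)%R.
  by have := lipF 1%R 0%R; rewrite subr0 normr1 mulr1; apply: le_trans.
split => //.
- move=> u; apply/andP; split.
    apply: (@ler_cvg_to _ _ _ _ (fun v => F v (Z w)) (fun=> F u (Z w)) _ _ lNy (cvg_cst _)).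
    by near=> v; apply: hom; near: v; exact/nbhs_ninfty_le/num_real.
  apply: (@ler_cvg_to _ _ _ _ (fun=> F u (Z w)) (fun v => F v (Z w)) _ _ (cvg_cst _) ly).
  by near=> v; apply: hom; near: v; exact/nbhs_pinfty_ge/num_real.
- apply/eqP; rewrite eq_le l0 andbT; apply/ler_addgt0Pr => e e0.
  have e1 : (0 < e / (CF + 1))%R by rewrite divr_gt0// ltr_wpDl.
  have [k _ /(_ k (leqnn k)) /= hk] := near_infty_natSinv_lt (PosNum e1).
  have := lipF 0%R (- k.+1%:R^-1)%R; rewrite sub0r opprK [`|k.+1%:R^-1|%R]ger0_norm ?invr_ge0//.
  move: hk; rewrite ltr_pdivlMr ?ltr_wpDl// => hk h.
  have hk' : (CF * k.+1%:R^-1 <= e)%R.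
    by rewrite mulrC (le_trans _ (ltW hk))// ler_wpM2l ?invr_ge0// lerDl.
  have h' := le_trans (ler_norm _) h.
  rewrite -[leLHS](subrK (F (- k.+1%:R^-1) (Z w))) addrC lerD//.
  exact: le_trans h' hk'.
Unshelve. all: by end_near. Qed.

End conditional_bounds.

Section slab.
Local Open Scope ereal_scope.
Context d d' (T : measurableType d) (V : measurableType d') (R : realType).
Variable P : probability T R.
Local Notation mu := (@lebesgue_measure R).
Variables (zeta : T -> R) (Z : T -> V) (rho : R -> V -> R) (Cr : R).
Hypotheses (mzeta : measurable_fun setT zeta) (mZ : measurable_fun setT Z).
Hypothesis hrho : is_cond_density P zeta Z rho.
Hypothesis brho : {ae P, forall w, forall t, (rho t (Z w) <= Cr)%R}.
Hypothesis Cr0 : (0 <= Cr)%R.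

(** Given [Z], the slab confines [zeta] to an interval of length [2 h], on which its density is at
    most [Cr]. *)
Lemma slab_integral (c phi : V -> R) (h : R) : (0 < h)%R ->
  measurable_fun setT c -> measurable_fun setT phi -> (forall z, (0 <= phi z)%R) ->
  \int[P]_w (phi (Z w) * \1_[set x : R | (`|x| <= h)%R] (zeta w + c (Z w)))%:E <=
  (2 * h * Cr)%:E * \int[P]_w (phi (Z w))%:E.
Proof.
move=> h0 mc mphi phi0.
have mI : measurable [set x : R | (`|x| <= h)%R].
  rewrite (_ : [set _ | _] = `[(- h)%R, h]%classic)//.
  by apply/seteqP; split => x /=; rewrite in_itv/= ler_norml.
pose g (v : R * V) : R := (phi v.2 * \1_[set x : R | (`|x| <= h)%R] (v.1 + c v.2))%R.
have mg : measurable_fun setT g.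
  apply: measurable_funM; first exact: measurableT_comp.
  have m1 : measurable_fun setT (\1_[set x : R | (`|x| <= h)%R] : R -> R).
    exact: measurable_indic.
  have m2 : measurable_fun setT (fun v : R * V => (v.1 + c v.2)%R).
    by apply: measurable_funD => //; exact: measurableT_comp.
  exact: (measurableT_comp m1 m2).
have g0 v : (0 <= g v)%R by rewrite mulr_ge0.
rewrite (density_formula mzeta mZ hrho mg) fubini_tonelli1; last 2 first.
- apply/measurable_EFinP; apply: measurable_funM; first exact: (measurable_dens_weight mZ hrho).
  exact: (measurable_swap_comp mZ mg).
- by move=> wt; rewrite lee_fin mulr_ge0// dens_weight_ge0.
rewrite -ge0_integralZl; [|exact: measurableT|by apply/measurable_EFinP; exact: measurableT_comp
  |by move=> w _; rewrite lee_fin|by rewrite lee_fin !mulr_ge0// ltW].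
apply: ae_le_integral_nonmeasurable.
- by move=> w; apply: integral_ge0 => t _; rewrite lee_fin mulr_ge0// dens_weight_ge0.
- by move=> w; rewrite mule_ge0 ?lee_fin// !mulr_ge0// ltW.
apply: filterS brho => w br; rewrite /fubini_F /=.
apply: (@le_trans _ _ (\int[mu]_t ((Cr * phi (Z w)) *
    \1_`[(- h - c (Z w))%R, (h - c (Z w))%R] t)%:E)).
  apply: ge0_le_integral; first exact: measurableT.
  - by move=> t _; rewrite lee_fin mulr_ge0// dens_weight_ge0.
  - apply/measurable_EFinP.
    apply: (measurable_fun_pair2 (f := fun wt : T * R =>
       (dens_weight Z rho wt * g (wt.2, Z wt.1))%R)).
    apply: measurable_funM; first exact: (measurable_dens_weight mZ hrho).
    exact: (measurable_swap_comp mZ mg).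
  - by apply/measurable_EFinP; apply: measurable_funM.
  - move=> t _; rewrite lee_fin /dens_weight /g /= mulrA.
    have -> : (\1_[set x : R | (`|x| <= h)%R] (t + c (Z w)) =
       \1_`[(- h - c (Z w))%R, (h - c (Z w))%R] t :> R)%R.
      rewrite !indicE; congr ((_ : bool)%:R); apply/idP/idP; rewrite !inE /= in_itv/= ler_norml.
        by move=> /andP[h1 h2]; apply/andP; split; lra.
      by move=> /andP[h1 h2]; apply/andP; split; lra.
    by rewrite ler_wpM2r// ler_wpM2r// ge_max br.
under eq_integral do rewrite EFinM.
rewrite ge0_integralZl; [|exact: measurableT|by apply/measurable_EFinP
  |by move=> t _; rewrite lee_fin|by rewrite lee_fin mulr_ge0].
rewrite integral_indic// setIT.
have := @lebesgue_measure_itv R `[(- h - c (Z w))%R, (h - c (Z w))%R].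
rewrite /= lte_fin.
have -> : (- h - c (Z w) < h - c (Z w))%R by lra.
move=> ->.
rewrite -EFinD -!EFinM lee_fin.
by have -> : (h - c (Z w) - (- h - c (Z w)) = 2 * h)%R by [ring]; rewrite mulrC mulrA.
Qed.

End slab.

(** * Measurability on R^p, uniform constants and moments of [Z] *)

Section borel_vectors.
Context (R : realType) (p : nat).
Local Notation V := (borel_cV R p).

Lemma continuous_borel_measurable (f : 'cV[R]_p -> R) : continuous f ->
  measurable_fun setT (f : V -> R).
Proof.
move=> cf; apply: (measurability _ (RGenOpens.measurableE R)) => _ [_ [a [b ->] <-]].
rewrite setTI; apply: sub_sigma_algebra; exact: open_comp.
Qed.

Lemma measurable_coord i : measurable_fun setT (fun z : V => (z : 'cV[R]_p) i 0).
Proof. by apply: continuous_borel_measurable; exact: coord_continuous. Qed.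

Lemma measurable_dotp u : measurable_fun setT (fun z : V => dotp u z).
Proof.
under eq_fun do rewrite dotpE.
by apply: measurable_sum => i; apply: measurable_funM => //; exact: measurable_coord.
Qed.

Lemma measurable_l2norm : measurable_fun setT (fun z : V => l2norm (z : 'cV[R]_p)).
Proof.
apply: (measurableT_comp (f := @Num.sqrt R)).
  by apply: continuous_measurable_fun; exact: sqrt_continuous.
by apply: measurable_sum => i; apply: measurable_funX; exact: measurable_coord.
Qed.

End borel_vectors.

(** One interface for a fixed sample size. The constants in the header are shared by all [n] and
    [p], and all later bounds are expressed through them. *)
Record regular_model (R : realType) (alpha : nat) (H : R -> R)
    (K Cr CF c1 eta CZ : R) (n p : nat) (M : binary_response R n p)
    (rho F : R -> borel_cV R p -> R) : Prop := RegularModel {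
  rm_kernel : kernel_bounds alpha H K;
  rm_alpha : (2 <= alpha)%N;
  rm_p : (0 < p)%N;
  rm_c1 : 0 < c1;
  rm_eta : 0 < eta;
  rm_CZ : 1 <= CZ;
  rm_Cr : 0 <= Cr;
  rm_CF : 0 <= CF;
  rm_iid : iid_sample M;
  rm_median : cond_median0 (br_prob M) (br_eps M) (@br_XZ R n p M);
  rm_density : density_assumption M alpha Cr rho;
  rm_noise : noise_assumption M alpha CF F;
  rm_eigen : forall a, eigenvalue (V_mx M rho F) a -> c1^-1 < a;
  rm_subg : subgaussian_assumption M eta CZ
}.

Section real_bounds.
Context (R : realType).

Definition exp_const (a : R) : R := 1 + a^-1 + 4 / a ^+ 2.

(** Powers up to 4 are at most [1 + x^4], and [x^4] is controlled by squaring [y <= e^y] at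
    [y = a x^2 / 2]. *)
Lemma pow_le_expR (a x : R) (k : nat) : 0 < a -> (k <= 4)%N ->
  `|x| ^+ k <= exp_const a * expR (a * x ^+ 2).
Proof.
move=> a0 k4.
have e1 : 1 <= expR (a * x ^+ 2) by rewrite -expR0 ler_expR mulr_ge0 ?sqr_ge0// ltW.
have x4 : `|x| ^+ 4 <= 4 / a ^+ 2 * expR (a * x ^+ 2).
  have h : a * x ^+ 2 / 2 <= expR (a * x ^+ 2 / 2).
    by apply: le_trans (expR_ge1Dx _); rewrite lerDr.
  have h0 : 0 <= a * x ^+ 2 / 2 by rewrite divr_ge0// mulr_ge0 ?sqr_ge0// ltW.
  have h3 : expR (a * x ^+ 2 / 2) * expR (a * x ^+ 2 / 2) = expR (a * x ^+ 2).
    by rewrite -expRD; congr expR; field.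
  have := ler_pM h0 h0 h h; rewrite h3 => h2; rewrite mulrAC ler_pdivlMr ?exprn_gt0// mulrC.
  rewrite -[4%N]/(2 * 2)%N exprM real_normK ?num_real//.
  have -> : a ^+ 2 * (x ^+ 2) ^+ 2 = 4 * (a * x ^+ 2 / 2 * (a * x ^+ 2 / 2)) by field.
  by rewrite ler_pM2l.
have c0 : 0 <= a^-1 by rewrite invr_ge0 ltW.
have xk : `|x| ^+ k <= 1 + `|x| ^+ 4.
  have [x1|x1] := leP `|x| 1.
    apply: (@le_trans _ _ 1); first by rewrite exprn_ile1.
    by rewrite lerDl exprn_ge0.
  apply: (@le_trans _ _ (`|x| ^+ 4)); last by rewrite lerDr.
  by apply: ler_weXn2l => //; exact: ltW.
apply: le_trans xk _; rewrite /exp_const 2!mulrDl mul1r.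
rewrite lerD//; apply: le_trans e1 _; rewrite lerDl mulr_ge0// expR_ge0.
Qed.

Lemma exp_const_ge0 (a : R) : 0 < a -> 0 <= exp_const a.
Proof. by move=> a0; rewrite !addr_ge0// ?invr_ge0 ?divr_ge0 ?sqr_ge0// ltW. Qed.

End real_bounds.

Section regular_model_facts.
Context (R : realType) (alpha : nat) (H : R -> R) (K Cr CF c1 eta CZ : R).
Context (n p : nat) (M : binary_response R n p) (rho F : R -> borel_cV R p -> R).
Hypothesis hM : regular_model alpha H K Cr CF c1 eta CZ M rho F.
Local Notation P := (br_prob M).
Local Notation X := (br_X M).
Local Notation Z := (br_Z M).
Local Notation eps := (br_eps M).
Local Notation beta := (br_beta M).
Local Notation V := (borel_cV R p).

Lemma rm_good : {ae P, forall w, [/\ good_cdf CF alpha (F^~ (Z w)),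
  forall t, 0 < rho t (Z w) <= Cr & bounded_derivatives alpha Cr (rho^~ (Z w))]}.
Proof.
have [_ hcdf hd] := rm_noise hM; have [_ hr] := rm_density hM.
have h1 := good_cdf_ae (measurable_funPT Z) (measurable_funPT X) (measurable_funPT eps)
  (rm_median hM) hcdf hd.
by apply: filterS2 h1 hr => w g [r1 r2]; split.
Qed.

Lemma exists_unit : exists2 u : 'cV[R]_p, l2norm u = 1 & True.
Proof.
have p0 := rm_p hM; exists (delta_mx (Ordinal p0) 0) => //.
have : l2norm (delta_mx (Ordinal p0) 0 : 'cV[R]_p) ^+ 2 = 1.
  rewrite sqr_l2norm dotpE (bigD1 (Ordinal p0))//= mxE !eqxx mulr1 big1 ?addr0//.
  by move=> i /negbTE h; rewrite !mxE h mulr0.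
by move=> h; apply/eqP; rewrite -(@eqrXn2 _ 2)// ?l2norm_ge0// expr1n h.
Qed.

Lemma rm_mZ : measurable_fun setT (Z : br_space M -> V).
Proof. exact: measurable_funPT. Qed.

Lemma rm_mdotp u : measurable_fun setT (fun w => dotp u (Z w)).
Proof. exact: (measurableT_comp (measurable_dotp u) rm_mZ). Qed.

Lemma subgaussian_unit u : l2norm u = 1 ->
  (\int[P]_w (expR (eta * dotp u (Z w) ^+ 2))%:E <= CZ%:E)%E.
Proof.
move=> u1; apply: le_trans (rm_subg hM); apply: ereal_sup_ubound; exists u => //.
by rewrite unlock.
Qed.

Lemma subgaussian_le1 u : l2norm u <= 1 ->
  (\int[P]_w (expR (eta * dotp u (Z w) ^+ 2))%:E <= CZ%:E)%E.
Proof.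
move=> u1; have [v [v1 vu]] : exists v, l2norm v = 1 /\ u = l2norm u *: v.
  have [u0|un0] := eqVneq (l2norm u) 0.
    have [v v1 _] := exists_unit; exists v; split => //.
    by rewrite (l2norm0_eq0 u0) /l2norm big1 ?sqrtr0 ?scale0r// => i _; rewrite mxE expr0n.
  exists ((l2norm u)^-1 *: u); rewrite l2normZ ger0_norm ?invr_ge0 ?l2norm_ge0// mulVf//.
  by rewrite scalerA divff// scale1r.
apply: le_trans (subgaussian_unit v1).
have me (w' : 'cV[R]_p) : measurable_fun setT (fun w => (expR (eta * dotp w' (Z w) ^+ 2))%:E).
  apply/measurable_EFinP; apply: measurableT_comp => //; apply: measurable_funM => //.
  by apply: measurable_funX; exact: rm_mdotp.
apply: ge0_le_integral; first exact: measurableT.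
- by move=> w _; rewrite lee_fin expR_ge0.
- exact: me.
- exact: me.
- move=> w _; rewrite lee_fin ler_expR ler_wpM2l ?(ltW (rm_eta hM))//.
  by rewrite vu dotpZl exprMn ler_piMl ?sqr_ge0// exprn_ile1// ?l2norm_ge0.
Qed.

Lemma moment_le u k : l2norm u <= 1 -> (k <= 4)%N ->
  (\int[P]_w (`|dotp u (Z w)| ^+ k)%:E <= (exp_const eta * CZ)%:E)%E.
Proof.
move=> u1 k4; have e0 := rm_eta hM; have c0 := exp_const_ge0 e0.
have me : measurable_fun setT (fun w => expR (eta * dotp u (Z w) ^+ 2)).
  apply: measurableT_comp => //; apply: measurable_funM => //.
  by apply: measurable_funX; exact: rm_mdotp.
apply: (@le_trans _ _ (\int[P]_w (exp_const eta * expR (eta * dotp u (Z w) ^+ 2))%:E)%E).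
  apply: ge0_le_integral; first exact: measurableT.
  - by move=> w _; rewrite lee_fin exprn_ge0.
  - apply/measurable_EFinP; apply: measurable_funX; apply: measurableT_comp => //.
    exact: rm_mdotp.
  - by apply/measurable_EFinP; exact: measurable_funM.
  - by move=> w _; rewrite lee_fin; exact: pow_le_expR.
under eq_integral do rewrite EFinM.
rewrite ge0_integralZl; [|exact: measurableT|exact/measurable_EFinP
  |by move=> w _; rewrite lee_fin expR_ge0|by rewrite lee_fin].
by rewrite [leRHS]EFinM lee_wpmul2l ?lee_fin// subgaussian_le1.
Qed.

Definition mom_const := 3 * (exp_const eta * CZ).

Lemma mom_const_ge0 : 0 <= mom_const.
Proof.
rewrite !mulr_ge0 ?exp_const_ge0 ?(rm_eta hM)//.
exact: le_trans (rm_CZ hM).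
Qed.

(* AM-GM: |abc| <= |a|^3 + |b|^3 + |c|^3. *)
Lemma moment3_le u v a : l2norm u <= 1 -> l2norm v <= 1 -> l2norm a <= 1 ->
  (\int[P]_w (`|dotp a (Z w)| * `|dotp u (Z w)| * `|dotp v (Z w)|)%:E <= mom_const%:E)%E.
Proof.
move=> u1 v1 a1.
have m3 (b : 'cV[R]_p) : measurable_fun setT (fun w => `|dotp b (Z w)| ^+ 3).
  by apply: measurable_funX; apply: measurableT_comp => //; exact: rm_mdotp.
have m1 (b : 'cV[R]_p) : measurable_fun setT (fun w => `|dotp b (Z w)|).
  by apply: measurableT_comp => //; exact: rm_mdotp.
apply: (@le_trans _ _ (\int[P]_w (`|dotp a (Z w)| ^+ 3 + `|dotp u (Z w)| ^+ 3
    + `|dotp v (Z w)| ^+ 3)%:E)%E).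
  apply: ge0_le_integral; first exact: measurableT.
  - by move=> w _; rewrite lee_fin !mulr_ge0.
  - by apply/measurable_EFinP; apply: measurable_funM => //; apply: measurable_funM.
  - by apply/measurable_EFinP; apply: measurable_funD => //; apply: measurable_funD.
  move=> w _; rewrite lee_fin; set x := `|_|; set y := `|dotp u _|; set z := `|dotp v _|.
  have [x0 y0 z0] : [/\ 0 <= x, 0 <= y & 0 <= z] by split; exact: normr_ge0.
  have le3 (s t r' : R) : 0 <= s -> 0 <= t -> s <= r' -> t <= r' -> 0 <= r' -> r' * s * t <= r' ^+ 3.
    move=> s0 t0 sr tr r0; rewrite 2!exprS expr1 -mulrA ler_wpM2l//.
    by rewrite ler_pM.
  have X3 : 0 <= x ^+ 3 by rewrite exprn_ge0.
  have Y3 : 0 <= y ^+ 3 by rewrite exprn_ge0.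
  have Z3 : 0 <= z ^+ 3 by rewrite exprn_ge0.
  have [xy|xy] := leP y x; have [xz|xz] := leP z x.
  - by have := le3 y z x y0 z0 xy xz x0; lra.
  - have -> : x * y * z = z * x * y by ring.
    by have := le3 x y z x0 y0 (ltW xz) (le_trans xy (ltW xz)) z0; lra.
  - have -> : x * y * z = y * x * z by ring.
    by have := le3 x z y x0 z0 (ltW xy) (le_trans xz (ltW xy)) y0; lra.
  - have [yz|yz] := leP y z.
      have -> : x * y * z = z * x * y by ring.
      by have := le3 x y z x0 y0 (ltW xz) yz z0; lra.
    have -> : x * y * z = y * x * z by ring.
    by have := le3 x z y x0 z0 (ltW xy) (ltW yz) y0; lra.
under eq_integral do rewrite !EFinD.
rewrite ge0_integralD; [|exact: measurableT|by move=> w _; rewrite -EFinD lee_fin addr_ge0 ?exprn_ge0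
  |by apply/measurable_EFinP; exact: measurable_funD
  |by move=> w _; rewrite lee_fin exprn_ge0|exact/measurable_EFinP].
rewrite ge0_integralD; [|exact: measurableT|by move=> w _; rewrite lee_fin exprn_ge0
  |exact/measurable_EFinP|by move=> w _; rewrite lee_fin exprn_ge0|exact/measurable_EFinP].
have -> : mom_const = exp_const eta * CZ + exp_const eta * CZ + exp_const eta * CZ.
  by rewrite /mom_const; ring.
by rewrite !EFinD; apply: leeD; [apply: leeD|]; exact: moment_le.
Qed.

Lemma moment2_le u v : l2norm u <= 1 -> l2norm v <= 1 ->
  (\int[P]_w (`|dotp u (Z w)| * `|dotp v (Z w)|)%:E <= mom_const%:E)%E.
Proof.
move=> u1 v1.
have m2 (b : 'cV[R]_p) : measurable_fun setT (fun w => `|dotp b (Z w)| ^+ 2).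
  by apply: measurable_funX; apply: measurableT_comp => //; exact: rm_mdotp.
have m1 (b : 'cV[R]_p) : measurable_fun setT (fun w => `|dotp b (Z w)|).
  by apply: measurableT_comp => //; exact: rm_mdotp.
apply: (@le_trans _ _ (\int[P]_w (`|dotp u (Z w)| ^+ 2 + `|dotp v (Z w)| ^+ 2)%:E)%E).
  apply: ge0_le_integral; first exact: measurableT.
  - by move=> w _; rewrite lee_fin mulr_ge0.
  - by apply/measurable_EFinP; apply: measurable_funM.
  - by apply/measurable_EFinP; apply: measurable_funD.
  move=> w _; rewrite lee_fin; set x := `|_|; set y := `|dotp v _|.
  have h : 0 <= (x - y) ^+ 2 by exact: sqr_ge0.
  have [x0 y0] : 0 <= x /\ 0 <= y by split; exact: normr_ge0.
  have xy : 0 <= x * y by rewrite mulr_ge0.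
  by move: h; rewrite sqrrB => h; lra.
under eq_integral do rewrite !EFinD.
rewrite ge0_integralD; [|exact: measurableT|by move=> w _; rewrite lee_fin exprn_ge0
  |exact/measurable_EFinP|by move=> w _; rewrite lee_fin exprn_ge0|exact/measurable_EFinP].
apply: (@le_trans _ _ (exp_const eta * CZ + exp_const eta * CZ)%:E).
  by rewrite EFinD; apply: leeD; exact: moment_le.
have c0 := mom_const_ge0; rewrite /mom_const in c0 *.
by rewrite lee_fin; move: c0; move: (exp_const eta * CZ) => x; lra.
Qed.

Lemma moment1_le u : l2norm u <= 1 ->
  (\int[P]_w (`|dotp u (Z w)|)%:E <= mom_const%:E)%E.
Proof.
move=> u1; have := moment_le (k := 1) u1 isT.
under eq_integral do rewrite expr1.
move/le_trans; apply; have c0 := mom_const_ge0; rewrite /mom_const in c0 *.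
by rewrite lee_fin; move: c0; move: (exp_const eta * CZ) => x; lra.
Qed.

End regular_model_facts.

(** * Mean gradient and mean Hessian *)

Section pointwise_model_bias.
Context (R : realType) (alpha : nat) (H : R -> R) (K CF Cr : R).
Local Notation mu := (@lebesgue_measure R).
Hypotheses (hK : kernel_bounds alpha H K) (alpha2 : (2 <= alpha)%N).
Variables (f r : R -> R).
Hypothesis hf : good_cdf CF alpha f.
Hypothesis r01 : forall t, 0 < r t <= Cr.
Hypothesis hr : bounded_derivatives alpha Cr r.

Let f1 : R -> R := derive1 f. Let f2 : R -> R := derive1 f1.
Let r1 : R -> R := derive1 r. Let r2 : R -> R := derive1 r1.
Let hd : bounded_derivatives alpha.+1 CF f. Proof. by have [] := hf. Qed.
Let df x : is_derive x (1 : R) f (f1 x).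
Proof. by apply: derivable_is_derive; have [] := hd (j := 1%N) isT x. Qed.
Let df1 x : is_derive x (1 : R) f1 (f2 x).
Proof. by apply: derivable_is_derive; have [] := hd (j := 2%N) (ltnW alpha2) x. Qed.
Let dr x : is_derive x (1 : R) r (r1 x).
Proof. by apply: derivable_is_derive; have [] := hr (j := 1%N) (ltnW alpha2) x. Qed.
Let dr1 x : is_derive x (1 : R) r1 (r2 x).
Proof. by apply: derivable_is_derive; have [] := hr (j := 2%N) alpha2 x. Qed.
Let bf1 x : `|f1 x| <= CF. Proof. by have [] := hd (j := 1%N) isT x. Qed.
Let bf2 x : `|f2 x| <= CF. Proof. by have [] := hd (j := 2%N) (ltnW alpha2) x. Qed.
Let br1 x : `|r1 x| <= Cr. Proof. by have [] := hr (j := 1%N) (ltnW alpha2) x. Qed.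
Let br2 x : `|r2 x| <= Cr. Proof. by have [] := hr (j := 2%N) alpha2 x. Qed.
Let br x : `|r x| <= Cr.
Proof. by have /andP[h1 h2] := r01 x; rewrite gtr0_norm. Qed.
Let f01 u : 0 <= f u <= 1. Proof. by have [] := hf. Qed.
Let f0 : f 0 = 2^-1. Proof. by have [] := hf. Qed.
Let CF0 : 0 <= CF. Proof. exact: le_trans (bf1 0). Qed.
Let Cr0 : 0 <= Cr. Proof. exact: le_trans (br 0). Qed.
Let L0 : 0 <= sgn_lip CF Cr. Proof. by rewrite addr_ge0// !mulr_ge0. Qed.
Let K0 : 0 <= K. Proof. exact: le_trans (kb_K hK). Qed.

Let q := sgn_dens f r.
Let dq t : is_derive t (1 : R) q (sgn_dens1 f f1 r r1 t).
Proof. exact: is_derive_sgn_dens. Qed.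
Let lq x y : `|sgn_dens1 f f1 r r1 x - sgn_dens1 f f1 r r1 y| <= sgn_lip CF Cr * `|x - y|.
Proof. exact: (sgn_dens1_lip df df1 dr dr1 f01 bf1 bf2 br br1 br2). Qed.
Let cq : continuous q.
Proof. by apply: derivable_continuous => t; have [] := dq t. Qed.

Definition grad_bias_const := (2 * CF * Cr *+ alpha) * K * 2.
Definition hess_bias_const := sgn_lip CF Cr * K * 2.

Let pull (G : R -> R) (c d : R) : mu.-integrable setT (EFin \o (fun t => q t * G t)) ->
  \int[mu]_t (q t * (G t * c / d)) = (\int[mu]_t (q t * G t) / d) * c.
Proof.
move=> iG; have -> : (fun t => q t * (G t * c / d)) = (fun t => (c / d) * (q t * G t)).
  by apply/funext => t; ring.
by rewrite RintegralZl//; ring.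
Qed.

Lemma pointwise_grad_bias h c : 0 < h ->
  `| \int[mu]_t (q t * (derive1 H (t / h) * c / h)) | <= grad_bias_const * h ^+ alpha * `|c|.
Proof.
move=> h0.
have i1 : mu.-integrable setT (EFin \o (fun t => q t * derive1 H (t / h))).
  have := @integrable_rescaled R q (derive1 H) 0 h cq (kb_c1 hK) h0 (kb_s1 hK).
  by congr (mu.-integrable _ _); apply/funext => t /=; rewrite addr0.
rewrite (@pull (fun t => derive1 H (t / h)))// normrM ler_wpM2r//.
apply: (smooth_gradient_bias alpha2 (kb_c1 hK) (kb_s1 hK) (kb_b1 hK) (kb_m hK)) => //.
exact: bounded_derivativesW hd.
Qed.

Lemma pointwise_hess_lip h a a' c : 0 < h ->
  `| \int[mu]_t (q t * ((derive1n 2 H ((t + a) / h) - derive1n 2 H ((t + a') / h)) * c / h ^+ 2)) |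
     <= hess_bias_const * `|a - a'| * `|c|.
Proof.
move=> h0.
have ia b : mu.-integrable setT (EFin \o (fun t => q t * derive1n 2 H ((t + b) / h))).
  exact: (@integrable_rescaled R q (derive1n 2 H) b h cq (kb_c2 hK) h0 (kb_s2 hK)).
rewrite (@pull (fun t => derive1n 2 H ((t + a) / h) - derive1n 2 H ((t + a') / h))).
  rewrite normrM ler_wpM2r//.
  have := smooth_bias_lip dq lq L0 (kb_c2 hK) (kb_s2 hK) (kb_b2 hK) (kb_i0 hK) a a' h0.
  exact.
rewrite (_ : EFin \o _ = (fun t => ((q t * derive1n 2 H ((t + a) / h))%:E
    - (q t * derive1n 2 H ((t + a') / h))%:E)%E)).
  exact: (integrableB measurableT (ia a) (ia a')).
by apply/funext => t; rewrite -EFinB -mulrBr.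
Qed.

(** At 0 the factor [2 f - 1] vanishes, so minus the derivative of the signed density is
    [2 f'(0) r(0)], the weight that defines [V]. *)
Lemma pointwise_hess_bias h c : 0 < h ->
  `| \int[mu]_t (q t * (derive1n 2 H (t / h) * c / h ^+ 2)) - 2 * (derive1 f 0 * r 0) * c |
     <= hess_bias_const * h * `|c|.
Proof.
move=> h0.
have i1 : mu.-integrable setT (EFin \o (fun t => q t * derive1n 2 H (t / h))).
  rewrite (_ : (fun t => _) = (fun t => q t * derive1n 2 H ((t + 0) / h))).
    exact: (@integrable_rescaled R q (derive1n 2 H) 0 h cq (kb_c2 hK) h0 (kb_s2 hK)).
  by apply/funext => t; rewrite addr0.
rewrite (@pull (fun t => derive1n 2 H (t / h)))// -mulrBl normrM ler_wpM2r//.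
have := smooth_bias dq lq L0 (kb_c2 hK) (kb_s2 hK) (kb_b2 hK) (kb_i0 hK) (kb_i1 hK) h0.
rewrite /sgn_dens1 oppr0 f0.
have -> : - (2 * f1 0) * r 0 + (2 / 2 - 1) * r1 0 = - (2 * (derive1 f 0 * r 0)).
  by rewrite /f1; move: (derive1 f 0) (r 0) (r1 0) => x y z; field.
exact.
Qed.

End pointwise_model_bias.

Section domination.
Context d (T : measurableType d) (R : realType) (P : {measure set T -> \bar R}).

Lemma integrable_dominated (f g : T -> R) (c : R) : measurable_fun setT f ->
  measurable_fun setT g -> (forall w, `|f w| <= g w) ->
  (\int[P]_w (g w)%:E <= c%:E)%E -> P.-integrable setT (EFin \o f).
Proof.
move=> mf mg fg gc; apply/integrableP; split; first exact/measurable_EFinP.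
apply: le_lt_trans (ltry c); apply: le_trans gc.
apply: ge0_le_integral; first exact: measurableT.
- by move=> w _.
- by apply/measurable_EFinP; exact: measurableT_comp.
- exact/measurable_EFinP.
- by move=> w _; rewrite /= lee_fin.
Qed.

Lemma Rintegral_le (g : T -> R) (c : R) : measurable_fun setT g ->
  (forall w, 0 <= g w) -> (\int[P]_w (g w)%:E <= c%:E)%E -> \int[P]_w g w <= c.
Proof.
move=> mg g0 gc; have f : (\int[P]_w (g w)%:E)%E \is a fin_num.
  rewrite ge0_fin_numE; last by apply: integral_ge0 => w _; rewrite lee_fin.
  exact: le_lt_trans gc (ltry _).
by rewrite -lee_fin /Rintegral fineK.
Qed.

End domination.

Section model_bias.
Context (R : realType) (alpha : nat) (H : R -> R) (K Cr CF c1 eta CZ : R).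
Context (n p : nat) (M : binary_response R n p) (rho F : R -> borel_cV R p -> R).
Hypothesis hM : regular_model alpha H K Cr CF c1 eta CZ M rho F.
Local Notation P := (br_prob M).
Local Notation X := (br_X M).
Local Notation Z := (br_Z M).
Local Notation eps := (br_eps M).
Local Notation beta := (br_beta M).
Local Notation V := (borel_cV R p).
Local Notation mu := (@lebesgue_measure R).
Local Notation obs := (R * V * R)%type.

Definition obs0 (w : br_space M) : obs := (X w, Z w, eps w).

Definition latent (v : obs) : R := v.1.1 + dotp v.1.2 beta.

Definition grad_term (h : R) (u : 'cV[R]_p) (v : obs) : R :=
  - sign_pm (latent v + v.2) * (derive1 H (latent v / h) * dotp u v.1.2 / h).

(** Here [d] is the displacement from the true parameter: averaging over the sample gives the
    bilinear form of the Hessian at [beta + d]. *)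
Definition hess_term (h : R) (d u u' : 'cV[R]_p) (v : obs) : R :=
  - sign_pm (latent v + v.2) *
  (derive1n 2 H ((latent v + dotp d v.1.2) / h) * (dotp u v.1.2 * dotp u' v.1.2) / h ^+ 2).

Lemma measurable_latent : measurable_fun setT latent.
Proof.
apply: measurable_funD.
  by apply: measurableT_comp => //; exact: measurable_fst.
apply: (measurableT_comp (f := fun z : V => dotp z beta)
  (g := fun v : obs => v.1.2)).
  by under eq_fun do rewrite dotpC; exact: measurable_dotp.
by apply: measurableT_comp => //; exact: measurable_snd.
Qed.

Lemma measurable_obs_dotp u : measurable_fun setT (fun v : obs => dotp u v.1.2).
Proof.
apply: (measurableT_comp (measurable_dotp u) (g := fun v : obs => v.1.2)).
by apply: measurableT_comp => //; exact: measurable_snd.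
Qed.

Lemma measurable_sign_pm : measurable_fun setT (@sign_pm R).
Proof.
have -> : @sign_pm R = (fun x => 1 - 2 * \1_`]-oo, (0 : R)[ x).
  apply/funext => x; rewrite /sign_pm indicE; case: ifPn => x0.
    by rewrite mem_set/= ?in_itv//=; ring.
  by rewrite memNset/= ?in_itv/=; [ring|exact/negP].
by apply: measurable_funB => //; apply: measurable_funM.
Qed.

Lemma measurable_obs_sign : measurable_fun setT (fun v : obs => - sign_pm (latent v + v.2)).
Proof.
apply: measurableT_comp => //; apply: (measurableT_comp measurable_sign_pm).
by apply: measurable_funD; [exact: measurable_latent|exact: measurable_snd].
Qed.

Let cdH := kb_c1 (rm_kernel hM). Let cddH := kb_c2 (rm_kernel hM).

Lemma measurable_grad_term h u : measurable_fun setT (grad_term h u).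
Proof.
apply: measurable_funM; first exact: measurable_obs_sign.
apply: measurable_funM => //; apply: measurable_funM; last exact: measurable_obs_dotp.
apply: (measurableT_comp (continuous_measurable_fun cdH)).
by apply: measurable_funM => //; exact: measurable_latent.
Qed.

Lemma measurable_hess_term h d u u' : measurable_fun setT (hess_term h d u u').
Proof.
apply: measurable_funM; first exact: measurable_obs_sign.
apply: measurable_funM => //; apply: measurable_funM; last first.
  by apply: measurable_funM; exact: measurable_obs_dotp.
apply: (measurableT_comp (continuous_measurable_fun cddH)).
apply: measurable_funM => //; apply: measurable_funD; first exact: measurable_latent.
exact: measurable_obs_dotp.
Qed.

Lemma measurable_obs0 : measurable_fun setT obs0.
Proof.
apply: measurable_fun_pair; last exact: measurable_funPT.
by apply: measurable_fun_pair; exact: measurable_funPT.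
Qed.

Lemma model_bias_expectation (g : R * V -> R) (kap B : br_space M -> R) :
  measurable_fun setT g ->
  P.-integrable setT (fun w => (g (br_zeta w, Z w))%:E) ->
  P.-integrable setT (EFin \o kap) -> P.-integrable setT (EFin \o B) ->
  {ae P, forall w, `| (\int[mu]_t (sgn_dens (F^~ (Z w)) (rho^~ (Z w)) t * g (t, Z w)))
     - kap w | <= B w} ->
  `| \int[P]_w (- sign_pm (br_zeta w + eps w) * g (br_zeta w, Z w)) - \int[P]_w kap w |
    <= \int[P]_w B w.
Proof.
move=> mg ig ik iB hb.
have [hind [hcdf _] _] := rm_noise hM; have [hr hr2] := rm_density hM.
have mc : measurable_fun setT (fun z : V => dotp z beta).
  by under eq_fun do rewrite dotpC; exact: measurable_dotp.
apply: (bias_expectation (CF := CF) (measurable_funPT X) (measurable_funPT eps)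
  (measurable_funPT Z) mc hind hcdf _ hr mg ig ik iB hb).
- by apply: filterS (rm_good hM) => w [[]].
- by apply: filterS hr2 => w [h _] t; have /andP[/ltW] := h t.
Qed.

Let K0 : 0 <= K. Proof. exact: le_trans (kb_K (rm_kernel hM)). Qed.
Let gc0 : 0 <= grad_bias_const alpha K CF Cr.
Proof. by rewrite !mulr_ge0// mulrn_wge0// !mulr_ge0// ?(rm_CF hM) ?(rm_Cr hM). Qed.
Let hc0 : 0 <= hess_bias_const K CF Cr.
Proof.
by rewrite !mulr_ge0// addr_ge0 ?(rm_Cr hM)// !mulr_ge0// ?(rm_CF hM) ?(rm_Cr hM).
Qed.

Let mZd u : measurable_fun setT (fun w => dotp u (Z w)) .
Proof. exact: rm_mdotp. Qed.
Let mcst_norm (c : R) (f : br_space M -> R) : measurable_fun setT f ->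
  measurable_fun setT (fun w => c * `|f w|).
Proof. by move=> mf; apply: measurable_funM => //; exact: measurableT_comp. Qed.

Let intZ (c k : R) (f : br_space M -> R) : 0 <= c -> measurable_fun setT f ->
  (\int[P]_w (`|f w|)%:E <= k%:E)%E -> (\int[P]_w (c * `|f w|)%:E <= (c * k)%:E)%E.
Proof.
move=> c0 mf hk; under eq_integral do rewrite EFinM.
rewrite ge0_integralZl; [|exact: measurableT|by apply/measurable_EFinP; exact: measurableT_comp
  |by move=> w _|by rewrite lee_fin].
by rewrite EFinM lee_wpmul2l.
Qed.

Lemma integrable0R : P.-integrable setT (EFin \o (fun _ : br_space M => 0 : R)).
Proof. exact: (finite_measure_integrable_cst P 0 measurableT). Qed.

Lemma Rintegral0R : \int[P]_w (0 : R) = 0.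
Proof. by rewrite /Rintegral integral0. Qed.

Lemma grad_bias h u : 0 < h -> l2norm u <= 1 ->
  `| \int[P]_w grad_term h u (obs0 w) | <=
     grad_bias_const alpha K CF Cr * mom_const eta CZ * h ^+ alpha.
Proof.
move=> h0 u1.
pose g (v : R * V) : R := derive1 H (v.1 / h) * dotp u v.2 / h.
pose c := grad_bias_const alpha K CF Cr * h ^+ alpha.
pose B w := c * `|dotp u (Z w)|.
have c0 : 0 <= c by rewrite mulr_ge0// exprn_ge0// ltW.
have mg : measurable_fun setT g.
  apply: measurable_funM => //; apply: measurable_funM.
    apply: (measurableT_comp (continuous_measurable_fun cdH)).
    by apply: measurable_funM => //; exact: measurable_fst.
  exact: (measurableT_comp (measurable_dotp u) measurable_snd).
have hB := intZ c0 (mZd u) (moment1_le hM u1).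
have mB : measurable_fun setT B by exact: mcst_norm.
have iB : P.-integrable setT (EFin \o B).
  apply: (integrable_dominated mB mB _ hB) => w.
  by rewrite ger0_norm// mulr_ge0.
have mzZ : measurable_fun setT (fun w : br_space M => (br_zeta w, Z w : V)).
  apply: measurable_fun_pair; last exact: measurable_funPT.
  have [[? _ _] _] := rm_density hM.
  apply: measurable_funD; first exact: measurable_funPT.
  by under eq_fun do rewrite dotpC; exact: mZd.
have ig : P.-integrable setT (fun w => (g (br_zeta w, Z w))%:E).
  have kh0 : 0 <= K / h by rewrite divr_ge0// ltW.
  apply: (integrable_dominated (f := fun w => g (br_zeta w, Z w))
    (g := fun w => K / h * `|dotp u (Z w)|) (c := K / h * mom_const eta CZ)).
  - exact: (measurableT_comp mg mzZ).
  - exact: mcst_norm.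
  - move=> w; rewrite /g /= normrM normfV (gtr0_norm h0) normrM mulrAC.
    by rewrite ler_wpM2r// ler_wpM2r ?invr_ge0 ?(ltW h0)// (kb_b1 (rm_kernel hM)).
  - exact: intZ (moment1_le hM u1).
have := model_bias_expectation mg ig integrable0R iB _.
rewrite Rintegral0R subr0 => hbias.
apply: (le_trans (hbias _)).
  apply: filterS (rm_good hM) => w [gf r01 hr]; rewrite subr0.
  exact: (pointwise_grad_bias (rm_kernel hM) (rm_alpha hM) gf r01 hr (dotp u (Z w)) h0).
rewrite (_ : _ * _ * _ = c * mom_const eta CZ); last by rewrite /c; ring.
by apply: Rintegral_le hB => // w; rewrite mulr_ge0.
Qed.

End model_bias.

Section hessian_bias.
Context (R : realType) (alpha : nat) (H : R -> R) (K Cr CF c1 eta CZ : R).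
Context (n p : nat) (M : binary_response R n p) (rho F : R -> borel_cV R p -> R).
Hypothesis hM : regular_model alpha H K Cr CF c1 eta CZ M rho F.
Local Notation P := (br_prob M).
Local Notation X := (br_X M).
Local Notation Z := (br_Z M).
Local Notation eps := (br_eps M).
Local Notation beta := (br_beta M).
Local Notation V := (borel_cV R p).
Local Notation mu := (@lebesgue_measure R).

Let cddH := kb_c2 (rm_kernel hM).
Let K0 : 0 <= K. Proof. exact: le_trans (kb_K (rm_kernel hM)). Qed.
Let hc0 : 0 <= hess_bias_const K CF Cr.
Proof.
by rewrite !mulr_ge0// addr_ge0 ?(rm_Cr hM)// !mulr_ge0// ?(rm_CF hM) ?(rm_Cr hM).
Qed.
Let mZd u : measurable_fun setT (fun w => dotp u (Z w)).
Proof. exact: rm_mdotp. Qed.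
Let mnZd u : measurable_fun setT (fun w => `|dotp u (Z w)|).
Proof. exact: measurableT_comp. Qed.
Let mzZ : measurable_fun setT (fun w : br_space M => (br_zeta w, Z w : V)).
Proof.
apply: measurable_fun_pair; last exact: measurable_funPT.
apply: measurable_funD; first exact: measurable_funPT.
by under eq_fun do rewrite dotpC; exact: mZd.
Qed.

Let cst_integral (c k : R) (f : br_space M -> R) : 0 <= c -> measurable_fun setT f ->
  (forall w, 0 <= f w) ->
  (\int[P]_w (f w)%:E <= k%:E)%E -> (\int[P]_w (c * f w)%:E <= (c * k)%:E)%E.
Proof.
move=> c0 mf f0 hk; under eq_integral do rewrite EFinM.
rewrite ge0_integralZl; [|exact: measurableT|exact/measurable_EFinP
  |by move=> w _; rewrite lee_fin|by rewrite lee_fin].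
by rewrite EFinM lee_wpmul2l.
Qed.

Let model_bias_bound (g : R * V -> R) (kap B D : br_space M -> R) (cB cD : R) :
  measurable_fun setT g -> measurable_fun setT D ->
  (forall w, `|g (br_zeta w, Z w)| <= D w) -> (\int[P]_w (D w)%:E <= cD%:E)%E ->
  P.-integrable setT (EFin \o kap) ->
  measurable_fun setT B -> (forall w, 0 <= B w) -> (\int[P]_w (B w)%:E <= cB%:E)%E ->
  {ae P, forall w, `| (\int[mu]_t (sgn_dens (F^~ (Z w)) (rho^~ (Z w)) t * g (t, Z w)))
     - kap w | <= B w} ->
  `| \int[P]_w (- sign_pm (br_zeta w + eps w) * g (br_zeta w, Z w)) - \int[P]_w kap w |
    <= cB.
Proof.
move=> mg mD gD hD ik mB B0 hB hb.
have ig : P.-integrable setT (fun w => (g (br_zeta w, Z w))%:E).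
  by apply: (integrable_dominated (f := fun w => g (br_zeta w, Z w)) _ mD gD hD);
    exact: (measurableT_comp mg mzZ).
have iB : P.-integrable setT (EFin \o B).
  by apply: (integrable_dominated mB mB _ hB) => w; rewrite ger0_norm.
apply: le_trans (model_bias_expectation hM mg ig ik iB hb) _.
exact: Rintegral_le.
Qed.

Let moment3_scaled d u u' : l2norm u <= 1 -> l2norm u' <= 1 ->
  (\int[P]_w (`|dotp d (Z w)| * `|dotp u (Z w) * dotp u' (Z w)|)%:E <=
    (l2norm d * mom_const eta CZ)%:E)%E.
Proof.
move=> u1 u1'; have [d0|dn0] := eqVneq (l2norm d) 0.
  rewrite d0 mul0r (l2norm0_eq0 d0).
  under eq_integral do rewrite dotpC dotp0r normr0 mul0r.
  by rewrite integral0.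
have dE : d = l2norm d *: ((l2norm d)^-1 *: d) by rewrite scalerA divff// scale1r.
have v1 : l2norm ((l2norm d)^-1 *: d) <= 1.
  by rewrite l2normZ ger0_norm ?invr_ge0 ?l2norm_ge0// mulVf.
move: v1 dE; set v := _^-1 *: d; set c := l2norm d => v1 dE.
have c0 : 0 <= c := l2norm_ge0 d.
have -> : (fun w => (`|dotp d (Z w)| * `|dotp u (Z w) * dotp u' (Z w)|)%:E) =
    (fun w => (c * (`|dotp v (Z w)| * `|dotp u (Z w)| * `|dotp u' (Z w)|))%:E).
  by apply/funext => w; rewrite dE dotpZl !normrM (ger0_norm c0) !mulrA.
apply: cst_integral => //.
- by apply: measurable_funM => //; apply: measurable_funM.
- exact: (moment3_le hM).
Qed.

Lemma hess_term_le h d u u' v : 0 < h ->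
  `|hess_term H M h d u u' v| <= K / h ^+ 2 * `|dotp u v.1.2 * dotp u' v.1.2|.
Proof.
move=> h0; have h2 : 0 < h ^+ 2 by rewrite exprn_gt0.
rewrite /hess_term normrM normrN.
have -> : `|sign_pm (latent M v + v.2)| = 1.
  by rewrite /sign_pm; case: ifP => _; rewrite ?normrN normr1.
rewrite mul1r normrM normfV (gtr0_norm h2) normrM mulrAC ler_wpM2r//.
by rewrite ler_wpM2r ?invr_ge0 ?(ltW h2)// (kb_b2 (rm_kernel hM)).
Qed.

Lemma integrable_hess_term h d u u' : 0 < h -> l2norm u <= 1 -> l2norm u' <= 1 ->
  P.-integrable setT (fun w => (hess_term H M h d u u' (obs0 w))%:E).
Proof.
move=> h0 u1 u1'; have k0 : 0 <= K / h ^+ 2 by rewrite divr_ge0// exprn_ge0// ltW.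
apply: (integrable_dominated (f := fun w => hess_term H M h d u u' (obs0 w))
  (g := fun w => K / h ^+ 2 * (`|dotp u (Z w)| * `|dotp u' (Z w)|))
  (c := K / h ^+ 2 * mom_const eta CZ)).
- have m1 := measurable_hess_term hM h d u u'; have m2 := @measurable_obs0 R n p M.
  exact: (measurableT_comp m1 m2).
- by apply: measurable_funM => //; exact: measurable_funM.
- by move=> w; rewrite -normrM; exact: hess_term_le.
- apply: cst_integral => //; first exact: measurable_funM.
  exact: (moment2_le hM).
Qed.

(** Given [Z], the two Hessians differ by the shifts [d^T Z] and [d'^T Z], so [smooth_bias_lip]
    applies free of [h]. Averaging over [Z] costs a third moment of projections, and
    [moment3_scaled] extracts the norm of [d - d']. *)
Lemma hess_mean_lip h d d' u u' : 0 < h -> l2norm u <= 1 -> l2norm u' <= 1 ->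
  `| \int[P]_w hess_term H M h d u u' (obs0 w) - \int[P]_w hess_term H M h d' u u' (obs0 w) |
   <= hess_bias_const K CF Cr * mom_const eta CZ * l2norm (d - d').
Proof.
move=> h0 u1 u1'; have h2 : 0 < h ^+ 2 by rewrite exprn_gt0.
rewrite -RintegralB; [|exact: measurableT|exact: integrable_hess_term|exact: integrable_hess_term].
pose g (v : R * V) : R := (derive1n 2 H ((v.1 + dotp d v.2) / h)
   - derive1n 2 H ((v.1 + dotp d' v.2) / h)) * (dotp u v.2 * dotp u' v.2) / h ^+ 2.
have -> : \int[P]_w (hess_term H M h d u u' (obs0 w) - hess_term H M h d' u u' (obs0 w)) =
   \int[P]_w (- sign_pm (br_zeta w + eps w) * g (br_zeta w, Z w)) - \int[P]_w (0 : R).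
  rewrite Rintegral0R subr0; congr Rintegral; apply/funext => w.
  have key (y a b c e : R) : y * (a * c / e) - y * (b * c / e) = y * ((a - b) * c / e).
    by ring.
  exact: key.
have m2d (e : 'cV[R]_p) : measurable_fun setT
    (fun v : R * V => derive1n 2 H ((v.1 + dotp e v.2) / h)).
  apply: (measurableT_comp (continuous_measurable_fun cddH)).
  apply: measurable_funM => //; apply: measurable_funD; first exact: measurable_fst.
  exact: (measurableT_comp (measurable_dotp e) measurable_snd).
have mg : measurable_fun setT g.
  apply: measurable_funM => //; apply: measurable_funM; first exact: measurable_funB.
  by apply: measurable_funM; exact: (measurableT_comp (measurable_dotp _) measurable_snd).
pose D w := 2 * K / h ^+ 2 * (`|dotp u (Z w)| * `|dotp u' (Z w)|).
pose B w := hess_bias_const K CF Cr *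
   (`|dotp (d - d') (Z w)| * `|dotp u (Z w) * dotp u' (Z w)|).
have k0 : 0 <= 2 * K / h ^+ 2 by rewrite divr_ge0 ?mulr_ge0// ltW.
have -> : hess_bias_const K CF Cr * mom_const eta CZ * l2norm (d - d') =
   hess_bias_const K CF Cr * (l2norm (d - d') * mom_const eta CZ) by ring.
have m2 : measurable_fun setT (fun w => `|dotp u (Z w)| * `|dotp u' (Z w)|).
  exact: measurable_funM.
have m3 : measurable_fun setT (fun w =>
    `|dotp (d - d') (Z w)| * `|dotp u (Z w) * dotp u' (Z w)|).
  apply: measurable_funM => //; apply: measurableT_comp => //.
  by apply: measurable_funM => //; exact: mZd.
apply: (model_bias_bound (D := D) (B := B) (cD := 2 * K / h ^+ 2 * mom_const eta CZ)) => //.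
- exact: measurable_funM.
- move=> w; rewrite /g /D /= normrM normfV (gtr0_norm h2) normrM mulrAC -normrM.
  rewrite ler_wpM2r// ler_wpM2r ?invr_ge0 ?(ltW h2)//.
  apply: le_trans (ler_normB _ _) _; rewrite (_ : 2 * K = K + K); last by ring.
  by apply: lerD; exact: (kb_b2 (rm_kernel hM)).
- apply: cst_integral => //; exact: (moment2_le hM).
- exact: integrable0R.
- exact: measurable_funM.
- by move=> w; apply: mulr_ge0 => //; exact: mulr_ge0.
- apply: cst_integral => //; exact: moment3_scaled.
- apply: filterS (rm_good hM) => w [gf r01 hr]; rewrite subr0 /B dotpBl mulrA.
  exact: (pointwise_hess_lip (rm_kernel hM) (rm_alpha hM) gf r01 hr
    (dotp d (Z w)) (dotp d' (Z w)) (dotp u (Z w) * dotp u' (Z w)) h0).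
Qed.

End hessian_bias.

Section slope.
Context d' (V : measurableType d') (R : realType) (F : R -> V -> R) (CF : R).

(* Measurable version of z |-> F'(0 | z). *)
Definition cdf_slope (z : V) : R := Num.max (- CF) (Num.min CF (fine (limn_esup
  (fun N => ((F (N.+1%:R^-1) z - F 0 z) * N.+1%:R)%:E)))).

Lemma cdf_slope_le z : 0 <= CF -> `|cdf_slope z| <= CF.
Proof.
move=> CF0; rewrite ler_norml /cdf_slope le_max lexx/= ge_max.
by rewrite ge_min lexx/= andbT; lra.
Qed.

Lemma measurable_cdf_slope : (forall u, measurable_fun setT (F u)) ->
  measurable_fun setT cdf_slope.
Proof.
move=> mF; apply: measurable_maxr => //; apply: measurable_minr => //.
apply: measurableT_comp => //.
apply: measurable_fun_limn_esup => N; apply/measurable_EFinP.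
by apply: measurable_funM => //; exact: measurable_funB.
Qed.

Lemma cdf_slopeE z : bounded_derivatives 2 CF (F^~ z) -> cdf_slope z = derive1 (F^~ z) 0.
Proof.
move=> hd; set f := F^~ z in hd *.
have [_ b1] := hd 1%N isT 0; rewrite derive1n1 in b1.
have CF0 : 0 <= CF := le_trans (normr_ge0 _) b1.
have tb x := taylor_bound hd x.
have cv : (fun N => (F (N.+1%:R^-1) z - F 0 z) * N.+1%:R) @ \oo --> derive1 f 0.
  apply/cvgrPdist_le => e e0.
  have h0 : 0 < e / (CF + 1) by rewrite divr_gt0// ltr_wpDl.
  apply: filterS (near_infty_natSinv_lt (PosNum h0)) => N /= hN.
  have N0 : 0 < N.+1%:R :> R by [].
  have := tb N.+1%:R^-1.
  rewrite /taylor !big_ord_recl big_ord0 /= /bump /= expr0 expr1 mulr1 addr0 fact0 divr1.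
  rewrite (_ : 1`! = 1%N)// divr1 -[derive1 _ 0]/(derive1 f 0) => h.
  rewrite -(@ler_pM2r _ N.+1%:R^-1) ?invr_gt0// -[X in _ * X]gtr0_norm ?invr_gt0//.
  rewrite -normrM mulrBl mulfK ?gt_eqF// distrC.
  have -> : F N.+1%:R^-1 z - F 0 z - derive1 f 0 / N.+1%:R =
    f N.+1%:R^-1 - (f 0 + derive1 f 0 / N.+1%:R) by rewrite /f; ring.
  apply: le_trans h _; rewrite gtr0_norm ?invr_gt0// expr2 mulrA.
  rewrite ler_pM2r ?invr_gt0//; move: hN; rewrite ltr_pdivlMr ?ltr_wpDl// => hN.
  by rewrite mulrC (le_trans _ (ltW hN))// ler_wpM2l ?invr_ge0// lerDl.
rewrite /cdf_slope.
have -> : limn_esup (fun N => ((F (N.+1%:R^-1) z - F 0 z) * N.+1%:R)%:E) = (derive1 f 0)%:E.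
  have cvE : (fun N => ((F (N.+1%:R^-1) z - F 0 z) * N.+1%:R)%:E) @ \oo --> (derive1 f 0)%:E.
    by apply: cvg_EFin; [exact: nearW|exact: cv].
  rewrite is_cvg_limn_esupE; last by apply/cvg_ex; eexists; exact: cvE.
  exact/cvg_lim.
by move: b1; rewrite ler_norml => /andP[h1 h2]; rewrite /= min_r// max_r.
Qed.

End slope.

Section hessian_limit.
Context (R : realType) (alpha : nat) (H : R -> R) (K Cr CF c1 eta CZ : R).
Context (n p : nat) (M : binary_response R n p) (rho F : R -> borel_cV R p -> R).
Hypothesis hM : regular_model alpha H K Cr CF c1 eta CZ M rho F.
Local Notation P := (br_prob M).
Local Notation Z := (br_Z M).
Local Notation eps := (br_eps M).
Local Notation V := (borel_cV R p).
Local Notation mu := (@lebesgue_measure R).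

Let K0 : 0 <= K. Proof. exact: le_trans (kb_K (rm_kernel hM)). Qed.
Let CF0 := rm_CF hM. Let Cr0 := rm_Cr hM.
Let hc0 : 0 <= hess_bias_const K CF Cr.
Proof. by rewrite !mulr_ge0// addr_ge0// !mulr_ge0. Qed.
Let mZd u : measurable_fun setT (fun w => dotp u (Z w)).
Proof. exact: rm_mdotp. Qed.

(** A bounded and everywhere measurable substitute for [rho(0|z) F'(0|z)], equal to it almost
    surely. It turns the entries of [V_mx] into integrals of integrable functions, which can be
    summed. *)
Definition weight0 (z : V) : R :=
  Num.max 0 (Num.min Cr (rho 0 z)) * cdf_slope F CF z.

Lemma weight0_le z : `|weight0 z| <= Cr * CF.
Proof.
rewrite normrM ler_pM//; last exact: cdf_slope_le.
rewrite ger0_norm ?le_max ?lexx//.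
by rewrite ge_max Cr0 ge_min lexx.
Qed.

Lemma measurable_weight0 : measurable_fun setT weight0.
Proof.
have [_ [hcdf _] _] := rm_noise hM; have [[mr _ _] _] := rm_density hM.
apply: measurable_funM; last by apply: measurable_cdf_slope => u; have [] := hcdf u.
apply: measurable_maxr => //; apply: measurable_minr => //.
exact: (measurable_fun_pair2 (f := fun xz : R * V => rho xz.1 xz.2) 0 mr).
Qed.

Lemma weight0_ae : {ae P, forall w, weight0 (Z w) = rho 0 (Z w) * derive1 (F^~ (Z w)) 0}.
Proof.
apply: filterS (rm_good hM) => w [[_ _ _ hd] r01 _].
have /andP[r0 r1] := r01 0.
rewrite /weight0 (cdf_slopeE (bounded_derivativesW _ hd)).
  by rewrite min_r// max_r// ltW.
by rewrite ltnS ltnW// (rm_alpha hM).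
Qed.

Lemma integrable_weighted_dotp u u' : l2norm u <= 1 -> l2norm u' <= 1 ->
  P.-integrable setT (EFin \o (fun w => weight0 (Z w) * (dotp u (Z w) * dotp u' (Z w)))).
Proof.
move=> u1 u1'.
have mw : measurable_fun setT (fun w => weight0 (Z w)).
  have m1 := measurable_weight0; have m2 := @rm_mZ R n p M.
  exact: (measurableT_comp m1 m2).
have mn (e : 'cV[R]_p) : measurable_fun setT (fun w => `|dotp e (Z w)|).
  exact: measurableT_comp.
have C0 : 0 <= Cr * CF by rewrite mulr_ge0.
apply: (@integrable_dominated _ _ _ _ _
   (fun w => Cr * CF * (`|dotp u (Z w)| * `|dotp u' (Z w)|)) (Cr * CF * mom_const eta CZ)).
- by apply: measurable_funM => //; exact: measurable_funM.
- by apply: measurable_funM => //; exact: measurable_funM.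
- move=> w; rewrite (normrM (weight0 _)) -(normrM (dotp u _)).
  by apply: ler_wpM2r (weight0_le _).
- under eq_integral do rewrite EFinM.
  rewrite ge0_integralZl; [|exact: measurableT
    |by apply/measurable_EFinP; exact: measurable_funM
    |by move=> w _; rewrite lee_fin mulr_ge0|by rewrite lee_fin].
  by rewrite [leRHS]EFinM lee_wpmul2l// (moment2_le hM).
Qed.

Lemma l2norm_delta (i : 'I_p) : l2norm (delta_mx i 0 : 'cV[R]_p) = 1.
Proof.
have h : l2norm (delta_mx i 0 : 'cV[R]_p) ^+ 2 = 1.
  rewrite sqr_l2norm dotpE (bigD1 i)//= mxE !eqxx mulr1 big1 ?addr0//.
  by move=> j /negbTE h; rewrite !mxE h mulr0.
by apply/eqP; rewrite -(@eqrXn2 _ 2)// ?l2norm_ge0// expr1n h.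
Qed.

Lemma dotp_delta (i : 'I_p) (z : 'cV[R]_p) : dotp (delta_mx i 0) z = z i 0.
Proof.
rewrite dotpE (bigD1 i)//= mxE !eqxx mul1r big1 ?addr0//.
by move=> j /negbTE h; rewrite !mxE h mul0r.
Qed.

Lemma V_mxE i j : V_mx M rho F i j =
  2 * \int[P]_w (weight0 (Z w) * (dotp (delta_mx i 0) (Z w) * dotp (delta_mx j 0) (Z w))).
Proof.
rewrite !mxE; congr (_ * _); rewrite unlock /Rintegral; congr fine.
apply: ae_eq_integral_nonmeasurable; apply: filterS weight0_ae => w ->.
congr EFin; congr (_ * _); rewrite !dotp_delta mxE big_ord1.
by rewrite [(trmx _) _ _]mxE.
Qed.

Lemma V_mx_sym : (V_mx M rho F)^T = V_mx M rho F.
Proof.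
apply/matrixP => i j; rewrite [LHS]mxE !V_mxE; apply: (congr1 ( *%R 2)).
by apply: eq_Rintegral => w _; rewrite [dotp (delta_mx j 0) _ * _]mulrC.
Qed.

Lemma dotp_V u u' : dotp u (V_mx M rho F *m u') =
  \int[P]_w (2 * (weight0 (Z w) * (dotp u (Z w) * dotp u' (Z w)))).
Proof.
have sumE (I : finType) (f : I -> br_space M -> R) :
    (forall i, P.-integrable setT (EFin \o f i)) ->
    \sum_i \int[P]_w f i w = \int[P]_w \sum_i f i w.
  move=> fi; rewrite /Rintegral; under [in RHS]eq_integral do rewrite -sumEFin.
  rewrite integral_sum//; apply: sum_fine => i _.
  by apply: (integrable_fin_num measurableT); exact: fi.
have iZ (c : R) (f : br_space M -> R) : P.-integrable setT (EFin \o f) ->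
    P.-integrable setT (EFin \o (fun w => c * f w)).
  move=> fi; have := integrableZl measurableT c fi.
  by congr (P.-integrable _ _); apply/funext => w /=; rewrite EFinM.
have iSum (I : finType) (f : I -> br_space M -> R) :
    (forall i, P.-integrable setT (EFin \o f i)) ->
    P.-integrable setT (EFin \o (fun w => \sum_i f i w)).
  move=> fi; have := @integrable_sum _ _ _ P setT measurableT I (index_enum I) xpredT
    (fun i => EFin \o f i) (fun i _ => fi i).
  by congr (P.-integrable _ _); apply/funext => w /=; rewrite sumEFin.
pose e i j w := weight0 (Z w) * (dotp (delta_mx i 0) (Z w) * dotp (delta_mx j 0) (Z w)).
have ie i j : P.-integrable setT (EFin \o e i j).
  by apply: integrable_weighted_dotp; rewrite l2norm_delta.
transitivity (\sum_i \sum_j \int[P]_w (2 * u i 0 * u' j 0 * e i j w)).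
  rewrite dotpE; apply: eq_bigr => i _; rewrite mxE mulr_sumr; apply: eq_bigr => j _.
  by rewrite V_mxE RintegralZl// -/(e i j); ring.
under eq_bigr => i _ do rewrite (sumE _ _ (fun j => iZ _ _ (ie i j))).
rewrite sumE; last by move=> i; apply: iSum => j; exact: iZ.
apply: eq_Rintegral => w _; rewrite !dotpE !mulr_suml !mulr_sumr.
apply: eq_bigr => i _; rewrite mulr_sumr !mulr_sumr; apply: eq_bigr => j _.
by rewrite /e !dotp_delta; ring.
Qed.

Lemma hess_mean_limit h u u' : 0 < h -> l2norm u <= 1 -> l2norm u' <= 1 ->
  `| \int[P]_w hess_term H M h 0 u u' (obs0 w) - dotp u (V_mx M rho F *m u') |
   <= hess_bias_const K CF Cr * mom_const eta CZ * h.
Proof.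
move=> h0 u1 u1'; have h2 : 0 < h ^+ 2 by rewrite exprn_gt0.
pose g (v : R * V) : R := derive1n 2 H (v.1 / h) * (dotp u v.2 * dotp u' v.2) / h ^+ 2.
have gE w : hess_term H M h 0 u u' (obs0 w) =
    - sign_pm (br_zeta w + eps w) * g (br_zeta w, Z w).
  by rewrite /hess_term dotpC dotp0r addr0.
have mzZ : measurable_fun setT (fun w : br_space M => (br_zeta w, Z w : V)).
  apply: measurable_fun_pair; last exact: measurable_funPT.
  apply: measurable_funD; first exact: measurable_funPT.
  by under eq_fun do rewrite dotpC; exact: mZd.
have mg : measurable_fun setT g.
  apply: measurable_funM => //; apply: measurable_funM; last first.
    by apply: measurable_funM; exact: (measurableT_comp (measurable_dotp _) measurable_snd).
  apply: (measurableT_comp (continuous_measurable_fun (kb_c2 (rm_kernel hM)))).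
  by apply: measurable_funM => //; exact: measurable_fst.
have mn (e : 'cV[R]_p) : measurable_fun setT (fun w => `|dotp e (Z w)|).
  exact: measurableT_comp.
have m2 : measurable_fun setT (fun w => `|dotp u (Z w)| * `|dotp u' (Z w)|).
  exact: measurable_funM.
have cstI (c : R) : 0 <= c -> (\int[P]_w (c * (`|dotp u (Z w)| * `|dotp u' (Z w)|))%:E
    <= (c * mom_const eta CZ)%:E)%E.
  move=> c0; under eq_integral do rewrite EFinM.
  rewrite ge0_integralZl; [|exact: measurableT|exact/measurable_EFinP
    |by move=> w _; rewrite lee_fin mulr_ge0|by rewrite lee_fin].
  by rewrite [leRHS]EFinM lee_wpmul2l// (moment2_le hM).
have ig : P.-integrable setT (fun w => (g (br_zeta w, Z w))%:E).
  have k0 : 0 <= K / h ^+ 2 by rewrite divr_ge0// ltW.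
  apply: (integrable_dominated (f := fun w => g (br_zeta w, Z w)) _ _ _ (cstI _ k0)).
  - exact: (measurableT_comp mg mzZ).
  - exact: measurable_funM.
  - move=> w; rewrite /g /= normrM normfV (gtr0_norm h2) normrM mulrAC -normrM.
    by rewrite ler_wpM2r// ler_wpM2r ?invr_ge0 ?(ltW h2)// (kb_b2 (rm_kernel hM)).
pose kap w := 2 * (weight0 (Z w) * (dotp u (Z w) * dotp u' (Z w))).
have ik : P.-integrable setT (EFin \o kap).
  have := integrableZl measurableT 2 (integrable_weighted_dotp u1 u1').
  by congr (P.-integrable _ _); apply/funext => w /=; rewrite EFinM.
pose c := hess_bias_const K CF Cr * h.
have c0 : 0 <= c by rewrite mulr_ge0// ltW.
pose B w := c * (`|dotp u (Z w)| * `|dotp u' (Z w)|).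
have mB : measurable_fun setT B by exact: measurable_funM.
have B0 w : 0 <= B w by rewrite mulr_ge0// mulr_ge0.
have iB : P.-integrable setT (EFin \o B).
  by apply: (integrable_dominated mB mB _ (cstI _ c0)) => w; rewrite ger0_norm.
rewrite dotp_V; under eq_Rintegral do rewrite gE.
apply: (le_trans (model_bias_expectation hM mg ig ik iB _)).
  apply: filterS2 (rm_good hM) weight0_ae => w [gf r01 hr] wE.
  rewrite /B /kap wE.
  have -> : 2 * (rho 0 (Z w) * derive1 (F^~ (Z w)) 0 * (dotp u (Z w) * dotp u' (Z w))) =
    2 * (derive1 (F^~ (Z w)) 0 * rho 0 (Z w)) * (dotp u (Z w) * dotp u' (Z w)).
    by rewrite [rho 0 _ * _]mulrC mulrA.
  rewrite -normrM.
  exact: (pointwise_hess_bias (rm_kernel hM) (rm_alpha hM) gf r01 hr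
    (dotp u (Z w) * dotp u' (Z w)) h0).
rewrite (_ : _ * _ * h = c * mom_const eta CZ); last by rewrite /c; ring.
by apply: Rintegral_le (cstI _ c0).
Qed.

End hessian_limit.

(** * Exponentially weighted second moments of the summands *)

Section variance_bounds.
Context (R : realType) (alpha : nat) (H : R -> R) (K Cr CF c1 eta CZ : R).
Context (n p : nat) (M : binary_response R n p) (rho F : R -> borel_cV R p -> R).
Hypothesis hM : regular_model alpha H K Cr CF c1 eta CZ M rho F.
Local Notation P := (br_prob M).
Local Notation Z := (br_Z M).
Local Notation V := (borel_cV R p).
Local Notation obs := (R * V * R)%type.

Let K1 : 1 <= K := kb_K (rm_kernel hM).
Let Kp : 0 < K. Proof. exact: lt_le_trans K1. Qed.

(** The gain over the trivial bound [A B] is the factor [h], the order of the probability of the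
    slab. *)
Lemma slab_bound (f : obs -> R) (d : 'cV[R]_p) (phi : V -> R) (A B h : R) : 0 < h -> 0 <= A ->
  measurable_fun setT phi -> (forall z, 0 <= phi z) -> measurable_fun setT f ->
  (forall v, 0 <= f v <= A * phi v.1.2) ->
  (forall v, h < `|latent M v + dotp d v.1.2| -> f v = 0) ->
  (\int[P]_w (phi (Z w))%:E <= B%:E)%E ->
  (\int[P]_w (f (obs0 w))%:E <= (A * (2 * h * Cr * B))%:E)%E.
Proof.
move=> h0 A0 mphi phi0 mf fA f0 hB.
have [hr hr2] := rm_density hM.
have mz : measurable_fun setT (@br_zeta R n p M).
  apply: measurable_funD; first exact: measurable_funPT.
  by under eq_fun do rewrite dotpC; exact: rm_mdotp.
have mI : measurable [set x : R | `|x| <= h].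
  rewrite (_ : [set _ | _] = `[(- h)%R, h]%classic)//.
  by apply/seteqP; split => x /=; rewrite in_itv/= ler_norml.
pose I (x : R) : R := \1_[set x : R | `|x| <= h] x.
have mII : measurable_fun setT I by exact: measurable_indic.
have mZ := @rm_mZ R n p M.
have mg : measurable_fun setT (fun w => phi (Z w) * I (br_zeta w + dotp d (Z w))).
  apply: measurable_funM; first exact: (measurableT_comp mphi mZ).
  by apply: (measurableT_comp mII); apply: measurable_funD => //; exact: rm_mdotp.
have brho : {ae P, forall w, forall t, rho t (Z w) <= Cr}.
  by apply: filterS hr2 => w [h1 _] t; have /andP[] := h1 t.
have := slab_integral mz mZ hr brho (rm_Cr hM) h0 (measurable_dotp d) mphi phi0.
move=> hs; apply: (@le_trans _ _ (\int[P]_w (A * (phi (Z w) * I (br_zeta w + dotp d (Z w))))%:E)%E).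
  apply: ge0_le_integral; first exact: measurableT.
  - by move=> w _; rewrite lee_fin; have /andP[] := fA (obs0 w).
  - by apply/measurable_EFinP; apply: (measurableT_comp mf); exact: measurable_obs0.
  - by apply/measurable_EFinP; exact: measurable_funM.
  - move=> w _; rewrite lee_fin; have /andP[fw fA'] := fA (obs0 w).
    have [hle|hgt] := leP `|br_zeta w + dotp d (Z w)| h; last first.
      by rewrite f0// mulr_ge0// mulr_ge0// /I indicE.
    by rewrite /I indicE mem_set// mulr1.
under eq_integral do rewrite EFinM.
rewrite ge0_integralZl; [|exact: measurableT|exact/measurable_EFinP
  |by move=> w _; rewrite lee_fin mulr_ge0// /I indicE|by rewrite lee_fin].
rewrite [leRHS]EFinM; apply: lee_wpmul2l; first by rewrite lee_fin.
apply: (le_trans hs); rewrite [leRHS]EFinM; apply: lee_wpmul2l => //.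
by rewrite lee_fin !mulr_ge0// ?(ltW h0)// (rm_Cr hM).
Qed.

Definition hess_mgf_const := 4 * K ^+ 2 * exp_const (eta / 8) ^+ 2 * Cr * CZ.

(** A summand is [O(h^-2)] on a slab of probability [O(h)], hence the order [h^-3]. With
    [x = u^T Z], [y = u'^T Z] and [S = x^2 + y^2], the square costs [e^(eta S/4)] and the
    exponential weight, whose parameter has order [h^2], costs [e^(eta S/8)]. Since
    [3 S/8 <= max(x^2, y^2)], the subgaussian bound in the two directions suffices. *)
Lemma hess_mgf h d u u' : 0 < h -> l2norm u <= 1 -> l2norm u' <= 1 ->
  (\int[P]_w (hess_term H M h d u u' (obs0 w) ^+ 2 *
     expR (eta * h ^+ 2 / (4 * K) * `|hess_term H M h d u u' (obs0 w)|))%:E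
   <= (hess_mgf_const / h ^+ 3)%:E)%E.
Proof.
move=> h0 u1 u1'; have e0 := rm_eta hM; have h2 : 0 < h ^+ 2 by rewrite exprn_gt0.
pose t := hess_term H M h d u u'.
pose l0 := eta * h ^+ 2 / (4 * K).
have l00 : 0 <= l0 by rewrite divr_ge0// ?mulr_ge0// ltW.
have mt : measurable_fun setT t by exact: (measurable_hess_term hM).
have e8 : 0 < eta / 8 by rewrite divr_gt0.
pose c := exp_const (eta / 8).
have c0 : 0 <= c by exact: exp_const_ge0.
pose phi (z : V) : R := expR (eta * dotp u z ^+ 2) + expR (eta * dotp u' z ^+ 2).
have me (e : 'cV[R]_p) : measurable_fun setT (fun z : V => expR (eta * dotp e z ^+ 2)).
  apply: measurableT_comp => //; apply: measurable_funM => //; apply: measurable_funX.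
  exact: measurable_dotp.
have mZ := @rm_mZ R n p M.
have -> : hess_mgf_const / h ^+ 3 = (K / h ^+ 2 * c) ^+ 2 * (2 * h * Cr * (CZ + CZ)).
  by rewrite /hess_mgf_const -/c; field; rewrite gt_eqF.
apply: (@slab_bound (fun v => t v ^+ 2 * expR (l0 * `|t v|)) d phi) => //.
- by rewrite sqr_ge0.
- exact: measurable_funD.
- by move=> z; rewrite addr_ge0 ?expR_ge0.
- apply: measurable_funM; first exact: measurable_funX.
  apply: measurableT_comp => //; apply: measurable_funM => //; exact: measurableT_comp.
- move=> v; rewrite mulr_ge0 ?sqr_ge0 ?expR_ge0//=.
  set x := dotp u v.1.2; set y := dotp u' v.1.2.
  have tl : `|t v| <= K / h ^+ 2 * `|x * y| by exact: (hess_term_le hM).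
  have k0 : 0 <= K / h ^+ 2 by rewrite divr_ge0// ltW.
  have xy : `|x * y| <= (x ^+ 2 + y ^+ 2) / 2.
    rewrite normrM -(real_normK (num_real x)) -(real_normK (num_real y)).
    by have := sqr_ge0 (`|x| - `|y|); rewrite sqrrB => ?; lra.
  have E1 : l0 * `|t v| <= eta / 8 * (x ^+ 2 + y ^+ 2).
    apply: (le_trans (ler_wpM2l l00 tl)); rewrite mulrA.
    have -> : l0 * (K / h ^+ 2) = eta / 4 by rewrite /l0; field; rewrite !gt_eqF.
    have -> : eta / 8 * (x ^+ 2 + y ^+ 2) = eta / 4 * ((x ^+ 2 + y ^+ 2) / 2) by field.
    by rewrite ler_wpM2l// divr_ge0// ltW.
  have E2 : `|x * y| <= c * expR (eta / 8 * (x ^+ 2 + y ^+ 2)).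
    have q0 (x' : R) : 0 <= x' ^+ 2 by exact: sqr_ge0.
    have px (x' : R) : x' ^+ 2 <= x ^+ 2 + y ^+ 2 ->
        x' ^+ 2 <= c * expR (eta / 8 * (x ^+ 2 + y ^+ 2)).
      move=> le'; have := pow_le_expR x' e8 (isT : (2 <= 4)%N).
      rewrite real_normK ?num_real// => /le_trans; apply.
      by rewrite ler_wpM2l// ler_expR ler_wpM2l// ltW.
    have hx := px x; have hy := px y; rewrite lerDl in hx; rewrite lerDr in hy.
    have := hx (q0 y); have := hy (q0 x); move: xy.
    by move: (c * _) `|x * y| => e xy; lra.
  set S := x ^+ 2 + y ^+ 2 in E1 E2 xy *.
  have S0 : 0 <= S by rewrite addr_ge0 ?sqr_ge0.
  have t2 : t v ^+ 2 <= (K / h ^+ 2 * c) ^+ 2 * expR (eta / 4 * S).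
    have -> : expR (eta / 4 * S) = expR (eta / 8 * S) ^+ 2.
      by rewrite expr2 -expRD; congr expR; field.
    have kc : 0 <= K / h ^+ 2 * c by rewrite mulr_ge0.
    rewrite -exprMn -(real_normK (num_real (t v))) ler_pXn2r ?nnegrE//; last first.
      by rewrite mulr_ge0 ?expR_ge0.
    by apply: (le_trans tl); rewrite -[leRHS]mulrA; apply: ler_wpM2l.
  apply: (le_trans (ler_pM (sqr_ge0 _) (expR_ge0 _) t2 (_ : _ <= expR (eta / 8 * S)))).
    by rewrite ler_expR.
  rewrite -[leLHS]mulrA -expRD; apply: ler_wpM2l; first exact: sqr_ge0.
  rewrite /phi -/x -/y.
  have [xy'|xy'] := leP (x ^+ 2) (y ^+ 2).
    rewrite -[leLHS]add0r lerD ?expR_ge0// ler_expR -mulrDl.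
    by have := mulr_ge0 (ltW e0) (sqr_ge0 y); move: (ler_wpM2l (ltW e0) xy'); rewrite /S; lra.
  rewrite -[leLHS]addr0 lerD ?expR_ge0// ler_expR -mulrDl.
  by have := mulr_ge0 (ltW e0) (sqr_ge0 x); move: (ler_wpM2l (ltW e0) (ltW xy')); rewrite /S; lra.
- move=> v hv; suff -> : t v = 0 by rewrite expr0n mul0r.
  rewrite /t /hess_term (kb_s2 (rm_kernel hM)) ?mul0r ?mulr0//.
  by rewrite normrM normfV (gtr0_norm h0) ler_pdivlMr// mul1r ltW.
- under eq_integral do rewrite EFinD.
  rewrite ge0_integralD; [|exact: measurableT|by move=> w _; rewrite lee_fin expR_ge0
    |by apply/measurable_EFinP; exact: (measurableT_comp (me u) mZ)
    |by move=> w _; rewrite lee_fin expR_ge0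
    |by apply/measurable_EFinP; exact: (measurableT_comp (me u') mZ)].
  by rewrite EFinD; apply: leeD; exact: subgaussian_le1 hM _ _.
Qed.

Definition grad_mgf_const := 2 * K ^+ 2 * exp_const (eta / 2) * expR (eta / 2) * Cr * CZ.

Lemma grad_term_le h u v : 0 < h ->
  `|grad_term H M h u v| <= K / h * `|dotp u v.1.2|.
Proof.
move=> h0; rewrite /grad_term normrM normrN.
have -> : `|sign_pm (latent M v + v.2)| = 1.
  by rewrite /sign_pm; case: ifP => _; rewrite ?normrN normr1.
rewrite mul1r normrM normfV (gtr0_norm h0) normrM mulrAC ler_wpM2r//.
by rewrite ler_wpM2r ?invr_ge0 ?(ltW h0)// (kb_b1 (rm_kernel hM)).
Qed.

Lemma grad_mgf h u : 0 < h -> l2norm u <= 1 ->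
  (\int[P]_w (grad_term H M h u (obs0 w) ^+ 2 *
     expR (eta * h / (2 * K) * `|grad_term H M h u (obs0 w)|))%:E
   <= (grad_mgf_const / h)%:E)%E.
Proof.
move=> h0 u1; have e0 := rm_eta hM.
pose t := grad_term H M h u.
pose l0 := eta * h / (2 * K).
have l00 : 0 <= l0 by rewrite divr_ge0// ?mulr_ge0// ltW.
have mt : measurable_fun setT t by exact: (measurable_grad_term hM).
have e2 : 0 < eta / 2 by rewrite divr_gt0.
pose c := exp_const (eta / 2).
have c0 : 0 <= c by exact: exp_const_ge0.
pose phi (z : V) : R := expR (eta * dotp u z ^+ 2).
have me : measurable_fun setT phi.
  apply: measurableT_comp => //; apply: measurable_funM => //; apply: measurable_funX.
  exact: measurable_dotp.
have k0 : 0 <= K / h by rewrite divr_ge0// ltW.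
have -> : grad_mgf_const / h = (K / h) ^+ 2 * c * expR (eta / 2) * (2 * h * Cr * CZ).
  by rewrite /grad_mgf_const -/c; field; rewrite gt_eqF.
apply: (@slab_bound (fun v => t v ^+ 2 * expR (l0 * `|t v|)) 0 phi) => //.
- by apply: mulr_ge0 (expR_ge0 _); exact: mulr_ge0 (sqr_ge0 _) c0.
- by move=> z; exact: expR_ge0.
- apply: measurable_funM; first exact: measurable_funX.
  apply: measurableT_comp => //; apply: measurable_funM => //; exact: measurableT_comp.
- move=> v; rewrite mulr_ge0 ?sqr_ge0 ?expR_ge0//= /phi.
  set x := dotp u v.1.2.
  have tl : `|t v| <= K / h * `|x| by exact: grad_term_le.
  (* [|x| <= 1 + x^2] makes the exponent quadratic at the price of the constant factor
     [expR (eta / 2)]. *)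
  have E1 : l0 * `|t v| <= eta / 2 + eta / 2 * x ^+ 2.
    apply: (le_trans (ler_wpM2l l00 tl)); rewrite mulrA.
    have -> : l0 * (K / h) = eta / 2 by rewrite /l0; field; rewrite !gt_eqF.
    rewrite -[X in X + _]mulr1 -mulrDr ler_wpM2l ?(ltW e2)//.
    rewrite -(real_normK (num_real x)).
    by have := sqr_ge0 (`|x| - 1); have := normr_ge0 x; rewrite sqrrB mulr1 => *; nra.
  have t2 : t v ^+ 2 <= (K / h) ^+ 2 * (c * expR (eta / 2 * x ^+ 2)).
    apply: le_trans (ler_wpM2l (sqr_ge0 (K / h)) (pow_le_expR x e2 (isT : (2 <= 4)%N))).
    rewrite -exprMn -(real_normK (num_real (t v))).
    by apply: (lerXn2r 2 _ _ tl); rewrite nnegrE// mulr_ge0.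
  apply: (le_trans (ler_pM (sqr_ge0 _) (expR_ge0 _) t2
    (_ : _ <= expR (eta / 2 + eta / 2 * x ^+ 2)))); first by rewrite ler_expR.
  rewrite le_eqVlt; apply/orP; left; apply/eqP.
  have -> : eta * x ^+ 2 = eta / 2 * x ^+ 2 + eta / 2 * x ^+ 2 by field.
  by rewrite !expRD; ring.
- move=> v; rewrite dotpC dotp0r addr0 => hv; suff -> : t v = 0 by rewrite expr0n mul0r.
  rewrite /t /grad_term (kb_s1 (rm_kernel hM)) ?mul0r ?mulr0//.
  by rewrite normrM normfV (gtr0_norm h0) ler_pdivlMr// mul1r ltW.
- exact: subgaussian_le1 hM _ _.
Qed.

End variance_bounds.

Lemma markov_le d (T : measurableType d) (R : realType) (P : probability T R)
    (f : T -> R) (c t : R) : measurable_fun setT f -> (forall w, 0 <= f w) -> 0 < t ->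
  (\int[P]_w (f w)%:E <= c%:E)%E -> (P [set w | t <= f w]%R <= (c / t)%:E)%E.
Proof.
move=> mf f0 t0 hc; set A := [set w | _].
have mA : measurable A.
  by rewrite -[A]setTI; apply: (measurable_fun_ler (measurable_cst _)).
have : (t%:E * P A <= c%:E)%E.
  apply: le_trans hc; rewrite -[A in X in (X <= _)%E]setIT -integral_indic//.
  rewrite -ge0_integralZl; [|exact: measurableT|by apply/measurable_EFinP; exact: measurable_indic
    |by move=> w _; rewrite lee_fin indicE|by rewrite lee_fin ltW].
  apply: ge0_le_integral; first exact: measurableT.
  - by move=> w _; rewrite -EFinM lee_fin mulr_ge0 ?(ltW t0)// indicE.
  - apply/measurable_EFinP; apply: measurable_funM => //; exact: measurable_indic.
  - exact/measurable_EFinP.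
  - move=> w _; rewrite -EFinM lee_fin indicE; have [wA|wA] := boolP (w \in A).
      by rewrite mulr1; move: wA; rewrite inE.
    by rewrite mulr0.
have fA : P A \is a fin_num by exact: fin_num_measure.
by rewrite -(fineK fA) -EFinM !lee_fin ler_pdivlMr// mulrC.
Qed.

(** * Deviation of the empirical gradient at the true parameter *)

Section empirical.
Context (R : realType) (alpha : nat) (H : R -> R) (K Cr CF c1 eta CZ : R).
Context (n p : nat) (M : binary_response R n p) (rho F : R -> borel_cV R p -> R).
Hypothesis hM : regular_model alpha H K Cr CF c1 eta CZ M rho F.
Local Notation P := (br_prob M).
Local Notation Z := (br_Z M).
Local Notation V := (borel_cV R p).
Local Notation obs := (R * V * R)%type.

Definition obs_at (i : 'I_n) (w : br_space M) : obs := (br_xs M i w, br_zs M i w, br_es M i w).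

Lemma measurable_obs_at i : measurable_fun setT (obs_at i).
Proof.
apply: measurable_fun_pair; last exact: measurable_funPT.
by apply: measurable_fun_pair; exact: measurable_funPT.
Qed.

Definition emp_grad (h : R) (d : 'cV[R]_p) (w : br_space M) : 'cV[R]_p :=
  sms_grad H (fun i => br_ys i w) (fun i => br_xs M i w) (fun i => br_zs M i w)
    h (br_beta M + d).

Definition emp_hess (h : R) (d : 'cV[R]_p) (w : br_space M) : 'M[R]_p :=
  sms_hess H (fun i => br_ys i w) (fun i => br_xs M i w) (fun i => br_zs M i w)
    h (br_beta M + d).

Lemma dotp_emp_grad h u w :
  dotp u (emp_grad h 0 w) = n%:R^-1 * \sum_i grad_term H M h u (obs_at i w).
Proof.
rewrite /emp_grad addr0 /sms_grad dotpZr dotp_sumr invfM -mulrA mulr_sumr.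
congr (_ * _); apply: eq_bigr => i _; rewrite dotpZr.
have key (y a c e : R) : e * (- y * a * c) = - y * (a * c * e) by ring.
exact: key.
Qed.

Lemma dotp_emp_hess h d u u' w :
  dotp u (emp_hess h d w *m u') = n%:R^-1 * \sum_i hess_term H M h d u u' (obs_at i w).
Proof.
rewrite /emp_hess /sms_hess -scalemxAl dotpZr mulmx_suml dotp_sumr invfM -mulrA mulr_sumr.
congr (_ * _); apply: eq_bigr => i _; rewrite -scalemxAl dotpZr.
have -> : dotp u (br_zs M i w *m (br_zs M i w : 'cV[R]_p)^T *m u') =
   dotp u (br_zs M i w) * dotp u' (br_zs M i w).
  rewrite (dotpC u'); rewrite /dotp -mulmxA mulmxA [u^T *m _]mx11_scalar mul_scalar_mx mxE.
  by rewrite !mxE eqxx mulr1n.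
rewrite dotpDr addrA (dotpC (br_zs M i w) d).
have key (y a c e : R) : e * (- y * a * c) = - y * (a * c * e) by ring.
exact: key.
Qed.

Let delta_le1 (j : 'I_p) : l2norm (delta_mx j 0 : 'cV[R]_p) <= 1.
Proof. by rewrite l2norm_delta. Qed.

Let hind := (rm_iid hM).1.
Let hid := (rm_iid hM).2.

Lemma integrable_grad_term h u : 0 < h -> l2norm u <= 1 ->
  P.-integrable setT (fun w => (grad_term H M h u (obs0 w))%:E).
Proof.
move=> h0 u1; have k0 : 0 <= K / h.
  by rewrite divr_ge0 ?(ltW h0)//; exact: le_trans (kb_K (rm_kernel hM)).
have mn : measurable_fun setT (fun w => `|dotp u (Z w)|).
  by apply: measurableT_comp => //; exact: rm_mdotp.
apply: (integrable_dominated (f := fun w => grad_term H M h u (obs0 w))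
  (g := fun w => K / h * `|dotp u (Z w)|) (c := K / h * mom_const eta CZ)).
- have m1 := measurable_grad_term hM h u; have m2 := @measurable_obs0 R n p M.
  exact: (measurableT_comp m1 m2).
- exact: measurable_funM.
- by move=> w; exact: (grad_term_le hM).
- under eq_integral do rewrite EFinM.
  rewrite ge0_integralZl; [|exact: measurableT|exact/measurable_EFinP
    |by move=> w _|by rewrite lee_fin].
  rewrite [leRHS]EFinM; apply: lee_wpmul2l; first by rewrite lee_fin.
  exact: (moment1_le hM).
Qed.

Definition grad_mean (h : R) : 'cV[R]_p :=
  \col_j \int[P]_w grad_term H M h (delta_mx j 0) (obs0 w).

Lemma dotp_grad_mean h u : 0 < h -> l2norm u <= 1 ->
  dotp u (grad_mean h) = \int[P]_w grad_term H M h u (obs0 w).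
Proof.
move=> h0 u1.
have gi j := @integrable_grad_term h (delta_mx j 0) h0 (delta_le1 j).
have giZ j : P.-integrable setT (fun w => (u j 0 * grad_term H M h (delta_mx j 0) (obs0 w))%:E).
  have := integrableZl measurableT (u j 0) (gi j).
  by congr (P.-integrable _ _); apply/funext => w /=; rewrite EFinM.
rewrite dotpE; under eq_bigr => j _ do rewrite mxE -(@RintegralZl _ _ _ _ _ _ (u j 0) measurableT (gi j)).
transitivity (fine (\sum_j \int[P]_w
    (u j 0 * grad_term H M h (delta_mx j 0) (obs0 w))%:E)%E).
  by apply: sum_fine => j _; apply: (integrable_fin_num measurableT); exact: giZ.
rewrite /Rintegral -integral_sum//; congr fine; apply: eq_integral => w _; rewrite sumEFin; congr EFin.
rewrite /grad_term [in RHS]dotpE /=.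
move: (- sign_pm _) (derive1 H _) => y a.
rewrite mulr_sumr mulr_suml mulr_sumr; apply: eq_bigr => j _.
by rewrite dotp_delta; ring.
Qed.

Lemma grad_mean_le h : 0 < h ->
  l2norm (grad_mean h) <= grad_bias_const alpha K CF Cr * mom_const eta CZ * h ^+ alpha.
Proof.
move=> h0; apply: l2norm_dual.
  have CF0 := rm_CF hM; have Cr0 := rm_Cr hM.
  have K0 : 0 <= K by exact: le_trans (kb_K (rm_kernel hM)).
  have gc0 : 0 <= grad_bias_const alpha K CF Cr.
    by rewrite !mulr_ge0// mulrn_wge0// !mulr_ge0.
  apply: mulr_ge0; last by rewrite exprn_ge0// ltW.
  by apply: mulr_ge0 => //; exact: (mom_const_ge0 hM).
move=> u u1; rewrite dotp_grad_mean//; apply: le_trans (ler_norm _) _.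
exact: (grad_bias hM).
Qed.

Lemma emp_grad_centered h j w : (0 < n)%N ->
  (emp_grad h 0 w - grad_mean h) j 0 =
  n%:R^-1 * centered_sum P obs_at (@obs0 R n p M) (grad_term H M h (delta_mx j 0)) w.
Proof.
move=> n0; have nn : n%:R != 0 :> R by rewrite pnatr_eq0 -lt0n.
rewrite -dotp_delta dotpBr dotp_emp_grad dotp_delta mxE /centered_sum.
by rewrite sumrB sumr_const card_ord mulrBr -[X in _ = _ - _ * X]mulr_natl mulKf.
Qed.

Definition grad_dev_const := 4 * expR 1 * (grad_mgf_const K Cr eta CZ + 1).

(** Only one parameter value is involved, so the second moment of the norm is enough: [p]
    coordinates, each with second moment [O(1/(n h))], followed by Markov's inequality. No logarithm
    appears. *)
Lemma grad_deviation h m : 0 < h -> 0 < m -> (0 < n)%N ->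
  4 * K ^+ 2 / eta ^+ 2 <= n%:R * h ->
  (P [set w | m * Num.sqrt (p%:R / (n%:R * h)) < l2norm (emp_grad h 0 w - grad_mean h)]%R
    <= (grad_dev_const / m ^+ 2)%:E)%E.
Proof.
move=> h0 m0 n0 nh; have e0 := rm_eta hM; have p0 := rm_p hM.
have nR : 0 < n%:R :> R by rewrite ltr0n.
have pR : 0 < p%:R :> R by rewrite ltr0n.
have Kp : 0 < K by exact: lt_le_trans (kb_K (rm_kernel hM)).
set C := grad_mgf_const K Cr eta CZ.
have C0 : 0 <= C.
  have c0 := exp_const_ge0 (divr_gt0 e0 (ltr0Sn _ 1) : 0 < eta / 2).
  rewrite !mulr_ge0 ?expR_ge0 ?(ltW Kp) ?(rm_Cr hM)//.
  exact: le_trans (rm_CZ hM).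
have C1 : 0 < C + 1 by rewrite ltr_wpDl.
(* Adding 1 keeps [s2] positive even if the constant is 0. *)
pose s2 := (C + 1) / h; have s20 : 0 < s2 by rewrite divr_gt0.
pose cs j := centered_sum P obs_at (@obs0 R n p M) (grad_term H M h (delta_mx j 0)).
have mg j := measurable_grad_term hM h (delta_mx j 0).
have hcs j : (\int[P]_w (cs j w ^+ 2)%:E <= (4 * expR 1 * (n%:R * s2))%:E)%E.
  have u1 := delta_le1 j.
  have hs2 : (\int[P]_w (grad_term H M h (delta_mx j 0) (obs0 w) ^+ 2 *
     expR (eta * h / (2 * K) * `|grad_term H M h (delta_mx j 0) (obs0 w)|))%:E <= s2%:E)%E.
    apply: le_trans (grad_mgf hM h0 u1) _.
    by rewrite lee_fin ler_pM2r ?invr_gt0// lerDl.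
  have ns0 : 0 < n%:R * s2 by rewrite mulr_gt0.
  (* This [l] makes the exponent [n l^2 s2] equal to 1; the lower bound on [n h] is what makes it
     admissible, that is, at most [eta h/(2 K)]. *)
  have := iid_second_moment measurable_obs_at (@measurable_obs0 R n p M) hind hid
    (mg j) (integrable_grad_term h0 u1) hs2 (l := (Num.sqrt (n%:R * s2))^-1).
  rewrite exprVn sqr_sqrtr ?(ltW ns0)// invrK.
  have -> : n%:R / (n%:R * s2) * s2 = 1 by field; rewrite !gt_eqF.
  apply; rewrite invr_gt0 sqrtr_gt0 ns0/=.
  have l0 : 0 < eta * h / (2 * K) by rewrite divr_gt0// mulr_gt0.
  rewrite -[leRHS]invrK lef_pV2 ?posrE ?invr_gt0 ?sqrtr_gt0//.
  rewrite -[leLHS]ger0_norm ?invr_ge0 ?(ltW l0)// -sqrtr_sqr ler_sqrt ?(ltW ns0)//.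
  have -> : (eta * h / (2 * K))^-1 ^+ 2 = 4 * K ^+ 2 / eta ^+ 2 / h ^+ 2.
    by field; rewrite !gt_eqF.
  rewrite ler_pdivrMr ?exprn_gt0//; apply: le_trans nh _.
  have -> : n%:R * s2 * h ^+ 2 = n%:R * h * (C + 1) by rewrite /s2; field; rewrite gt_eqF.
  by rewrite ler_peMr ?lerDr// mulr_ge0// ltW.
pose f w := \sum_j (n%:R^-1 * cs j w) ^+ 2.
have fE w : l2norm (emp_grad h 0 w - grad_mean h) ^+ 2 = f w.
  rewrite sqr_l2norm dotpE /f; apply: eq_bigr => k _.
  by rewrite emp_grad_centered// expr2.
have mcs j : measurable_fun setT (cs j).
  exact: (measurable_centered_sum _ _ measurable_obs_at (mg j)).
have mterm j : measurable_fun setT (fun w => (n%:R^-1 * cs j w) ^+ 2).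
  by apply: measurable_funX; exact: measurable_funM.
have mf : measurable_fun setT f by exact: measurable_sum.
have f0 w : 0 <= f w by apply: sumr_ge0 => j _; exact: sqr_ge0.
pose a := p%:R / (n%:R * h).
have a0 : 0 < a by rewrite divr_gt0// mulr_gt0.
have hf : (\int[P]_w (f w)%:E <= (grad_dev_const * a)%:E)%E.
  have -> : (fun w => (f w)%:E) = (fun w => \sum_j ((n%:R^-1 * cs j w) ^+ 2)%:E)%E.
    by apply/funext => w; rewrite sumEFin.
  rewrite ge0_integral_sum; [|exact: measurableT|by move=> i; exact/measurable_EFinP
    |by move=> i w _; rewrite lee_fin sqr_ge0].
  apply: (@le_trans _ _ (\sum_(j < p) (n%:R ^- 2 * (4 * expR 1 * (n%:R * s2)))%:E)%E).
    apply: lee_sum => j _; under eq_integral do rewrite exprMn EFinM.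
    rewrite ge0_integralZl; [|exact: measurableT
      |by apply/measurable_EFinP; exact: measurable_funX
      |by move=> w _; rewrite lee_fin sqr_ge0|by rewrite lee_fin sqr_ge0].
    by rewrite [leRHS]EFinM exprVn; apply: lee_wpmul2l => //; rewrite lee_fin invr_ge0 sqr_ge0.
  rewrite sumEFin lee_fin sumr_const card_ord -mulr_natl le_eqVlt; apply/orP; left.
  by apply/eqP; rewrite /grad_dev_const -/C /s2 /a; field; rewrite !gt_eqF.
have ma : 0 < m ^+ 2 * a by rewrite mulr_gt0// exprn_gt0.
have -> : grad_dev_const / m ^+ 2 = grad_dev_const * a / (m ^+ 2 * a).
  by field; rewrite !gt_eqF.
have mS : measurable [set w | m ^+ 2 * a <= f w].
  by rewrite -[X in measurable X]setTI; apply: (measurable_fun_ler (measurable_cst _)).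
have ltE w : (m * Num.sqrt a < l2norm (emp_grad h 0 w - grad_mean h)) = (m ^+ 2 * a < f w).
  have -> : m ^+ 2 * a = (m * Num.sqrt a) ^+ 2 by rewrite exprMn sqr_sqrtr// ltW.
  by rewrite -fE ltr_pXn2r// nnegrE ?l2norm_ge0// mulr_ge0 ?sqrtr_ge0// ltW.
under eq_set do rewrite -/a ltE.
apply: le_trans (markov_le mf f0 ma hf); apply: le_measure; rewrite ?inE//.
  by rewrite -[X in measurable X]setTI; apply: (measurable_fun_ltr (measurable_cst _)).
by move=> w /= /ltW.
Qed.

End empirical.

(** * Uniform deviation of the empirical Hessian *)

Section grid.
Context (R : realType) (p : nat).
Implicit Types d u v : 'cV[R]_p.

Lemma l2norm_le_sum v : l2norm v <= \sum_i `|v i 0|.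
Proof.
apply: l2norm_dual; first by apply: sumr_ge0.
move=> u u1; rewrite dotpE; apply: ler_sum => i _.
apply: le_trans (ler_norm _) _; rewrite normrM ler_piMl//.
exact: le_trans (coord_le_l2norm _ _) u1.
Qed.

Lemma l2norm_le_coord u v : (forall i, `|u i 0| <= `|v i 0|) -> l2norm u <= l2norm v.
Proof.
move=> h; rewrite ler_sqrt; last by apply: sumr_ge0 => i _; exact: sqr_ge0.
apply: ler_sum => i _; rewrite -(real_normK (num_real (u i 0))) -(real_normK (num_real (v i 0))).
by rewrite lerXn2r// nnegrE.
Qed.

(** The boolean carries the sign of a coordinate. Zero has two codes, which is harmless since only
    an upper bound on the number of points is used. *)
Definition grid_point (N : nat) (g : {ffun 'I_p -> 'I_N.+1 * bool}) : 'cV[R]_p :=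
  \col_j ((-1) ^+ (g j).2 * (g j).1%:R / N%:R).

(* Coordinates are rounded towards zero, so that the grid point stays in the ball. *)
Lemma grid_pointP (N : nat) d : (0 < N)%N -> l2norm d <= 1 ->
  exists g : {ffun 'I_p -> 'I_N.+1 * bool},
    l2norm (grid_point g) <= 1 /\ l2norm (d - grid_point g) <= p%:R / N%:R.
Proof.
move=> N0 d1; have NR : 0 < N%:R :> R by rewrite ltr0n.
pose k j := Num.truncn (`|d j 0| * N%:R).
have kP j : (k j)%:R <= `|d j 0| * N%:R < (k j).+1%:R.
  by apply: truncn_itv; rewrite mulr_ge0.
have kN j : (k j < N.+1)%N.
  rewrite ltnS -(ler_nat R); have /andP[h _] := kP j; apply: le_trans h _.
  by rewrite ler_piMl// (le_trans (coord_le_l2norm _ _) d1).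
exists [ffun j => (Ordinal (kN j), d j 0 < 0)].
have sg j : (-1) ^+ (d j 0 < 0)%R * `|d j 0| = d j 0.
  have [dn|dp] := ltP (d j 0) 0.
    by rewrite expr1 ltr0_norm// mulrNN mul1r.
  by rewrite expr0 mul1r ger0_norm.
split.
  apply: le_trans d1; apply: l2norm_le_coord => j; rewrite mxE ffunE /=.
  rewrite normrM normrM normrX normrN1 expr1n mul1r normfV !normr_nat ler_pdivrMr//.
  by have /andP[] := kP j.
apply: le_trans (l2norm_le_sum _) _.
apply: (@le_trans _ _ (\sum_(j < p) N%:R^-1)); last first.
  by rewrite sumr_const card_ord -[leLHS]mulr_natl.
apply: ler_sum => j _; rewrite !mxE ffunE /= -[X in `|X - _|]sg -mulrA -mulrBr.
rewrite normrM normrX normrN1 expr1n mul1r -[`|d j 0|](@mulfK _ N%:R) ?gt_eqF//.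
rewrite -mulrBl normrM normfV normr_nat -[leRHS]mul1r ler_pM2r ?invr_gt0//.
have /andP[h1 h2] := kP j; rewrite -natr1 in h2.
by rewrite ger0_norm ?subr_ge0// lerBlDr addrC ltW.
Qed.

Lemma sqr_sum_le (a : 'I_p -> R) : (\sum_i a i) ^+ 2 <= p%:R * \sum_i a i ^+ 2.
Proof.
have := cauchy_schwarz (const_mx 1 : 'cV[R]_p) (\col_i a i).
rewrite -(@ler_pXn2r _ 2)// ?nnegrE ?mulr_ge0 ?l2norm_ge0//.
rewrite real_normK ?num_real// exprMn !sqr_l2norm !dotpE.
under [X in X ^+ 2 <= _]eq_bigr do rewrite !mxE mul1r.
under [X in _ <= X * _]eq_bigr do rewrite !mxE mul1r.
under [X in _ <= _ * X]eq_bigr do rewrite !mxE -expr2.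
by rewrite sumr_const card_ord.
Qed.

End grid.

Section hessian_lipschitz.
Context (R : realType) (alpha : nat) (H : R -> R) (K Cr CF c1 eta CZ : R).
Context (n p : nat) (M : binary_response R n p) (rho F : R -> borel_cV R p -> R).
Hypothesis hM : regular_model alpha H K Cr CF c1 eta CZ M rho F.
Local Notation P := (br_prob M).
Local Notation Z := (br_Z M).
Local Notation V := (borel_cV R p).
Local Notation obs := (R * V * R)%type.

Let Kp : 0 <= K. Proof. exact: le_trans (kb_K (rm_kernel hM)). Qed.

(** [|z|^4 <= p (z_1^4 + ... + z_p^4)] reduces the norm to one-dimensional moments. *)
Lemma norm4 : (\int[P]_w (l2norm (Z w : 'cV[R]_p) ^+ 4)%:E <=
  (p%:R ^+ 2 * (exp_const eta * CZ))%:E)%E.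
Proof.
have m4 (j : 'I_p) : measurable_fun setT (fun w => `|dotp (delta_mx j 0) (Z w)| ^+ 4).
  by apply: measurable_funX; apply: measurableT_comp => //; exact: rm_mdotp.
have mS : measurable_fun setT (fun w => \sum_j `|dotp (delta_mx j 0) (Z w)| ^+ 4).
  exact: measurable_sum.
apply: (@le_trans _ _ (\int[P]_w (p%:R * \sum_j `|dotp (delta_mx j 0) (Z w)| ^+ 4)%:E)%E).
  apply: ge0_le_integral; first exact: measurableT.
  - by move=> w _; rewrite lee_fin exprn_ge0// l2norm_ge0.
  - apply/measurable_EFinP; apply: measurable_funX.
    have m1 := @measurable_l2norm R p; have m2 := @rm_mZ R n p M.
    exact: (measurableT_comp m1 m2).
  - by apply/measurable_EFinP; exact: measurable_funM.
  move=> w _; rewrite lee_fin -[4%N]/(2 * 2)%N exprM sqr_l2norm dotpE.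
  apply: le_trans (sqr_sum_le _) _; rewrite ler_wpM2l// le_eqVlt; apply/orP; left.
  apply/eqP; apply: eq_bigr => j _; rewrite dotp_delta exprM real_normK ?num_real//.
under eq_integral do rewrite EFinM.
rewrite ge0_integralZl; [|exact: measurableT|exact/measurable_EFinP
  |by move=> w _; rewrite lee_fin sumr_ge0|by rewrite lee_fin].
have -> : (fun w => (\sum_j `|dotp (delta_mx j 0) (Z w)| ^+ 4)%:E) =
    (fun w => \sum_j (`|dotp (delta_mx j 0) (Z w)| ^+ 4)%:E)%E.
  by apply/funext => w; rewrite sumEFin.
rewrite ge0_integral_sum; [|exact: measurableT|by move=> i; exact/measurable_EFinP
    |by move=> i w _; rewrite lee_fin exprn_ge0].
rewrite expr2 -mulrA [leRHS]EFinM; apply: lee_wpmul2l => //.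
apply: (@le_trans _ _ (\sum_(j < p) (exp_const eta * CZ)%:E)%E).
  by apply: lee_sum => j _; apply: (moment_le hM) => //; rewrite l2norm_delta.
by rewrite sumEFin sumr_const card_ord lee_fin -[leLHS]mulr_natl.
Qed.

(** Telescoping over the three factors: each change costs [eps] times [|z|^2] or [|z|^3], all
    dominated by [1 + |z|^4]. The crude [h^-3] is affordable because the net will be polynomially
    fine in [n]. *)
Lemma hess_term_lip h d u u' e a a' eps v : 0 < h -> h <= 1 -> 0 <= eps ->
  l2norm u' <= 1 -> l2norm a <= 1 -> l2norm u <= 1 ->
  l2norm (d - e) <= eps -> l2norm (u - a) <= eps -> l2norm (u' - a') <= eps ->
  `|hess_term H M h d u u' v - hess_term H M h e a a' v| <=
    3 * K / h ^+ 3 * eps * (1 + l2norm (v.1.2 : 'cV[R]_p) ^+ 4).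
Proof.
move=> h0 h1 eps0 u'1 a1 u1 de ua ua'.
set z := v.1.2; set r := l2norm (z : 'cV[R]_p).
have r0 : 0 <= r := l2norm_ge0 _.
have csle (x : 'cV[R]_p) c : l2norm x <= c -> `|dotp x z| <= c * r.
  by move=> xc; apply: le_trans (cauchy_schwarz _ _) _; rewrite ler_wpM2r.
rewrite /hess_term -mulrBr normrM normrN -/z.
have -> : `|sign_pm (latent M v + v.2)| = 1.
  by rewrite /sign_pm; case: ifP => _; rewrite ?normrN normr1.
rewrite mul1r -mulrBl normrM normfV normrX (gtr0_norm h0).
set A := derive1n 2 H _; set B := derive1n 2 H _.
have AB : `|A - B| <= K / h * (eps * r).
  apply: le_trans (kb_l2 (rm_kernel hM) _ _) _.
  rewrite -mulrBl normrM normfV (gtr0_norm h0) -mulrA ler_wpM2l//.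
  rewrite mulrC ler_wpM2l ?invr_ge0 ?(ltW h0)// opprD addrACA subrr add0r -dotpBl.
  exact: csle.
have Bb : `|B| <= K := kb_b2 (rm_kernel hM) _.
have key (x y x' y' : R) : A * (x * y) - B * (x' * y') =
  (A - B) * (x * y) + B * ((x - x') * y + x' * (y - y')) by ring.
rewrite key -!dotpBl.
have hu := csle _ _ u1; have hu' := csle _ _ u'1; have ha := csle _ _ a1.
have hua := csle _ _ ua; have hua' := csle _ _ ua'; rewrite mul1r in hu hu' ha.
have n1 : `|(A - B) * (dotp u z * dotp u' z)| <= K / h * (eps * r) * (r * r).
  rewrite normrM; apply: ler_pM => //; rewrite normrM; exact: ler_pM.
have n2 : `|B * (dotp (u - a) z * dotp u' z + dotp a z * dotp (u' - a') z)| <=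
    K * (eps * r * r + r * (eps * r)).
  rewrite normrM; apply: ler_pM => //; apply: le_trans (ler_normD _ _) _.
  by rewrite !normrM; apply: lerD; exact: ler_pM.
have n12 := le_trans (ler_normD _ _) (lerD n1 n2).
rewrite ler_pdivrMr ?exprn_gt0//; apply: (le_trans n12).
have r3 : r ^+ 3 <= 1 + r ^+ 4.
  have [r1|r1] := leP r 1; first by apply: le_trans (exprn_ile1 _ r0 r1) _; rewrite lerDl exprn_ge0.
  by rewrite [r ^+ 4]exprS -[leLHS]mul1r ler_wpDl// ler_wpM2r ?exprn_ge0// ltW.
have r2 : r ^+ 2 <= 1 + r ^+ 4.
  have := sqr_ge0 (r ^+ 2 - 1); have := sqr_ge0 r; rewrite sqrrB -exprM => ? ?; lra.
have hi : 1 <= h^-1 by rewrite invr_ge1// unitf_gt0.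
have -> : 3 * K / h ^+ 3 * eps * (1 + r ^+ 4) * h ^+ 2 = 3 * (K * eps * h^-1 * (1 + r ^+ 4)).
  by field; rewrite gt_eqF.
have -> : K / h * (eps * r) * (r * r) = K * eps * h^-1 * r ^+ 3 by ring.
have -> : K * (eps * r * r + r * (eps * r)) = 2 * (K * eps * 1 * r ^+ 2) by ring.
have ke : 0 <= K * eps by rewrite mulr_ge0.
have q1 : K * eps * h^-1 * r ^+ 3 <= K * eps * h^-1 * (1 + r ^+ 4).
  by rewrite ler_wpM2l// mulr_ge0// invr_ge0 ltW.
have q2 : K * eps * 1 * r ^+ 2 <= K * eps * h^-1 * (1 + r ^+ 4).
  apply: ler_pM => //; rewrite ?mulr_ge0 ?sqr_ge0//; exact: ler_wpM2l.
lra.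
Qed.

End hessian_lipschitz.

Lemma union_bound d (T : measurableType d) (R : realType) (P : probability T R)
    (I : finType) (A : I -> set T) (c : R) :
  (forall i, measurable (A i)) -> (forall i, (P (A i) <= c%:E)%E) ->
  exists B, [/\ measurable B, (P B <= (#|I|%:R * c)%:E)%E & forall i, A i `<=` B].
Proof.
move=> mA hA.
suff [B [mB PB hB]] : exists B, [/\ measurable B, (P B <= ((size (enum I))%:R * c)%:E)%E &
    forall i, i \in enum I -> A i `<=` B].
  by exists B; split=> //; [rewrite cardE|move=> i; apply: hB; rewrite mem_enum].
elim: (enum I) => [|i s [B [mB PB hB]]].
  by exists set0; split=> //; rewrite measure0 mul0r.
exists (A i `|` B); split=> [||j].
- exact: measurableU.
- apply: le_trans (measureU2 _ (mA i) mB) _.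
  by rewrite /= -nat1r mulrDl mul1r EFinD; exact: leeD.
- rewrite inE => /orP[/eqP ->|/hB h]; first by move=> w; left.
  by move=> w /h; right.
Qed.

Section hessian_deviation.
Context (R : realType) (alpha : nat) (H : R -> R) (K Cr CF c1 eta CZ : R).
Context (n p : nat) (M : binary_response R n p) (rho F : R -> borel_cV R p -> R).
Hypothesis hM : regular_model alpha H K Cr CF c1 eta CZ M rho F.
Local Notation P := (br_prob M).
Local Notation Z := (br_Z M).
Local Notation V := (borel_cV R p).
Local Notation obs := (R * V * R)%type.
Local Notation W := (@obs_at R n p M).
Local Notation W0 := (@obs0 R n p M).

Let Kp : 0 < K. Proof. exact: lt_le_trans (kb_K (rm_kernel hM)). Qed.
Let CZ0 : 0 <= CZ. Proof. exact: le_trans (rm_CZ hM). Qed.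
Let hind := (rm_iid hM).1.
Let hid := (rm_iid hM).2.
Let C := hess_mgf_const K Cr eta CZ.
Let C0 : 0 <= C.
Proof.
have c0 := exp_const_ge0 (divr_gt0 (rm_eta hM) (ltr0Sn _ 7) : 0 < eta / 8).
rewrite /C /hess_mgf_const; apply: mulr_ge0 => //; apply: mulr_ge0 (rm_Cr hM).
by apply: mulr_ge0 (sqr_ge0 _); apply: mulr_ge0 (sqr_ge0 _).
Qed.

Let q : R := p%:R * ln n%:R.
Let rate h : R := Num.sqrt (q / (n%:R * h ^+ 3)).

(** Chernoff's bound with [l = sqrt(q h^3/n)]: the exponent then consists of [C q] from the second
    moment and [- k q] from the threshold. The lower bound on [n h] ensures [l <= eta h^2/(4 K)]. *)
Lemma hess_tail k h d u u' : 0 < h -> (0 < n)%N -> 0 < q ->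
  16 * K ^+ 2 / eta ^+ 2 * q <= n%:R * h -> l2norm u <= 1 -> l2norm u' <= 1 ->
  (P [set w | n%:R * (k * rate h) <= `|centered_sum P W W0 (hess_term H M h d u u') w|]%R
    <= (2 * expR ((C - k) * q))%:E)%E.
Proof.
move=> h0 n0 q0 hq u1 u1'; have e0 := rm_eta hM.
have nR : 0 < n%:R :> R by rewrite ltr0n.
have h3 : 0 < h ^+ 3 by rewrite exprn_gt0.
pose l := Num.sqrt (q * h ^+ 3 / n%:R).
have lp : 0 < q * h ^+ 3 / n%:R by rewrite divr_gt0// mulr_gt0.
have := iid_tail (@measurable_obs_at _ _ _ M) (@measurable_obs0 R n p M) hind hid
  (measurable_hess_term hM h d u u') (integrable_hess_term hM d h0 u1 u1')
  (hess_mgf hM d h0 u1 u1') (l := l) (k * rate h).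
have -> : n%:R * l ^+ 2 * (hess_mgf_const K Cr eta CZ / h ^+ 3) - l * (n%:R * (k * rate h)) =
    (C - k) * q.
  have -> : l * (n%:R * (k * rate h)) = n%:R * k * (l * rate h) by ring.
  rewrite /rate -sqrtrM ?(ltW lp)//.
  have -> : q * h ^+ 3 / n%:R * (q / (n%:R * h ^+ 3)) = (q / n%:R) ^+ 2.
    by field; rewrite !gt_eqF.
  rewrite sqrtr_sqr ger0_norm ?divr_ge0 ?(ltW q0)// sqr_sqrtr ?(ltW lp)// -/C.
  by field; rewrite !gt_eqF.
apply; rewrite sqrtr_gt0 lp/=.
have l0 : 0 < eta * h ^+ 2 / (4 * K) by rewrite divr_gt0// mulr_gt0// exprn_gt0.
rewrite -[leRHS]ger0_norm ?(ltW l0)// -sqrtr_sqr ler_sqrt ?sqr_ge0//.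
rewrite ler_pdivrMr//.
have -> : (eta * h ^+ 2 / (4 * K)) ^+ 2 * n%:R =
    h ^+ 3 * ((16 * K ^+ 2 / eta ^+ 2)^-1 * (n%:R * h)) by field; rewrite !gt_eqF.
rewrite mulrC ler_pM2l// mulrC ler_pdivlMr ?divr_gt0 ?mulr_gt0 ?exprn_gt0//.
by rewrite mulrC.
Qed.

Let c4 := exp_const eta * CZ.
Let c40 : 0 <= c4. Proof. by rewrite mulr_ge0// exp_const_ge0// (rm_eta hM). Qed.
Let g (v : obs) : R := 1 + l2norm (v.1.2 : 'cV[R]_p) ^+ 4.
Let mg : measurable_fun setT g.
Proof.
apply: measurable_funD => //; apply: measurable_funX.
have m1 := @measurable_l2norm R p.
have m2 : measurable_fun setT (fun v : obs => v.1.2).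
  by apply: measurableT_comp => //; exact: measurable_snd.
exact: (measurableT_comp m1 m2).
Qed.
Let g0 v : 0 <= g v. Proof. by rewrite addr_ge0// exprn_ge0// l2norm_ge0. Qed.
Let Eg : (\int[P]_w (g (W0 w))%:E <= (1 + p%:R ^+ 2 * c4)%:E)%E.
Proof.
under eq_integral do rewrite EFinD.
rewrite ge0_integralD; [|exact: measurableT|by []|exact: measurable_cst
  |by move=> w _; rewrite lee_fin exprn_ge0// l2norm_ge0|].
  rewrite EFinD; apply: leeD; last exact: (norm4 hM).
  by rewrite integral_cst//= probability_setT mule1.
apply/measurable_EFinP; apply: measurable_funX.
have m1 := @measurable_l2norm R p; have m2 := @rm_mZ R n p M.
exact: (measurableT_comp m1 m2).
Qed.

(** [C + 31] accounts for the points of the net and the rest for the passage from the net to the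
    ball. *)
Definition hess_dev_const := C + 31 + 6 * K * (1 + c4).

(** A net for the displacement and the two directions has at most [e^(30 q)] triples, against a tail
    of [2 e^(-31 q)] for each. Between net points the summands are Lipschitz with random constant
    [1 + |z_i|^4], whose sum is at most [n^2 c5] outside an event of probability [1/n]. The two
    failures add up to [3/n]. *)
Lemma hess_uniform h : 0 < h -> h <= 1 -> n%:R^-1 <= h -> (p <= n)%N ->
  1 <= ln (n%:R : R) -> 16 * K ^+ 2 / eta ^+ 2 * q <= n%:R * h ->
  exists A, [/\ measurable A, (P A <= (3 / n%:R)%:E)%E &
    forall w, ~ A w -> forall d u u', l2norm d <= 1 -> l2norm u <= 1 -> l2norm u' <= 1 ->
      `|dotp u (emp_hess H h d w *m u') - \int[P]_w hess_term H M h d u u' (W0 w)|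
      <= hess_dev_const * rate h].
Proof.
move=> h0 h1 nh pn ln1 hq.
have p0 := rm_p hM; have n0 : (0 < n)%N by exact: leq_trans p0 pn.
have nR : 0 < n%:R :> R by rewrite ltr0n.
have pR : 1 <= p%:R :> R by rewrite ler1n.
have n2 : (2 <= n)%N.
  have := expR_ge1Dx (ln (n%:R : R)); rewrite lnK ?posrE// -(ler_nat R).
  by move: ln1; move: (ln _) => x; lra.
have lq : ln n%:R <= q by rewrite /q ler_peMl// (le_trans ler01).
have q1 : 1 <= q := le_trans ln1 lq.
have q0 : 0 < q := lt_le_trans ltr01 q1.
have h3 : 0 < h ^+ 3 by rewrite exprn_gt0.
(* The discretisation error is at most a constant times [n^7 / N]; the power 8 makes it [O(1/n)],
   below the target rate. *)
pose N := (n ^ 8)%N.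
have N0 : (0 < N)%N by rewrite expn_gt0 n0.
pose G := {ffun 'I_p -> 'I_N.+1 * bool}.
pose pt (x : G) : 'cV[R]_p := grid_point R x.
pose cs d u u' w := centered_sum P W W0 (hess_term H M h d u u') w.
(* The tail bound asks for directions in the unit ball; triples with other directions get the empty
   event. *)
pose A1 (i : G * G * G) : set (br_space M) :=
  if (l2norm (pt i.1.2) <= 1) && (l2norm (pt i.2) <= 1) then
    [set w | n%:R * ((C + 31) * rate h) <= `|cs (pt i.1.1) (pt i.1.2) (pt i.2) w|]
  else set0.
have mcs d u u' : measurable_fun setT (cs d u u').
  exact: (measurable_centered_sum _ _ (@measurable_obs_at _ _ _ M) (measurable_hess_term hM _ _ _ _)).
have mA1 i : measurable (A1 i).
  rewrite /A1; case: ifP => // _; rewrite -[X in measurable X]setTI.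
  by apply: (measurable_fun_ler (measurable_cst _)) => //; exact: measurableT_comp.
have hA1 i : (P (A1 i) <= (2 * expR (- (31 * q)))%:E)%E.
  rewrite /A1; case: ifP => [/andP[u1 u1']|_]; last first.
    by rewrite measure0 lee_fin mulr_ge0// expR_ge0.
  apply: le_trans (hess_tail _ _ h0 n0 q0 hq u1 u1') _.
  rewrite lee_fin ler_pM2l// ler_expR le_eqVlt; apply/orP; left.
  by apply/eqP; ring.
have [B [mB PB hB]] := union_bound mA1 hA1.
pose S w := \sum_i g (W i w).
have mS : measurable_fun setT S.
  by apply: measurable_sum => i; exact: (measurableT_comp mg (measurable_obs_at i)).
have S0 w : 0 <= S w by apply: sumr_ge0.
pose c5 := 1 + p%:R ^+ 2 * c4.
have c50 : 0 < c5 by rewrite ltr_wpDr// mulr_ge0// sqr_ge0.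
have ES : (\int[P]_w (S w)%:E <= (n%:R * c5)%:E)%E.
  have -> : (fun w => (S w)%:E) = (fun w => \sum_i (g (W i w))%:E)%E.
    by apply/funext => w; rewrite sumEFin.
  rewrite ge0_integral_sum; [|exact: measurableT
    |by move=> i; apply/measurable_EFinP; exact: (measurableT_comp mg (measurable_obs_at i))
    |by move=> i w _; rewrite lee_fin].
  apply: (@le_trans _ _ (\sum_(i < n) c5%:E)%E).
    apply: lee_sum => i _.
    by rewrite (identically_distributed_integral (@measurable_obs_at _ _ _ M)
      (@measurable_obs0 R n p M) hid i mg).
  by rewrite sumEFin sumr_const card_ord lee_fin -[leLHS]mulr_natl.
(* The level is [n] times the bound on the mean, so Markov's inequality gives probability at most
   [1/n]. *)
pose D := [set w | n%:R ^+ 2 * c5 <= S w].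
have mD : measurable D.
  by rewrite -[X in measurable X]setTI; apply: (measurable_fun_ler (measurable_cst _)).
have PD : (P D <= (n%:R^-1)%:E)%E.
  apply: le_trans (markov_le mS S0 _ ES) _; first by rewrite mulr_gt0// exprn_gt0.
  by rewrite lee_fin le_eqVlt; apply/orP; left; apply/eqP; field; rewrite !gt_eqF.
exists (B `|` D); split; first exact: measurableU.
  apply: le_trans (measureU2 _ mB mD) _.
  apply: (@le_trans _ _ ((2 / n%:R)%:E + (n%:R^-1)%:E)%E); last first.
    by rewrite -EFinD lee_fin -[X in _ + X]mul1r -mulrDl (_ : 2 + 1 = 3 :> R)//; ring.
  apply: leeD => //; apply: le_trans PB _; rewrite lee_fin.
  (* Each coordinate has [2 (n^8 + 1) <= n^10] choices because [n >= 2]; there are [3 p] coordinates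
     and [q = p log n]. *)
  have cG : #|{: G * G * G}|%:R <= expR (30 * q) :> R.
    rewrite !card_prod card_ffun !card_prod card_bool !card_ord.
    have N10 : (N.+1 * 2)%:R <= (n%:R : R) ^+ 10.
      rewrite -natrX ler_nat; apply: (@leq_trans (N * 2 * 2)).
        by rewrite leq_mul2r/= muln2 -addnn -addn1 leq_add2l.
      rewrite -mulnA /N (_ : (n ^ 10 = n ^ 8 * (n * n))%N) ?leq_mul//.
      by rewrite mulnn -expnD.
    rewrite natrM natrM natrX.
    have -> : expR (30 * q) = ((n%:R : R) ^+ 10) ^+ p * (n%:R ^+ 10) ^+ p * (n%:R ^+ 10) ^+ p.
      have -> : n%:R ^+ 10 = expR (10 * ln n%:R) :> R by rewrite expRM_natl lnK.
      rewrite -!expRM_natl -!expRD; congr expR; rewrite /q; ring.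
    have hp10 : ((N.+1 * 2)%:R : R) ^+ p <= (n%:R ^+ 10) ^+ p.
      by rewrite lerXn2r// nnegrE ?exprn_ge0.
    by apply: ler_pM => //; apply: ler_pM.
  apply: (@le_trans _ _ (expR (30 * q) * (2 * expR (- (31 * q))))).
    by rewrite ler_wpM2r// mulr_ge0// expR_ge0.
  rewrite mulrCA -expRD ler_pM2l//.
  have -> : 30 * q + - (31 * q) = - q by ring.
  by rewrite expRN lef_pV2 ?posrE ?expR_gt0// -[leLHS]lnK ?posrE// ler_expR.
move=> w nBD d u u' d1 u1 u1'.
have nB : ~ B w by move=> ?; apply: nBD; left.
have SD : S w <= n%:R ^+ 2 * c5.
  by apply: contrapT => /negP; rewrite -ltNge => /ltW ?; apply: nBD; right.
have [gd [gd1 gd2]] := grid_pointP N0 d1.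
have [gu [gu1 gu2]] := grid_pointP N0 u1.
have [gu' [gu'1 gu'2]] := grid_pointP N0 u1'.
have heart : `|cs (pt gd) (pt gu) (pt gu') w| < n%:R * ((C + 31) * rate h).
  rewrite ltNge; apply/negP => hge; apply: nB; apply: (hB (gd, gu, gu')).
  by rewrite /A1/= gu1 gu'1/=.
set e := p%:R / N%:R in gd2 gu2 gu'2.
have e0 : 0 <= e by rewrite divr_ge0.
have lip v := hess_term_lip hM v h0 h1 e0 u1' gu1 u1 gd2 gu2 gu'2.
set k3 := 3 * K / h ^+ 3 * e in lip.
have k30 : 0 <= k3 by rewrite mulr_ge0// divr_ge0 ?mulr_ge0// ltW.
have k3c : k3 * c5 <= k3 * n%:R * c5.
  by rewrite ler_wpM2r ?(ltW c50)// ler_peMr// ler1n.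
rewrite dotp_emp_hess.
set t := hess_term H M h d u u' in lip *; set t' := hess_term H M h _ _ _ in lip.
have b1 : `|n%:R^-1 * (\sum_i t (W i w)) - n%:R^-1 * (\sum_i t' (W i w))| <= k3 * n%:R * c5.
  rewrite -mulrBr normrM gtr0_norm ?invr_gt0// -sumrB mulrC ler_pdivrMr//.
  apply: le_trans (ler_norm_sum _ _ _) _.
  apply: (@le_trans _ _ (k3 * S w)); first by rewrite mulr_sumr; apply: ler_sum => i _; exact: lip.
  have -> : k3 * n%:R * c5 * n%:R = k3 * (n%:R ^+ 2 * c5) by ring.
  exact: ler_wpM2l.
have it : P.-integrable setT (EFin \o (fun w => t (W0 w))) by exact: (integrable_hess_term hM).
have it' : P.-integrable setT (EFin \o (fun w => t' (W0 w))) by exact: (integrable_hess_term hM).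
have b2 : `|\int[P]_w t (W0 w) - \int[P]_w t' (W0 w)| <= k3 * c5.
  rewrite -RintegralB//.
  have itt : P.-integrable setT (EFin \o (fun w => t (W0 w) - t' (W0 w))).
    have := integrableB measurableT it it'.
    by congr (P.-integrable _ _); apply/funext => v /=; rewrite EFinB.
  have mtt : measurable_fun setT (fun w => t (W0 w) - t' (W0 w)).
    by apply/measurable_EFinP; exact: (measurable_int _ itt).
  have mgW : measurable_fun setT (fun w => g (W0 w)).
    have m2 := @measurable_obs0 R n p M; exact: (measurableT_comp mg m2).
  apply: le_trans (le_normr_Rintegral measurableT itt) _.
  apply: Rintegral_le => //; first exact: measurableT_comp.
  apply: (@le_trans _ _ (\int[P]_w (k3 * g (W0 w))%:E)%E).
    apply: ge0_le_integral; first exact: measurableT.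
    - by move=> v _; rewrite lee_fin.
    - by apply/measurable_EFinP; exact: measurableT_comp.
    - by apply/measurable_EFinP; exact: measurable_funM.
    - by move=> v _; rewrite lee_fin; exact: lip.
  under eq_integral do rewrite EFinM.
  rewrite ge0_integralZl; [|exact: measurableT|exact/measurable_EFinP
    |by move=> v _; rewrite lee_fin|by rewrite lee_fin].
  by rewrite [leRHS]EFinM; apply: lee_wpmul2l => //; rewrite lee_fin.
have b3 : `|n%:R^-1 * (\sum_i t' (W i w)) - \int[P]_w t' (W0 w)| <= (C + 31) * rate h.
  have -> : n%:R^-1 * (\sum_i t' (W i w)) - \int[P]_w t' (W0 w) =
      n%:R^-1 * cs (pt gd) (pt gu) (pt gu') w.
    rewrite /cs /centered_sum sumrB sumr_const card_ord mulrBr -[X in _ = _ - _ * X]mulr_natl.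
    by rewrite mulKf// gt_eqF.
  by rewrite normrM gtr0_norm ?invr_gt0// mulrC ler_pdivrMr// mulrC ltW.
have b4 : k3 * n%:R * c5 * 2 <= 6 * K * (1 + c4) * rate h.
  have hi : h^-1 <= n%:R by rewrite -[leRHS]invrK lef_pV2 ?posrE ?invr_gt0.
  have h3i : (h ^+ 3)^-1 <= n%:R ^+ 3.
    by rewrite -exprVn lerXn2r// nnegrE ?invr_ge0 ltW.
  have pn' : p%:R <= n%:R :> R by rewrite ler_nat.
  have c5n : c5 <= n%:R ^+ 2 * (1 + c4).
    rewrite mulrDr mulr1; apply: lerD; first by rewrite exprn_ege1// ler1n.
    by rewrite ler_wpM2r// lerXn2r// nnegrE.
  have rn : n%:R^-1 <= rate h.
    rewrite -[leLHS]ger0_norm ?invr_ge0// -sqrtr_sqr ler_sqrt; last first.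
      exact: divr_ge0 (ltW q0) (mulr_ge0 (ltW nR) (ltW h3)).
    have nh3 : 0 < n%:R * h ^+ 3 by rewrite mulr_gt0.
    apply: (@le_trans _ _ (1 * (n%:R * h ^+ 3)^-1)); last first.
      by apply: ler_wpM2r q1; rewrite invr_ge0 ltW.
    rewrite mul1r exprVn lef_pV2 ?posrE ?mulr_gt0 ?exprn_gt0// expr2 ler_pM2l//.
    apply: (@le_trans _ _ 1); first by rewrite exprn_ile1// ltW.
    by rewrite ler1n.
  have NE : N%:R = n%:R ^+ 8 :> R by rewrite natrX.
  apply: (@le_trans _ _ (6 * K * (1 + c4) * n%:R^-1)); last first.
    by rewrite ler_wpM2l// !mulr_ge0 ?(ltW Kp)// addr_ge0.
  apply: (@le_trans _ _ (6 * K * (n%:R ^+ 3 * (n%:R / N%:R) * n%:R * (n%:R ^+ 2 * (1 + c4))))).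
    have -> : k3 * n%:R * c5 * 2 = 6 * K * ((h ^+ 3)^-1 * (p%:R / N%:R) * n%:R * c5).
      by rewrite /k3 /e; field; rewrite !gt_eqF// ltr0n.
    have Ni : 0 <= (N%:R)^-1 :> R by rewrite invr_ge0.
    have hi0 : 0 <= (h ^+ 3)^-1 by rewrite invr_ge0 ltW.
    apply: ler_wpM2l; first by rewrite mulr_ge0// ltW.
    apply: ler_pM => //; rewrite ?(ltW c50)//; first by rewrite !mulr_ge0.
    apply: ler_wpM2r => //; apply: ler_pM => //.
    exact: ler_wpM2r.
  rewrite NE le_eqVlt; apply/orP; left; apply/eqP.
  by field; rewrite gt_eqF.
have -> : hess_dev_const * rate h = (C + 31) * rate h + 6 * K * (1 + c4) * rate h.
  by rewrite /hess_dev_const; ring.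
rewrite distrC in b2.
have tri (x x' y' y B1 B2 B3 : R) : `|x - x'| <= B1 -> `|y' - y| <= B2 -> `|x' - y'| <= B3 ->
    `|x - y| <= B3 + (B1 + B2).
  move=> r1 r2 r3; have -> : x - y = (x' - y') + ((x - x') + (y' - y)) by ring.
  apply: le_trans (ler_normD _ _) _; apply: lerD => //.
  by apply: le_trans (ler_normD _ _) _; exact: lerD.
apply: le_trans (tri _ _ _ _ _ _ _ b1 b2 b3) _; rewrite lerD2l; apply: le_trans b4.
by move: k3c; move: (k3 * c5) (k3 * _ * c5) => x y; lra.
Qed.

End hessian_deviation.

(** * One deterministic Newton step *)

Lemma is_derive_line (R : realType) (p : nat) (f : 'cV[R]_p -> R) (b v : 'cV[R]_p) (s a : R) :
  is_derive (b + s *: v) v f a -> is_derive s (1 : R) (fun t : R => f (b + t *: v)) a.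
Proof.
have E : (fun t : R => t^-1 *: ((f \o shift (b + s *: v)) (t *: v) - f (b + s *: v))) =
   (fun t : R => t^-1 *: (((fun t : R => f (b + t *: v)) \o shift s) (t *: (1 : R))
      - f (b + s *: v))).
  apply/funext => t /=; congr (_ *: (f _ - _)).
  by rewrite [t *: 1]mulr1 scalerDl addrCA.
case=> d1 d2; split; first by rewrite /derivable -E.
by rewrite /derive -E -/(derive _ _ _) d2.
Qed.

Section newton.
Context (R : realType) (n p : nat) (H : R -> R) (y x : 'I_n -> R) (z : 'I_n -> 'cV[R]_p).
Context (h : R) (beta : 'cV[R]_p) (E : 'cV[R]_p -> 'cV[R]_p -> 'cV[R]_p -> R) (V : 'M[R]_p).
Context (c D L : R).
Hypothesis dH : forall t, derivable (derive1 H) t 1.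
Hypotheses (c0 : 0 < c) (D0 : 0 <= D) (L0 : 0 <= L).
Let W (d : 'cV[R]_p) : 'M[R]_p := sms_hess H y x z h (beta + d).
Let G (d : 'cV[R]_p) : 'cV[R]_p := sms_grad H y x z h (beta + d).
Hypothesis WE : forall d u u', l2norm d <= 1 -> l2norm u <= 1 -> l2norm u' <= 1 ->
  `|dotp u (W d *m u') - E d u u'| <= D.
Hypothesis Elip : forall d d' u u', l2norm u <= 1 -> l2norm u' <= 1 ->
  `|E d u u' - E d' u u'| <= L * l2norm (d - d').
Hypothesis EV : forall u u', l2norm u <= 1 -> l2norm u' <= 1 ->
  `|E 0 u u' - dotp u (V *m u')| <= L * h.
Hypothesis Vge : forall u, c * dotp u u <= dotp u (V *m u).

(** The new error is [W(d)^-1 (W(d) d - G(d))]. Closeness to [V] makes [W(d)] coercive with constant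
    [c/2]. Tested against [u], [G(d) - G(0)] equals [W(xi d) d], so the bracket is
    [(W(d) - W(xi d)) d - G(0)]; two deviations [D] and the Lipschitz bound on [E] control the first
    term. *)
Lemma newton_step_bound d : l2norm d <= 1 -> D + L * (l2norm d + h) <= c / 2 ->
  l2norm (newton_step H y x z h (beta + d) - beta) <=
    2 / c * (l2norm (G 0) + l2norm d * (2 * (D + L * l2norm d))).
Proof.
move=> d1 hc; set r := l2norm d in d1 hc *.
have unit_dir (u : 'cV[R]_p) : exists e, l2norm e <= 1 /\ u = l2norm u *: e.
  have [u0|un0] := eqVneq (l2norm u) 0.
    exists 0; split; last by rewrite (l2norm0_eq0 u0) scaler0.
    by rewrite /l2norm big1 ?sqrtr0// => i _; rewrite mxE expr0n.
  exists ((l2norm u)^-1 *: u); split; last by rewrite scalerA divff// scale1r.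
  by rewrite l2normZ ger0_norm ?invr_ge0 ?l2norm_ge0// mulVf.
have dVle u : l2norm u <= 1 -> dotp u (V *m u) - c / 2 <= dotp u (W d *m u).
  move=> u1; have h1 := WE d1 u1 u1; have h2 := Elip d 0 u1 u1; have h3 := EV u1 u1.
  rewrite subr0 -/r in h2; move: h1 h2 h3 hc; rewrite !ler_norml mulrDr.
  by move=> /andP[a1 a2] /andP[b1 b2] /andP[e1 e2] q; lra.
have coer u : c / 2 * l2norm u ^+ 2 <= dotp u (W d *m u).
  have [u0|un0] := eqVneq (l2norm u) 0.
    by rewrite u0 (l2norm0_eq0 u0) mulmx0 dotp0r expr0n mulr0.
  have [e [e1 ue]] := unit_dir u.
  have ee : dotp e e = 1.
    have un2 : l2norm u ^+ 2 != 0 by rewrite expf_neq0.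
    apply: (mulfI un2); rewrite mulr1 [RHS]sqr_l2norm [in RHS]ue dotpZl dotpZr.
    by rewrite mulrA -expr2.
  have We : c / 2 <= dotp e (W d *m e).
    by have := dVle _ e1; have := Vge e; rewrite ee => v1 v2; lra.
  have -> : dotp u (W d *m u) = dotp e (W d *m e) * l2norm u ^+ 2.
    by rewrite [in LHS]ue -scalemxAr dotpZl dotpZr expr2; ring.
  by rewrite ler_wpM2r ?sqr_ge0.
have [uW iW] := coercive_inverse (divr_gt0 c0 (ltr0Sn R 1)) coer.
have -> : newton_step H y x z h (beta + d) - beta = invmx (W d) *m (W d *m d - G d).
  rewrite mulmxBr (mulKmx uW).
  have key (b d' g : 'cV[R]_p) : b + d' - g - b = d' - g.
    by rewrite addrAC [b + d']addrC addrK.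
  exact: key.
apply: le_trans (iW _) _; rewrite invf_div ler_wpM2l// ?divr_ge0// ?(ltW c0)//.
have [e [e1 de]] := unit_dir d; rewrite -/r in de.
have r0 : 0 <= r := l2norm_ge0 d.
apply: l2norm_dual.
  by rewrite addr_ge0 ?l2norm_ge0// mulr_ge0// mulr_ge0// addr_ge0// mulr_ge0.
move=> u u1; rewrite dotpBr.
have dG s : is_derive s (1 : R) (fun s => dotp u (G (s *: d))) (dotp u (W (s *: d) *m d)).
  apply: (@is_derive_line _ _ (fun b => dotp u (sms_grad H y x z h b)) beta d).
  exact: sms_hessP.
(* The intermediate point depends on [u], which is harmless since the estimates on [W] hold on the
   whole ball. *)
have [xi] := @mvt_between R (fun s => dotp u (G (s *: d))) 0 1 (fun s => @ex_derive _ _ _ _ _ _ _ (dG s)).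
have -> : derive1 (fun s => dotp u (G (s *: d))) xi = dotp u (W (xi *: d) *m d).
  by rewrite derive1E (@derive_val _ _ _ _ _ _ _ (dG xi)).
rewrite !subr0 mulr1 scale1r scale0r normr1 => mvt xi1.
have xid : l2norm (xi *: d) <= 1 by rewrite l2normZ mulr_ile1// ?l2norm_ge0.
have Wd (d' : 'cV[R]_p) : dotp u (W d' *m d) = r * dotp u (W d' *m e).
  by rewrite {1}de -scalemxAr dotpZr.
have h1 := WE d1 u1 e1; have h2 := WE xid u1 e1; have h3 := Elip d (xi *: d) u1 e1.
(* Only [|xi| <= 1] is known from the mean value lemma, hence the factor 2. *)
have h4 : l2norm (d - xi *: d) <= 2 * r.
  rewrite -{1}[d]scale1r -scalerBl l2normZ ler_wpM2r//.
  by apply: le_trans (ler_normB _ _) _; rewrite normr1 -[2%:R]/(1 + 1) lerD2l.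
have h5 := le_trans h3 (ler_wpM2l L0 h4).
have h6 : `|dotp u (W d *m e) - dotp u (W (xi *: d) *m e)| <= 2 * (D + L * r).
  have tri (a a' b b' B : R) : `|a - b| <= D -> `|a' - b'| <= D -> `|b - b'| <= B ->
      `|a - a'| <= 2 * D + B.
    rewrite !ler_norml => /andP[? ?] /andP[? ?] /andP[? ?].
    by apply/andP; split; lra.
  have -> : 2 * (D + L * r) = 2 * D + L * (2 * r) by ring.
  exact: tri h1 h2 h5.
have -> : dotp u (W d *m d) - dotp u (G d) =
    r * (dotp u (W d *m e) - dotp u (W (xi *: d) *m e)) - dotp u (G 0).
  have key (a b g g0 s s' : R) : a = r * s -> b = r * s' -> g - g0 = b ->
      a - g = r * (s - s') - g0.
    by move=> -> eb gg; rewrite mulrBr -eb -gg; ring.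
  exact: key (Wd _) (Wd _) mvt.
apply: le_trans (ler_norm _) _; apply: le_trans (ler_normB _ _) _; rewrite addrC; apply: lerD.
  by apply: le_trans (cauchy_schwarz _ _) _; rewrite ler_piMl// ?l2norm_ge0.
by rewrite normrM (ger0_norm r0) ler_wpM2l.
Qed.

End newton.

(** * Measurability of the iterates *)

Section measurable_matrices.
Context d (T : measurableType d) (R : realType).

(** The inverse is written with a real power of the nonnegative [f^2]; where [f] vanishes both
    expressions are 0. *)
Lemma measurable_fun_invr (f : T -> R) : measurable_fun setT f ->
  measurable_fun setT (fun w => (f w)^-1).
Proof.
move=> mf; have -> : (fun w => (f w)^-1) = (fun w => f w * (f w ^+ 2) `^ (-1)).
  apply/funext => w; rewrite powR_inv1 ?sqr_ge0//.
  have [->|f0] := eqVneq (f w) 0; first by rewrite invr0 mul0r.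
  by field.
apply: measurable_funM => //.
have mX : measurable_fun setT (fun w => f w ^+ 2) by exact: measurable_funX.
exact: (measurableT_comp (measurable_powR (-1)) mX).
Qed.

Definition measurable_mx (q r : nat) (A : T -> 'M[R]_(q, r)) :=
  forall i j, measurable_fun setT (fun w => A w i j).

Lemma measurable_det (q : nat) (A : T -> 'M[R]_q) : measurable_mx A ->
  measurable_fun setT (fun w => \det (A w)).
Proof.
move=> mA; apply: measurable_sum => s; apply: measurable_funM => //.
by apply: measurable_prod => i _; exact: mA.
Qed.

Lemma measurable_invmx (q : nat) (A : T -> 'M[R]_q) : measurable_mx A ->
  measurable_mx (fun w => invmx (A w)).
Proof.
move=> mA i j; have md := measurable_det mA.
(* By convention [invmx] returns the matrix itself when it is singular, hence the case distinction
   on the determinant. *)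
have -> : (fun w => invmx (A w) i j) =
    (fun w => if \det (A w) == 0 then A w i j else (\det (A w))^-1 * cofactor (A w) j i).
  apply/funext => w; rewrite /invmx unitmxE unitfE.
  by case: eqVneq => // _; rewrite !mxE.
apply: measurable_fun_ifT.
- exact: measurable_fun_eqr.
- exact: mA.
- apply: measurable_funM; first exact: measurable_fun_invr.
  apply: measurable_funM => //; apply: measurable_det => k l.
  by under eq_fun do rewrite !mxE; exact: mA.
Qed.

Lemma measurable_mulmx (q r s : nat) (A : T -> 'M[R]_(q, r)) (B : T -> 'M[R]_(r, s)) :
  measurable_mx A -> measurable_mx B -> measurable_mx (fun w => A w *m B w).
Proof.
move=> mA mB i j; under eq_fun do rewrite mxE.
by apply: measurable_sum => k; apply: measurable_funM; [exact: mA|exact: mB].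
Qed.

Lemma measurable_mxB (q r : nat) (A B : T -> 'M[R]_(q, r)) :
  measurable_mx A -> measurable_mx B -> measurable_mx (fun w => A w - B w).
Proof.
move=> mA mB i j; under eq_fun do rewrite !mxE.
by apply: measurable_funB; [exact: mA|exact: mB].
Qed.

Lemma measurable_l2norm_mx (q : nat) (f : T -> 'cV[R]_q) : measurable_mx f ->
  measurable_fun setT (fun w => l2norm (f w)).
Proof.
move=> mf; apply: (measurableT_comp (f := @Num.sqrt R)).
  by apply: continuous_measurable_fun; exact: sqrt_continuous.
by apply: measurable_sum => i; apply: measurable_funX; exact: mf.
Qed.

Lemma measurable_dotp_mx (q : nat) (f g : T -> 'cV[R]_q) :
  measurable_mx f -> measurable_mx g -> measurable_fun setT (fun w => dotp (f w) (g w)).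
Proof.
move=> mf mg; under eq_fun do rewrite dotpE.
by apply: measurable_sum => i; apply: measurable_funM; [exact: mf|exact: mg].
Qed.

End measurable_matrices.

Section measurable_estimator.
Context (R : realType) (n p : nat) (M : binary_response R n p) (H : R -> R).
Hypotheses (cdH : continuous (derive1 H)) (cddH : continuous (derive1n 2 H)).

Let mzs i : measurable_mx (fun w : br_space M => br_zs M i w : 'cV[R]_p).
Proof.
move=> j k; rewrite [k]ord1; have m1 := @measurable_coord R p j.
have m2 : measurable_fun setT (br_zs M i) by exact: measurable_funPT.
exact: (measurableT_comp m1 m2).
Qed.

Let mys i : measurable_fun setT (@br_ys R n p M i).
Proof.
apply: (measurableT_comp (@measurable_sign_pm R)).
apply: measurable_funD; last exact: measurable_funPT.
apply: measurable_funD; first exact: measurable_funPT.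
by apply: measurable_dotp_mx => //; move=> j k; exact: measurable_cst.
Qed.

Lemma measurable_newton_step h (b : br_space M -> 'cV[R]_p) : measurable_mx b ->
  measurable_mx (fun w => newton_step H (fun i => br_ys i w) (fun i => br_xs M i w)
    (fun i => br_zs M i w) h (b w)).
Proof.
move=> mb; have marg i : measurable_fun setT
    (fun w => (br_xs M i w + dotp (br_zs M i w : 'cV[R]_p) (b w)) / h).
  apply: measurable_funM => //; apply: measurable_funD; first exact: measurable_funPT.
  exact: measurable_dotp_mx.
have mw (k : R -> R) i : continuous k -> measurable_fun setT
    (fun w => - br_ys i w * k ((br_xs M i w + dotp (br_zs M i w : 'cV[R]_p) (b w)) / h)).
  move=> ck; apply: measurable_funM; first exact: measurableT_comp.
  exact: (measurableT_comp (continuous_measurable_fun ck) (marg i)).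
apply: measurable_mxB => //; apply: measurable_mulmx.
  apply: measurable_invmx => k l; under eq_fun do rewrite mxE summxE.
  apply: measurable_funM => //; apply: measurable_sum => i; under eq_fun do rewrite mxE.
  apply: measurable_funM; first exact: mw.
  under eq_fun do rewrite mxE big_ord1 mxE.
  by apply: measurable_funM; exact: mzs.
move=> k l; under eq_fun do rewrite mxE summxE.
apply: measurable_funM => //; apply: measurable_sum => i; under eq_fun do rewrite mxE.
by apply: measurable_funM; [exact: mw|exact: mzs].
Qed.

Lemma measurable_estimator h t : measurable_mx (fun w => msm_estimator (M := M) H h t w).
Proof.
elim: t => [|t IH]; last exact: measurable_newton_step.
move=> j k; rewrite [k]ord1; have m1 := @measurable_coord R p j.
have m2 : measurable_fun setT (br_beta0 M) by exact: measurable_funPT.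
exact: (measurableT_comp m1 m2).
Qed.

Lemma measurable_estimation_error h t :
  measurable_fun setT (fun w => l2norm (msm_estimator (M := M) H h t w - br_beta M)).
Proof.
apply: measurable_l2norm_mx; apply: measurable_mxB; first exact: measurable_estimator.
by move=> j k; exact: measurable_cst.
Qed.

End measurable_estimator.

(** * One Newton step with high probability *)

Section newton_event.
Context (R : realType) (alpha : nat) (H : R -> R) (K Cr CF c1 eta CZ : R).
Context (n p : nat) (M : binary_response R n p) (rho F : R -> borel_cV R p -> R).
Hypothesis hM : regular_model alpha H K Cr CF c1 eta CZ M rho F.
Hypothesis dH : forall t, derivable (derive1 H) t 1.
Local Notation P := (br_prob M).
Local Notation W0 := (@obs0 R n p M).

Let L := hess_bias_const K CF Cr * mom_const eta CZ.
Let q : R := p%:R * ln n%:R.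
Let rate h : R := Num.sqrt (q / (n%:R * h ^+ 3)).
Let gb := grad_bias_const alpha K CF Cr * mom_const eta CZ.
Let hd := hess_dev_const K Cr eta CZ.

(** The exceptional event is chosen before [b], so the bound may be applied to a starting point
    computed from the same sample. *)
Lemma newton_event h a : 0 < h -> h <= 1 -> n%:R^-1 <= h -> (p <= n)%N ->
  1 <= ln (n%:R : R) -> 16 * K ^+ 2 / eta ^+ 2 * q <= n%:R * h ->
  4 * K ^+ 2 / eta ^+ 2 <= n%:R * h -> 0 < a ->
  exists A, [/\ measurable A,
    (P A <= (3 / n%:R + grad_dev_const K Cr eta CZ / a ^+ 2)%:E)%E &
    forall w, ~ A w -> forall b, l2norm (b - br_beta M) <= 1 ->
      hd * rate h + L * (l2norm (b - br_beta M) + h) <= c1^-1 / 2 ->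
      l2norm (newton_step H (fun i => br_ys i w) (fun i => br_xs M i w)
         (fun i => br_zs M i w) h b - br_beta M) <=
      2 * c1 * (gb * h ^+ alpha + a * Num.sqrt (p%:R / (n%:R * h)) +
        l2norm (b - br_beta M) * (2 * (hd * rate h + L * l2norm (b - br_beta M))))].
Proof.
move=> h0 h1 nh pn ln1 hq hn a0.
have n0 : (0 < n)%N by exact: leq_trans (rm_p hM) pn.
have K0 : 0 <= K by exact: le_trans (kb_K (rm_kernel hM)).
have L0 : 0 <= L.
  apply: mulr_ge0 (mom_const_ge0 hM); have [? ?] := (rm_Cr hM, rm_CF hM).
  by rewrite !mulr_ge0// addr_ge0// !mulr_ge0.
have [A [mA PA hA]] := hess_uniform hM h0 h1 nh pn ln1 hq.
pose B : set (br_space M) := [set w | a * Num.sqrt (p%:R / (n%:R * h)) < l2norm (emp_grad H h 0 w - grad_mean H M h)].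
have PB := grad_deviation hM h0 a0 n0 hn.
have mB : measurable B.
  rewrite -[X in measurable X]setTI; apply: (measurable_fun_ltr (measurable_cst _)) => //.
  apply: measurable_l2norm_mx => j k; rewrite [k]ord1.
  under eq_fun do rewrite (emp_grad_centered _ _ _ _ n0).
  apply: measurable_funM => //.
  exact: (measurable_centered_sum _ _ (@measurable_obs_at _ _ _ M) (measurable_grad_term hM _ _)).
exists (A `|` B); split; first exact: measurableU.
  apply: le_trans (measureU2 _ mA mB) _; rewrite EFinD; exact: leeD.
move=> w nAB b; set d := b - br_beta M => d1 hc.
have bE : b = br_beta M + d by rewrite /d addrC subrK.
have hWE := hA w (fun h => nAB (or_introl h)).
(* Nonnegativity of the deviation bound is read off from the uniform estimate at zero vectors. *)
have hrate : 0 <= hd * rate h.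
  have h00 : l2norm (0 : 'cV[R]_p) <= 1.
    by rewrite /l2norm big1 ?sqrtr0// => i _; rewrite mxE expr0n.
  exact: le_trans (normr_ge0 _) (hWE 0 0 0 h00 h00 h00).
have Vge u : c1^-1 * dotp u u <= dotp u (V_mx M rho F *m u).
  exact: rayleigh_ge (V_mx_sym hM) (rm_eigen hM) u.
have c10 : 0 < c1^-1 by rewrite invr_gt0 (rm_c1 hM).
rewrite bE; apply: le_trans (newton_step_bound dH c10 hrate L0 hWE
  (fun d d' u u' u1 u1' => hess_mean_lip hM d d' h0 u1 u1')
  (fun u u' u1 u1' => hess_mean_limit hM h0 u1 u1') Vge d1 hc) _.
rewrite invrK; apply: ler_wpM2l; first by rewrite mulr_ge0// ltW ?(rm_c1 hM).
apply: lerD => //.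
have -> : sms_grad H (fun i => br_ys i w) (fun i => br_xs M i w) (fun i => br_zs M i w) h
   (br_beta M + 0) = grad_mean H M h + (emp_grad H h 0 w - grad_mean H M h).
  by rewrite [RHS]addrC subrK.
apply: le_trans (ler_l2normD _ _) _; apply: lerD; first exact: (grad_mean_le hM).
by rewrite leNgt; apply/negP => hB; apply: nAB; right.
Qed.

End newton_event.

(** * The recursion satisfied by the rates *)

Section rates.
Context (R : realType) (alpha : nat).
Hypothesis alpha2 : (2 <= alpha)%N.

(* With u = (p/n)^(1/(2 alpha + 1)), v = (p/m)^(1/3) and lam = log n this is the
   rate of the t-th iterate; the initial estimator has rate v. *)
Definition error_rate (u v lam : R) (t : nat) : R :=
  if t is t'.+1 then
    u ^+ alpha + v ^+ (2 ^ t) + v ^+ (2 ^ t') * u ^+ alpha.-1 * Num.sqrt lam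
  else v.

Variables (u v lam h : R).
Hypotheses (u0 : 0 < u) (u1 : u <= 1) (v0 : 0 <= v) (v1 : v <= 1) (lam1 : 1 <= lam).

Let lam0 : 0 <= lam. Proof. exact: le_trans lam1. Qed.
Let alpha1 : (0 < alpha)%N. Proof. exact: ltnW alpha2. Qed.

Lemma error_rate_ge0 t : 0 <= error_rate u v lam t.
Proof.
case: t => [//|t]; rewrite /error_rate !addr_ge0// ?exprn_ge0// ?(ltW u0)//.
by rewrite !mulr_ge0// ?exprn_ge0// ?(ltW u0)// sqrtr_ge0.
Qed.

Lemma bias_rate y t : 0 <= y -> y ^+ alpha = v ^+ (2 ^ t.+1) ->
  Num.max u y ^+ alpha <= error_rate u v lam t.+1.
Proof.
move=> y0 yv; rewrite /error_rate -yv.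
have u00 := ltW u0.
have z0 : 0 <= v ^+ (2 ^ t) * u ^+ alpha.-1 * Num.sqrt lam.
  by rewrite !mulr_ge0// ?exprn_ge0// sqrtr_ge0.
have ua : 0 <= u ^+ alpha by rewrite exprn_ge0.
have ya : 0 <= y ^+ alpha by rewrite exprn_ge0.
by rewrite maxEle; case: ifP => _; lra.
Qed.

Lemma variance_rate t : u <= h ->
  Num.sqrt (u ^+ (2 * alpha + 1) / h) <= error_rate u v lam t.+1.
Proof.
move=> uh; have h0 : 0 < h := lt_le_trans u0 uh; have u00 := ltW u0.
apply: (@le_trans _ _ (u ^+ alpha)); last first.
  rewrite /error_rate -addrA lerDl addr_ge0// ?exprn_ge0//.
  by rewrite !mulr_ge0// ?exprn_ge0// sqrtr_ge0.
have ua : 0 <= u ^+ alpha by rewrite exprn_ge0.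
rewrite -[leRHS]ger0_norm// -sqrtr_sqr ler_sqrt ?sqr_ge0//.
rewrite ler_pdivrMr// -exprM mulnC exprD expr1 mulnC.
by rewrite ler_wpM2l// exprn_ge0.
Qed.

(** With [u^(2 alpha + 1) = p/n] the left side is the Hessian deviation; replacing [h^3] by the
    smaller [u^3] leaves [u^(2 (alpha - 1))] under the root. *)
Lemma concentration_rate : u <= h ->
  Num.sqrt (u ^+ (2 * alpha + 1) * lam / h ^+ 3) <= u ^+ alpha.-1 * Num.sqrt lam.
Proof.
move=> uh; have h0 : 0 < h := lt_le_trans u0 uh; have u00 := ltW u0.
have ua : 0 <= u ^+ alpha.-1 by rewrite exprn_ge0.
rewrite -[u ^+ alpha.-1]ger0_norm// -sqrtr_sqr -sqrtrM ?sqr_ge0//.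
rewrite ler_sqrt ?mulr_ge0 ?sqr_ge0// mulrAC ler_wpM2r//.
rewrite ler_pdivrMr ?exprn_gt0//.
have -> : (2 * alpha + 1 = alpha.-1 * 2 + 3)%N.
  by rewrite -{1}(prednK alpha1) mulnS addnAC addnC mulnC.
rewrite exprD -exprM; apply: ler_wpM2l; first by rewrite exprn_ge0.
by rewrite lerXn2r// nnegrE// ltW.
Qed.

Hypothesis small : u ^+ (alpha.-1 * 2) * lam ^+ 5 <= 1.
Local Notation D := (u ^+ alpha.-1 * Num.sqrt lam).

Let D0 : 0 <= D. Proof. by rewrite mulr_ge0 ?sqrtr_ge0// exprn_ge0// ltW. Qed.
Let D2 : D ^+ 2 = u ^+ (alpha.-1 * 2) * lam.
Proof. by rewrite exprMn sqr_sqrtr// -exprM. Qed.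
Let D1 : D <= 1.
Proof.
rewrite -(@expr_le1 _ 2)// D2; apply: le_trans small.
rewrite ler_wpM2l ?exprn_ge0 ?(ltW u0)//.
by rewrite -[leLHS]expr1 ler_weXn2l.
Qed.

Let two_w (w : R) (s : nat) : w ^+ (2 ^ s.+1) = (w ^+ (2 ^ s)) ^+ 2.
Proof. by rewrite -exprM expnSr. Qed.

(* If w lam <= 1 then w D^2 <= u^alpha because 2 (alpha - 1) >= alpha; otherwise
   w^4 >= lam^-4 dominates D^2. *)
Lemma cross_term (w : R) : 0 <= w <= 1 -> w * D ^+ 2 <= u ^+ alpha + w ^+ 4.
Proof.
move=> /andP[w0 w1]; rewrite D2.
have U0 : 0 <= u ^+ (alpha.-1 * 2) by rewrite exprn_ge0// ltW.
have ua : 0 <= u ^+ alpha by rewrite exprn_ge0// ltW.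
have [wl|wl] := leP (w * lam) 1.
  rewrite mulrCA -[leLHS]addr0; apply: lerD; last by rewrite exprn_ge0.
  apply: (@le_trans _ _ (u ^+ (alpha.-1 * 2) * 1)); first exact: ler_wpM2l.
  rewrite mulr1; apply: ler_wiXn2l => //; first exact: ltW.
  by rewrite -{1}(prednK alpha1) muln2 -addnn -addn1 leq_add2l ltn_predRL.
rewrite -[leLHS]add0r; apply: lerD => //.
have lp : 0 < lam := lt_le_trans ltr01 lam1.
apply: (@le_trans _ _ (u ^+ (alpha.-1 * 2) * lam)).
  by rewrite ler_piMl// mulr_ge0.
have l4 : 0 < lam ^+ 4 by rewrite exprn_gt0.
rewrite -(ler_pM2r l4) -mulrA -exprS; apply: (le_trans small).
by rewrite -exprMn exprn_ege1// ltW.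
Qed.

(** At [t = 0] the products are [v^2] and [v D], two terms of the next rate. Later, with
    [A = u^alpha] and [w = v^(2^(t-1))], the rate is [A + w^2 + w D] and the next one is
    [A + w^4 + w^2 D]. Since [A], [w] and [D] are at most 1, every product is absorbed directly
    except [w D^2], which is the matter of [cross_term]. *)
Lemma error_rate_next t :
  error_rate u v lam t ^+ 2 <= 3 * error_rate u v lam t.+1 /\
  error_rate u v lam t * D <= 3 * error_rate u v lam t.+1.
Proof.
have u00 := ltW u0.
set w := v ^+ (2 ^ t.-1).
have w01 : 0 <= w <= 1 by rewrite exprn_ge0//= exprn_ile1.
have [w0 w1] : 0 <= w /\ w <= 1 by exact: andP.
have A0 : 0 <= u ^+ alpha by rewrite exprn_ge0.
have A1 : u ^+ alpha <= 1 by rewrite exprn_ile1.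
case: t @w w01 w0 w1 => [|t] w w01 w0 w1.
  rewrite /error_rate expn0 expr1 expn1 -mulrA.
  have vv : 0 <= v ^+ 2 by rewrite sqr_ge0.
  have vD : 0 <= v * D by rewrite mulr_ge0.
  by split; lra.
have E1 : error_rate u v lam t.+1 = u ^+ alpha + w ^+ 2 + w * D.
  by rewrite /error_rate two_w mulrA.
have E2 : error_rate u v lam t.+2 = u ^+ alpha + w ^+ 4 + w ^+ 2 * D.
  by rewrite /error_rate !two_w -!exprM mulrA.
rewrite E1 E2; have cross := cross_term w01.
have w20 : 0 <= w ^+ 2 by rewrite sqr_ge0.
have w40 : 0 <= w ^+ 4 by rewrite exprn_ge0.
move: cross D0 D1; set d := D; set A := u ^+ alpha in A0 A1 *; set W := w ^+ 2 in w20 *.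
have W4 : w ^+ 4 = W ^+ 2 by rewrite /W -exprM.
rewrite W4 => cross d0 d1; have Wd : 0 <= W * d by rewrite mulr_ge0.
have AA : A ^+ 2 <= A by rewrite expr2 ler_piMl.
have Ad : A * d <= A by rewrite ler_piMr.
have wd2 : (w * d) ^+ 2 <= W * d.
  by rewrite exprMn -/W ler_wpM2l// expr2 ler_piMl.
split.
  have sq3 (x y z : R) : (x + y + z) ^+ 2 <= 3 * (x ^+ 2 + y ^+ 2 + z ^+ 2).
    have := sqr_ge0 (x - y); have := sqr_ge0 (y - z); have := sqr_ge0 (x - z).
    by nra.
  by apply: le_trans (sq3 _ _ _) _; rewrite ler_pM2l//; apply: lerD => //; apply: lerD.
rewrite !mulrDl -mulrA -expr2; have WW : 0 <= W ^+ 2 by rewrite sqr_ge0.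
by lra.
Qed.

End rates.

(** * Consequences of the growth condition on [p] *)

Section asymptotics.
Context (R : realType).

Lemma nat_cvg_infty_ge (f : nat -> nat) : f @ \oo --> \oo ->
  forall N, \forall k \near \oo, (N <= f k)%N.
Proof. by move=> hf N; exact: (hf _ (nbhs_infty_ge N)). Qed.

Lemma nat_powR_large (f : nat -> nat) (s B : R) : f @ \oo --> \oo -> 0 < s ->
  \forall k \near \oo, B <= (f k)%:R `^ s.
Proof.
move=> hf s0; pose B' := Num.max B 1.
have B0 : 0 <= B' by rewrite le_max ler01 orbT.
pose N := (Num.truncn (B' `^ s^-1)).+1.
apply: filterS (nat_cvg_infty_ge hf N) => k hk.
have hN : B' `^ s^-1 <= (f k)%:R.
  have := truncn_itv (powR_ge0 B' s^-1) => /andP[_ /ltW h].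
  by apply: le_trans h _; rewrite ler_nat.
have := ge0_ler_powR (ltW s0) _ _ hN; rewrite -powRrM mulVf ?gt_eqF// powRr1//.
move=> h; apply: le_trans (h _ _); first by rewrite le_max lexx.
- by rewrite nnegrE powR_ge0.
- by rewrite nnegrE.
Qed.

Lemma ln_pow_le (x s : R) : 0 < s -> 0 < x -> s * ln x <= x `^ s.
Proof.
move=> s0 x0; rewrite /powR gt_eqF//; apply: le_trans (expR_ge1Dx _).
by rewrite lerDr.
Qed.

Lemma powR_le_inv (x e s : R) : 0 < s -> 0 <= x -> 0 <= e -> x <= e `^ s^-1 -> x `^ s <= e.
Proof.
move=> s0 x0 e0 h; have := ge0_ler_powR (ltW s0) _ _ h.
by rewrite -powRrM mulVf ?gt_eqF// powRr1//; apply; rewrite nnegrE// powR_ge0.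
Qed.

Variables (n m p L : nat -> nat).
Hypotheses (hn : n @ \oo --> \oo) (hm : m @ \oo --> \oo).
Hypotheses (hnmL : forall k, n k = (m k * L k)%N) (hL : forall k, (0 < L k)%N).
Variable c2 : R.
Hypothesis hc2 : 0 < c2 < 1.
Hypothesis hpm : ((fun k => (p k)%:R) : nat -> R) =O_\oo
          ((fun k => (m k)%:R `^ c2) : nat -> R).

Let mn k : (m k <= n k)%N. Proof. by rewrite hnmL leq_pmulr. Qed.
Let s := 1 - c2.
Let s0 : 0 < s. Proof. by rewrite subr_gt0; have /andP[] := hc2. Qed.

Lemma dimension_growth : exists2 C, 0 < C &
  \forall k \near \oo, (0 < m k)%N /\ (p k)%:R <= C * (m k)%:R `^ c2.
Proof.
have [C C0 hC] := (@eqO_exP _ _ _ _ _ _ _).1 hpm.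
exists C => //; apply: filterS2 hC (nat_cvg_infty_ge hm 1) => k.
by rewrite normr_nat ger0_norm ?powR_ge0.
Qed.

Lemma ratio_small (e : R) : 0 < e -> \forall k \near \oo,
  (0 < m k)%N /\ (p k)%:R / (m k)%:R <= e.
Proof.
move=> e0; have [C C0 hC] := dimension_growth.
apply: filterS2 hC (nat_powR_large (C / e) hm s0) => k [mk hk] hs; split=> //.
have mR : 0 < (m k)%:R :> R by rewrite ltr0n.
have ms : 0 < (m k)%:R `^ s by rewrite powR_gt0.
rewrite ler_pdivrMr//; apply: le_trans hk _.
have -> : e * (m k)%:R = e * (m k)%:R `^ s * (m k)%:R `^ c2.
  by rewrite -mulrA -powRD ?subrK ?powRr1 ?ltW// oner_eq0.
rewrite ler_wpM2r ?powR_ge0//.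
by move: hs; rewrite ler_pdivrMr// mulrC.
Qed.

(** As [p/n] is at most a constant times [n^(-s)], its power [g] is [O(n^(-10 sg))] with
    [sg = s g/10]; and [log n <= n^sg / sg] bounds the fifth power of the logarithm by a multiple of
    [n^(5 sg)]. A negative power of [n] remains. *)
Lemma ratio_log_small (g e : R) : 0 < g -> 0 < e -> \forall k \near \oo,
  ((p k)%:R / (n k)%:R) `^ g * ln (n k)%:R ^+ 5 <= e.
Proof.
move=> g0 e0; have [C C0 hC] := dimension_growth.
pose sg := s * g / 10; have sg0 : 0 < sg by rewrite divr_gt0// mulr_gt0.
pose B := C `^ g / sg ^+ 5 / e.
apply: filterS2 hC (nat_powR_large B hn (mulr_gt0 sg0 (ltr0Sn _ 4) : 0 < sg * 5)).
move=> k [mk hk] hB.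
have n0 : (0 < n k)%N by exact: leq_trans mk (mn k).
have nR : 0 < (n k)%:R :> R by rewrite ltr0n.
have [c0 c1] := andP hc2.
have pn : (p k)%:R / (n k)%:R <= C * (n k)%:R `^ (- s).
  rewrite ler_pdivrMr// -mulrA; apply: le_trans hk _; rewrite ler_wpM2l ?(ltW C0)//.
  have -> : (n k)%:R `^ (- s) * (n k)%:R = (n k)%:R `^ c2.
    rewrite -{2}[(n k)%:R]powRr1 ?ltW// -powRD; last by rewrite (gt_eqF nR) implybT.
    by rewrite /s opprB subrK.
  by apply: ge0_ler_powR; rewrite ?nnegrE ?(ltW c0)// ler_nat.
have png : ((p k)%:R / (n k)%:R) `^ g <= C `^ g * (n k)%:R `^ (- (sg * 10)).
  have y0 : 0 <= C * (n k)%:R `^ (- s) by rewrite mulr_ge0 ?powR_ge0// ltW.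
  have x0 : 0 <= (p k)%:R / (n k)%:R :> R by exact: divr_ge0.
  have -> : - (sg * 10) = - s * g by rewrite /sg; field.
  rewrite powRrM -powRM ?powR_ge0 ?(ltW C0)//.
  by apply: ge0_ler_powR pn; rewrite ?nnegrE// ltW.
have ln0 : 0 <= ln (n k)%:R :> R by rewrite ln_ge0// ler1n.
have lnn : ln (n k)%:R ^+ 5 <= (n k)%:R `^ (sg * 5) / sg ^+ 5.
  have h := ln_pow_le sg0 nR.
  rewrite ler_pdivlMr ?exprn_gt0// mulrC -exprMn powRrM powR_mulrn ?powR_ge0//.
  by rewrite lerXn2r// nnegrE ?powR_ge0// mulr_ge0// ltW.
apply: le_trans (ler_pM (powR_ge0 _ _) (exprn_ge0 5 ln0) png lnn) _.
have -> : sg * 10 = sg * 5 + sg * 5 by ring.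
have N5 : 0 < (n k)%:R `^ (sg * 5) :> R by rewrite powR_gt0.
rewrite powRN powRD; last by rewrite (gt_eqF nR) implybT.
move: hB; rewrite /B ler_pdivrMr//; set X := _ `^ (sg * 5) in N5 *.
set Y := C `^ g; have s5 : 0 < sg ^+ 5 by rewrite exprn_gt0.
have -> : Y / (X * X) * (X / sg ^+ 5) = (Y / sg ^+ 5) / X by field; rewrite !gt_eqF.
by move=> h; rewrite ler_pdivrMr// [leRHS]mulrC.
Qed.

(** Collects the smallness that one Newton step consumes. The first powers follow from [p/m -> 0]
    and [m <= n]; the factor [log^5] is the one required by [cross_term]. *)
Lemma asymptotic_regime (alpha : nat) (e : R) : (2 <= alpha)%N -> 0 < e ->
  \forall k \near \oo,
    [/\ (0 < n k)%N, (p k <= n k)%N, e^-1 <= ln (n k)%:R,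
        ((p k)%:R / (n k)%:R) `^ (2 * alpha + 1)%:R^-1 <= e &
        ((p k)%:R / (m k)%:R) `^ (1 / 3) <= e /\
        (((p k)%:R / (n k)%:R) `^ (2 * alpha + 1)%:R^-1) ^+ (alpha.-1 * 2)
          * ln (n k)%:R ^+ 5 <= e].
Proof.
move=> alpha2 e0; pose q : R := (2 * alpha + 1)%:R^-1.
have q0 : 0 < q by rewrite invr_gt0 ltr0n addn1.
have t0 : 0 < 1 / 3 :> R by rewrite divr_gt0.
have g0 : 0 < q * (alpha.-1 * 2)%:R.
  by rewrite mulr_gt0// ltr0n muln_gt0 andbT -ltnS prednK// ltnW.
have near1 := ratio_small ltr01.
have nearq := ratio_small (powR_gt0 q^-1 e0); have nearv := ratio_small (powR_gt0 (1 / 3)^-1 e0).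
have nearg := ratio_log_small g0 e0.
have nearl := nat_powR_large (expR e^-1) hn (ltr01 : 0 < 1 :> R).
near=> k.
have [mk b1] : (0 < m k)%N /\ (p k)%:R / (m k)%:R <= (1 : R) by near: k.
have [_ bq] : (0 < m k)%N /\ (p k)%:R / (m k)%:R <= e `^ q^-1 by near: k.
have [_ bv] : (0 < m k)%N /\ (p k)%:R / (m k)%:R <= e `^ (1 / 3)^-1 by near: k.
have hg : ((p k)%:R / (n k)%:R) `^ (q * (alpha.-1 * 2)%:R) * ln (n k)%:R ^+ 5 <= e by near: k.
have hl : expR e^-1 <= (n k)%:R `^ 1 by near: k.
have n0 : (0 < n k)%N by exact: leq_trans mk (mn k).
have mR : 0 < (m k)%:R :> R by rewrite ltr0n.
have nR : 0 < (n k)%:R :> R by rewrite ltr0n.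
have ab : (p k)%:R / (n k)%:R <= (p k)%:R / (m k)%:R :> R.
  by rewrite ler_wpM2l// lef_pV2 ?posrE// ler_nat.
split => //.
- apply: leq_trans (mn k); move: b1; rewrite ler_pdivrMr// mul1r ler_nat//.
- by rewrite powRr1 ?(ltW nR)// in hl; rewrite -ler_expR lnK ?posrE.
- by apply: (powR_le_inv q0) (le_trans ab bq); [exact: divr_ge0|exact: ltW].
split; first by apply: (powR_le_inv t0) bv; [exact: divr_ge0|exact: ltW].
by rewrite -powR_mulrn ?powR_ge0// -powRrM.
Unshelve. all: by end_near.
Qed.

End asymptotics.

(** * One iteration at the announced rate *)

Section iterate.
Context (R : realType) (alpha : nat) (H : R -> R) (K Cr CF c1 eta CZ : R).
Context (n m p : nat) (M : binary_response R n p) (rho F : R -> borel_cV R p -> R).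
Hypothesis hM : regular_model alpha H K Cr CF c1 eta CZ M rho F.
Hypothesis dH : forall t, derivable (derive1 H) t 1.
Local Notation P := (br_prob M).

Let L := hess_bias_const K CF Cr * mom_const eta CZ.
Let gb := grad_bias_const alpha K CF Cr * mom_const eta CZ.
Let hd := hess_dev_const K Cr eta CZ.

Definition step_const (M0 a : R) : R :=
  2 * c1 * (`|gb| + a + 6 * M0 * `|hd| + 6 * M0 ^+ 2 * `|L|).

(** Each summand buys one condition on [delta]: [delta <= 1], admissible Chernoff parameters, a
    perturbation of the Hessian below [1/(2 c1)], and [3 M0 delta <= 1], which keeps the iterate in
    the unit ball around the truth. *)
Definition step_size (M0 : R) : R :=
  (1 + 16 * K ^+ 2 / eta ^+ 2 + 2 * c1 * (`|hd| + `|L| * (3 * M0 + 1)) + 3 * M0)^-1.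

(** Only the algebraic relations between [u], [v], [y] and [p/n] are kept, so real exponents stay
    outside. Smallness is required at level [delta^alpha] because [y] is controlled through
    [y^alpha]; this gives [h <= delta]. The previous error is then at most [3 M0 delta],
    [newton_event] applies, and the rate lemmas bound its right side term by term. *)
Lemma iterate_step_abstract (u v lam y h : R) (t : nat) (M0 a delta : R) :
  0 < u -> 0 <= v -> 0 <= y -> u ^+ (2 * alpha + 1) = p%:R / n%:R -> lam = ln n%:R ->
  y ^+ alpha = v ^+ (2 ^ t.+1) -> h = Num.max u y ->
  0 < M0 -> 0 < a -> 0 < delta ->
  delta <= step_size M0 -> (0 < n)%N -> (p <= n)%N -> (delta ^+ alpha)^-1 <= lam ->
  u <= delta ^+ alpha -> v <= delta ^+ alpha ->
  u ^+ (alpha.-1 * 2) * lam ^+ 5 <= delta ^+ alpha ->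
  exists A, [/\ measurable A,
    (P A <= (3 / n%:R + grad_dev_const K Cr eta CZ / a ^+ 2)%:E)%E &
    forall w, ~ A w -> forall b, l2norm (b - br_beta M) <= M0 * error_rate alpha u v lam t ->
      l2norm (newton_step H (fun i => br_ys i w) (fun i => br_xs M i w)
         (fun i => br_zs M i w) h b - br_beta M) <=
      step_const M0 a * error_rate alpha u v lam t.+1].
Proof.
move=> u0 v0 y0 u2a lamE yv hE M00 a0 d0 dle n0 pn hlam hu hv hul.
have alpha2 := rm_alpha hM; have c10 := rm_c1 hM; have e0 := rm_eta hM.
have alpha1 : (0 < alpha)%N := ltnW alpha2.
have nR : 0 < n%:R :> R by rewrite ltr0n.
have pR : 1 <= p%:R :> R by rewrite ler1n (rm_p hM).
pose T1 := 16 * K ^+ 2 / eta ^+ 2; pose T2 := `|hd| + `|L| * (3 * M0 + 1).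
have T10 : 0 <= T1 by rewrite divr_ge0 ?sqr_ge0// mulr_ge0// sqr_ge0.
have T20 : 0 <= T2 by rewrite addr_ge0// mulr_ge0// addr_ge0// mulr_ge0// ltW.
have T30 : 0 <= 2 * c1 * T2 by rewrite mulr_ge0// mulr_ge0// ltW.
have M30 : 0 <= 3 * M0 by rewrite mulr_ge0// ltW.
have S0 : 0 < 1 + T1 + 2 * c1 * T2 + 3 * M0.
  by rewrite -!addrA ltr_wpDr// !addr_ge0.
have dS : delta * (1 + T1 + 2 * c1 * T2 + 3 * M0) <= 1.
  by rewrite -ler_pdivlMr// div1r.
have d1 : delta <= 1.
  apply: le_trans dS; rewrite ler_peMr ?(ltW d0)//; lra.
have dT1 : T1 * delta <= 1.
  by apply: le_trans dS; rewrite mulrC ler_wpM2l ?(ltW d0)//; lra.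
have dM : 3 * M0 * delta <= 1.
  by apply: le_trans dS; rewrite mulrC ler_wpM2l ?(ltW d0)//; lra.
have dT2 : delta * T2 <= c1^-1 / 2.
  have -> : c1^-1 / 2 = 1 / (2 * c1) by rewrite div1r invfM mulrC.
  rewrite ler_pdivlMr ?mulr_gt0//; apply: le_trans dS.
  have -> : delta * T2 * (2 * c1) = delta * (2 * c1 * T2) by ring.
  by apply: ler_wpM2l; [exact: ltW|lra].
have da0 : 0 < delta ^+ alpha by rewrite exprn_gt0.
have da2 : delta ^+ alpha <= delta ^+ 2 by apply: ler_wiXn2l => //; exact: ltW.
have da1 : delta ^+ alpha <= delta.
  by apply: le_trans da2 _; rewrite expr2 ler_piMl// ltW.
have dale1 : delta ^+ alpha <= 1 := le_trans da1 d1.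
have u1 : u <= 1 := le_trans hu dale1.
have v1 : v <= 1 := le_trans hv dale1.
have lam1 : 1 <= lam by apply: le_trans hlam; rewrite invr_ge1 ?unitf_gt0.
have small : u ^+ (alpha.-1 * 2) * lam ^+ 5 <= 1 := le_trans hul dale1.
have aR : alpha%:R != 0 :> R by rewrite pnatr_eq0 -lt0n.
have vpow s : (0 < s)%N -> v ^+ s <= delta ^+ alpha.
  move=> s0; apply: le_trans hv; rewrite -[leRHS]expr1; exact: ler_wiXn2l.
have yd : y <= delta.
  rewrite -(@ler_pXn2r _ alpha)// ?nnegrE ?(ltW d0)// yv.
  by apply: vpow; rewrite expn_gt0.
have uh : u <= h by rewrite hE le_max lexx.
have h0 : 0 < h := lt_le_trans u0 uh.
have hdl : h <= delta by rewrite hE ge_max yd (le_trans hu da1).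
have h1 : h <= 1 := le_trans hdl d1.
have D2 : u ^+ (alpha.-1 * 2) * lam <= delta ^+ alpha.
  apply: le_trans hul; rewrite ler_wpM2l ?exprn_ge0 ?(ltW u0)//.
  by rewrite -[leLHS]expr1 ler_weXn2l.
set D := u ^+ alpha.-1 * Num.sqrt lam.
have lam0 : 0 <= lam := le_trans ler01 lam1.
have D0 : 0 <= D by rewrite mulr_ge0 ?sqrtr_ge0// exprn_ge0// ltW.
have Dd : D <= delta.
  rewrite -(@ler_pXn2r _ 2)// ?nnegrE ?(ltW d0)//.
  by rewrite exprMn sqr_sqrtr// -exprM (le_trans D2).
have pE : p%:R = u ^+ (2 * alpha + 1) * n%:R :> R by rewrite u2a divfK// gt_eqF.
have u00 := ltW u0.
(* Substituting [p = u^(2 alpha + 1) n] and using [h >= u], it is enough that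
   [T1 u^(2 alpha) lam <= 1]; here [u^(2 alpha) lam <= u^(2 alpha - 2) lam <= delta]. *)
have hq : T1 * (p%:R * lam) <= n%:R * h.
  apply: (@le_trans _ _ (n%:R * u)); last by rewrite ler_pM2l.
  have -> : T1 * (p%:R * lam) = n%:R * (T1 * (u ^+ (2 * alpha + 1) * lam)) by rewrite pE; ring.
  rewrite ler_pM2l//; apply: (@le_trans _ _ (T1 * (u * (u ^+ (alpha.-1 * 2) * lam)))).
    rewrite ler_wpM2l// [u * _]mulrA ler_wpM2r// -exprS; apply: ler_wiXn2l => //.
    by rewrite addn1 ltnS mulnC leq_mul2l leq_pred orbT.
  rewrite mulrCA ler_piMr//; apply: le_trans dT1.
  by rewrite ler_wpM2l// (le_trans D2).
have hn : 4 * K ^+ 2 / eta ^+ 2 <= n%:R * h.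
  apply: le_trans hq; apply: (@le_trans _ _ T1).
    have ke : 0 <= K ^+ 2 / eta ^+ 2 by rewrite divr_ge0 ?sqr_ge0.
    have -> : 4 * K ^+ 2 / eta ^+ 2 = 4 * (K ^+ 2 / eta ^+ 2) by rewrite mulrA.
    have -> : T1 = 16 * (K ^+ 2 / eta ^+ 2) by rewrite mulrA.
    by lra.
  by rewrite ler_peMr// mulr_ege1.
have nh : n%:R^-1 <= h.
  apply: le_trans uh; apply: (@le_trans _ _ (u ^+ (2 * alpha + 1))).
    by rewrite u2a ler_peMl// invr_ge0 ltW.
  by rewrite -[leRHS]expr1; apply: ler_wiXn2l => //; rewrite addn1.
have uad : u ^+ alpha <= delta.
  by apply: le_trans (le_trans hu da1); rewrite -[leRHS]expr1; apply: ler_wiXn2l.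
have rt : error_rate alpha u v lam t <= 3 * delta.
  have d3 : delta <= 3 * delta by rewrite ler_peMl ?(ltW d0)// ler1n.
  case: (t) => [|t']; first by apply: le_trans d3; exact: le_trans hv da1.
  rewrite /error_rate -mulrA -/D.
  have -> : 3 * delta = delta + delta + 1 * delta by ring.
  apply: lerD; first apply: lerD => //.
    by apply: le_trans da1; apply: vpow; rewrite expn_gt0.
  by apply: ler_pM => //; rewrite ?exprn_ge0// exprn_ile1.
rewrite lamE in hq lam1.
have [A [mA PA hA]] := newton_event hM dH h0 h1 nh pn lam1 hq hn a0.
rewrite -lamE in hq lam1 hA.
exists A; split=> // w nA b hb.
have r0 : 0 <= error_rate alpha u v lam t by exact: error_rate_ge0.
have r'0 : 0 <= error_rate alpha u v lam t.+1 by exact: error_rate_ge0.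
have [rr rD] := error_rate_next alpha2 u0 u1 v0 v1 lam1 small t.
set r := error_rate alpha u v lam t in hb rt r0 rr rD *.
set r' := error_rate alpha u v lam t.+1 in r'0 rr rD *.
set x := l2norm (b - br_beta M) in hb hA *.
have xM : x <= 3 * M0 * delta.
  apply: le_trans hb _; rewrite -mulrA mulrCA ler_pM2l//.
have x0 : 0 <= x := l2norm_ge0 _.
have c := concentration_rate alpha2 u0 lam1 uh.
set rate := Num.sqrt _ in c.
have ratE : Num.sqrt (p%:R * lam / (n%:R * h ^+ 3)) = rate.
  by rewrite /rate u2a; congr Num.sqrt; field; rewrite !gt_eqF// exprn_gt0.
have s0 : 0 <= rate by rewrite sqrtr_ge0.
have sD : rate <= D := c.
have hdle : hd * rate <= `|hd| * D.
  apply: le_trans (ler_wpM2r s0 (ler_norm hd)) _; exact: ler_wpM2l.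
have x1 : x <= 1 := le_trans xM dM.
have Lle z : 0 <= z -> L * z <= `|L| * z by move=> z0; rewrite ler_wpM2r// ler_norm.
(* Coercivity condition of the Newton step: the deviation is at most [|hd| delta], and
   [x + h <= (3 M0 + 1) delta]. *)
have hsmall : hd * rate + L * (x + h) <= c1^-1 / 2.
  apply: le_trans dT2; rewrite /T2 [leRHS]mulrDr; apply: lerD.
    by apply: le_trans hdle _; rewrite mulrC ler_wpM2r.
  apply: le_trans (Lle _ (addr_ge0 x0 (ltW h0))) _.
  rewrite mulrCA ler_wpM2l// mulrDr mulr1 lerD//.
  by rewrite mulrC.
have := hA w nA b x1; rewrite ratE => /(_ hsmall) /le_trans; apply.
have hb1 : gb * h ^+ alpha <= `|gb| * r'.
  apply: le_trans (ler_wpM2r (exprn_ge0 _ (ltW h0)) (ler_norm gb)) _.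
  by rewrite ler_wpM2l// hE; exact: bias_rate.
have hv1 : a * Num.sqrt (p%:R / (n%:R * h)) <= a * r'.
  rewrite ler_pM2l//; have -> : p%:R / (n%:R * h) = u ^+ (2 * alpha + 1) / h.
    by rewrite u2a invfM mulrA.
  exact: variance_rate.
have hd1 : x * (hd * rate) <= M0 * `|hd| * (3 * r').
  apply: (@le_trans _ _ (x * (`|hd| * D))); first by rewrite ler_wpM2l.
  apply: (@le_trans _ _ (M0 * r * (`|hd| * D))).
    by rewrite ler_wpM2r// mulr_ge0.
  have -> : M0 * r * (`|hd| * D) = M0 * `|hd| * (r * D) by ring.
  by rewrite ler_wpM2l// mulr_ge0// ltW.
have hL1 : x * (L * x) <= M0 ^+ 2 * `|L| * (3 * r').
  apply: (@le_trans _ _ (x * (`|L| * x))); first by rewrite ler_wpM2l// Lle.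
  have -> : x * (`|L| * x) = `|L| * x ^+ 2 by ring.
  apply: (@le_trans _ _ (`|L| * (M0 * r) ^+ 2)).
    by rewrite ler_wpM2l// lerXn2r// nnegrE mulr_ge0// ltW.
  have -> : `|L| * (M0 * r) ^+ 2 = M0 ^+ 2 * `|L| * r ^+ 2 by ring.
  by rewrite ler_wpM2l// mulr_ge0// sqr_ge0.
rewrite /step_const -[leRHS]mulrA; apply: ler_wpM2l; first by rewrite mulr_ge0// ltW.
move: hb1 hv1 hd1 hL1; rewrite -/gb -/hd -/L.
move: (gb * _) (Num.sqrt _) `|gb| `|hd| `|L| (hd * rate) (L * x) => z1 z2 z3 z4 z5 z6 z7.
move=> q1 q2 q3 q4.
have -> : (z3 + a + 6 * M0 * z4 + 6 * M0 ^+ 2 * z5) * r' =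
  z3 * r' + a * r' + 2 * (M0 * z4 * (3 * r') + M0 ^+ 2 * z5 * (3 * r')) by ring.
have -> : x * (2 * (z6 + z7)) = 2 * (x * z6 + x * z7) by ring.
apply: lerD; first exact: lerD.
by rewrite ler_pM2l//; exact: lerD.
Qed.

Lemma iterate_step (t : nat) (M0 a delta : R) :
  let u := (p%:R / n%:R) `^ (2 * alpha + 1)%:R^-1 in
  let v := (p%:R / m%:R) `^ (1 / 3) in
  let lam := ln n%:R in
  0 < M0 -> 0 < a -> 0 < delta ->
  delta <= step_size M0 -> (0 < n)%N -> (p <= n)%N -> (delta ^+ alpha)^-1 <= lam ->
  u <= delta ^+ alpha -> v <= delta ^+ alpha ->
  u ^+ (alpha.-1 * 2) * lam ^+ 5 <= delta ^+ alpha ->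
  exists A, [/\ measurable A,
    (P A <= (3 / n%:R + grad_dev_const K Cr eta CZ / a ^+ 2)%:E)%E &
    forall w, ~ A w -> forall b, l2norm (b - br_beta M) <= M0 * error_rate alpha u v lam t ->
      l2norm (newton_step H (fun i => br_ys i w) (fun i => br_xs M i w)
         (fun i => br_zs M i w) (bandwidth R alpha n m p t.+1) b - br_beta M) <=
      step_const M0 a * error_rate alpha u v lam t.+1].
Proof.
move=> u v lam M00 a0 d0 dS n0 pn.
have aR : alpha%:R != 0 :> R by rewrite pnatr_eq0 -lt0n (leq_trans _ (rm_alpha hM)).
have pR : 0 < p%:R :> R by rewrite ltr0n (rm_p hM).
have nR : 0 < n%:R :> R by rewrite ltr0n.
pose y : R := (p%:R / m%:R) `^ ((2 ^ t.+1)%:R / (3 * alpha)%:R).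
have u0 : 0 < u by rewrite powR_gt0// divr_gt0.
have v0 : 0 <= v := powR_ge0 _ _.
have y0 : 0 <= y := powR_ge0 _ _.
have u2a : u ^+ (2 * alpha + 1) = p%:R / n%:R.
  rewrite /u -powR_mulrn ?powR_ge0// -powRrM mulVf; last by rewrite pnatr_eq0 addn1.
  by rewrite powRr1// divr_ge0// ltW.
have yv : y ^+ alpha = v ^+ (2 ^ t.+1).
  rewrite /y /v -!powR_mulrn ?powR_ge0// -!powRrM natrM; congr (_ `^ _).
  by field.
exact: (iterate_step_abstract u0 v0 y0 u2a (erefl lam) yv (erefl _) M00 a0 d0 dS n0 pn).
Qed.

End iterate.

(** * Reduction to uniform constants and induction on the iterations *)

Section regular_model_exists.
Context (R : realType).

Lemma bounded_derivatives_le (N : nat) (C C' : R) (f : R -> R) : C <= C' ->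
  bounded_derivatives N C f -> bounded_derivatives N C' f.
Proof. by move=> CC h j jN x; have [d b] := h j jN x; split=> //; exact: le_trans CC. Qed.

(** The assumptions give no sign for [Cr] and [CF] and no lower bound for [CZ]; enlarging them by
    maxima supplies the inequalities of the interface. *)
Lemma regular_modelP (alpha : nat) (H : R -> R) (K Cr CF c1 eta CZ : R) (n p : nat)
    (M : binary_response R n p) (rho F : R -> borel_cV R p -> R) :
  kernel_bounds alpha H K -> (2 <= alpha)%N -> (0 < p)%N -> 1 < c1 -> 0 < eta ->
  iid_sample M -> identifiability M -> density_assumption M alpha Cr rho ->
  noise_assumption M alpha CF F -> eigenvalue_assumption M H c1 rho F ->
  subgaussian_assumption M eta CZ ->
  regular_model alpha H K (Num.max Cr 0) (Num.max CF 0) c1 eta (Num.max CZ 1) M rho F.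
Proof.
move=> hK alpha2 p0 c11 eta0 hiid [hmed _ _ _] [hr hr2] [hN1 hN2 hN3] [hV _] hZ.
split=> //; rewrite ?le_max ?lexx ?orbT//.
- exact: lt_trans c11.
- split=> //; apply: filterS hr2 => w [h1 h2]; split.
    by move=> t; have /andP[-> h] := h1 t; rewrite le_max h.
  by apply: bounded_derivatives_le h2; rewrite le_max lexx.
- split=> //; apply: filterS hN3 => w; apply: bounded_derivatives_le.
  by rewrite le_max lexx.
- by move=> a /hV /andP[].
- by apply: le_trans hZ _; rewrite lee_fin le_max lexx.
Qed.

End regular_model_exists.

Section induction.
Context (R : realType) (n m p : nat -> nat) (M : forall k, binary_response R (n k) (p k)).
Context (alpha : nat) (H : R -> R) (K Cr CF c1 eta CZ : R).
Context (rho F : forall k, R -> borel_cV R (p k) -> R).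
Hypothesis hH : kernel_assumption alpha H.
Hypothesis hM : forall k, regular_model alpha H K Cr CF c1 eta CZ (M k) (@rho k) (@F k).
Hypothesis hreg : forall e : R, 0 < e -> \forall k \near \oo,
    [/\ (0 < n k)%N, (p k <= n k)%N, e^-1 <= ln (n k)%:R,
        ((p k)%:R / (n k)%:R) `^ (2 * alpha + 1)%:R^-1 <= e &
        ((p k)%:R / (m k)%:R) `^ (1 / 3) <= e /\
        (((p k)%:R / (n k)%:R) `^ (2 * alpha + 1)%:R^-1) ^+ (alpha.-1 * 2)
          * ln (n k)%:R ^+ 5 <= e].

Let u k : R := ((p k)%:R / (n k)%:R) `^ (2 * alpha + 1)%:R^-1.
Let v k : R := ((p k)%:R / (m k)%:R) `^ (1 / 3).
Let rate t k : R := error_rate alpha (u k) (v k) (ln (n k)%:R) t.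
Let err t k (w : br_space (M k)) : R :=
  l2norm (msm_estimator H (bandwidth R alpha (n k) (m k) (p k)) t w - br_beta (M k)).

(** Off the exceptional event, an error below [M0] times the old rate becomes one below [M1] times
    the new rate. The budget [e] is spent as [e/2] on the previous iterate, [e/8] on the Hessian
    event and [e/8] on the gradient event. *)
Lemma iterate_OP t : is_OP (fun k => br_prob (M k)) (err t) (rate t) ->
  is_OP (fun k => br_prob (M k)) (err t.+1) (rate t.+1).
Proof.
move=> IH e e0; have [M0 M00 hM0] := IH (e / 2) (divr_gt0 e0 (ltr0Sn _ 1)).
have alpha2 := rm_alpha (hM 0); have alpha1 : (0 < alpha)%N := ltnW alpha2.
have [_ [_ [_ [_ [dH _]]]]] := hH.
(* These facts concern the common constants, so any index serves. *)
have [c10 eta0 K1] := And3 (rm_c1 (hM 0)) (rm_eta (hM 0)) (kb_K (rm_kernel (hM 0))).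
pose gdc := `|grad_dev_const K Cr eta CZ| + 1.
have gdc0 : 0 < gdc by rewrite ltr_wpDl.
(* Chosen so that [grad_dev_const / a^2 <= e/8]. *)
pose a := Num.sqrt (8 * gdc / e).
have a20 : 0 < 8 * gdc / e by rewrite divr_gt0// mulr_gt0.
have a0 : 0 < a by rewrite sqrtr_gt0.
have s0 : 0 < step_size K Cr CF c1 eta CZ M0.
  have T1 : 0 <= 16 * K ^+ 2 / eta ^+ 2 by rewrite divr_ge0 ?sqr_ge0// mulr_ge0// sqr_ge0.
  rewrite invr_gt0 -!addrA ltr_wpDr//; apply: addr_ge0 => //; apply: addr_ge0.
    by rewrite mulr_ge0 ?addr_ge0 ?mulr_ge0 ?addr_ge0 ?mulr_ge0// ltW.
  by rewrite mulr_ge0// ltW.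
(* The entry [e / 24] yields [3/n <= e/8], because [1/n <= 1/log n <= delta^alpha <= delta]. *)
pose delta := Num.min (Num.min (step_size K Cr CF c1 eta CZ M0) (e / 24)) 1.
have d0 : 0 < delta by rewrite !lt_min s0 divr_gt0/=.
have d1 : delta <= 1 by rewrite ge_min lexx orbT.
have dS : delta <= step_size K Cr CF c1 eta CZ M0 by rewrite !ge_min lexx.
have de : delta <= e / 24 by rewrite !ge_min lexx orbT.
have da0 : 0 < delta ^+ alpha by rewrite exprn_gt0.
have dad : delta ^+ alpha <= delta.
  by rewrite -[leRHS]expr1; apply: ler_wiXn2l => //; exact: ltW.
pose M1 := Num.max (step_const alpha K Cr CF c1 eta CZ M0 a) 1.
exists M1; first by rewrite lt_max ltr01 orbT.
apply: filterS2 hM0 (hreg da0) => k hk [n0 pn hl hu [hv hul]].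
have := iterate_step (m := m k) (hM k) dH t M00 a0 d0 dS n0 pn hl hu hv hul.
rewrite -/(u k) -/(v k) => -[A [mA PA hA]].
have err_measurable s : measurable_fun setT (err s (k := k)).
  have hK := rm_kernel (hM k).
  exact: (measurable_estimation_error (M := M k) (kb_c1 hK) (kb_c2 hK)).
have mS s c : measurable [set w | c < `|err s (k := k) w|].
  rewrite -[X in measurable X]setTI; apply: (measurable_fun_ltr (measurable_cst _)) => //.
  exact: measurableT_comp.
have u0 : 0 < u k by rewrite powR_gt0// divr_gt0// ltr0n ?(rm_p (hM k)).
have r0 s : 0 <= rate s k by apply: error_rate_ge0 => //; exact: powR_ge0.
apply: (@le_trans _ _ (br_prob (M k) ([set w | M0 * rate t k < `|err t (k := k) w|] `|` A))).
  apply: le_measure; rewrite ?inE//; first exact: measurableU.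
  move=> w /= hw; have [wA|wA] := pselect (A w); [by right|left].
  rewrite ltNge; apply/negP; rewrite ger0_norm ?l2norm_ge0// => hle.
  move: hw; rewrite ltNge => /negP; apply; rewrite ger0_norm ?l2norm_ge0//.
  apply: le_trans (hA w wA _ hle) _; apply: ler_wpM2r; first exact: (r0 t.+1).
  by rewrite le_max lexx.
apply: le_trans (measureU2 _ (mS _ _) mA) _.
apply: (@le_trans _ _ ((e / 2)%:E + (3 / (n k)%:R + grad_dev_const K Cr eta CZ / a ^+ 2)%:E)%E).
  by apply: leeD.
rewrite -EFinD lee_fin.
have b1 : 3 / (n k)%:R <= e / 8.
  have nR : 0 < (n k)%:R :> R by rewrite ltr0n.
  have ln_n : ln (n k)%:R <= (n k)%:R :> R.
    have := expR_ge1Dx (ln (n k)%:R : R); rewrite lnK ?posrE// => h.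
    by apply: le_trans h; rewrite lerDr.
  have ni : (n k)%:R^-1 <= delta.
    by apply: le_trans dad; rewrite -[leRHS]invrK lef_pV2 ?posrE ?invr_gt0// (le_trans hl).
  have -> : e / 8 = 3 * (e / 24) by field.
  by rewrite ler_pM2l// (le_trans ni).
have b2 : grad_dev_const K Cr eta CZ / a ^+ 2 <= e / 8.
  rewrite sqr_sqrtr ?(ltW a20)//.
  have -> : e / 8 = gdc / (8 * gdc / e) by field; rewrite !gt_eqF.
  rewrite ler_pM2r ?invr_gt0//.
  by apply: le_trans (ler_norm _) _; rewrite lerDl.
by lra.
Qed.

End induction.

Theorem theorem3p3 (R : realType)
  (n m p L : nat -> nat)
  (hn : n @ \oo --> \oo) (hm : m @ \oo --> \oo)
  (hnmL : forall k, n k = (m k * L k)%N)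
  (hL : forall k, (0 < L k)%N) (hp : forall k, (0 < p k)%N)
  (M : forall k, binary_response R (n k) (p k))
  (hiid : forall k, iid_sample (M k))
  (hident : forall k, identifiability (M k))
  (alpha : nat) (H : R -> R) (hH : kernel_assumption alpha H)
  (rho F : forall k, R -> borel_cV R (p k) -> R)
  (Crho : R) (hrho : forall k, density_assumption (M k) alpha Crho (rho k))
  (CF : R) (hF : forall k, noise_assumption (M k) alpha CF (F k))
  (c1 : R) (hc1 : 1 < c1)
  (hV : forall k, eigenvalue_assumption (M k) H c1 (rho k) (F k))
  (eta : R) (heta : 0 < eta) (CZ : R)
  (hZ : forall k, subgaussian_assumption (M k) eta CZ)
  (c2 : R) (hc2 : 0 < c2 < 1)
  (hpm : ((fun k => (p k)%:R) : nat -> R) =O_\oo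
          ((fun k => (m k)%:R `^ c2) : nat -> R))
  (hinit : is_OP (fun k => br_prob (M k))
     (fun k w => l2norm ((br_beta0 (M k) w : 'cV[R]_(p k)) - br_beta (M k)))
     (fun k => ((p k)%:R / (m k)%:R) `^ (1 / 3)))
  (T : nat) (hT : (0 < T)%N) :
  forall t : nat, (1 <= t <= T)%N ->
    is_OP (fun k => br_prob (M k))
      (fun k w =>
         l2norm (msm_estimator H (bandwidth R alpha (n k) (m k) (p k)) t w
                 - br_beta (M k)))
      (fun k =>
         ((p k)%:R / (n k)%:R) `^ (alpha%:R / (2 * alpha + 1)%:R)
         + ((p k)%:R / (m k)%:R) `^ ((2 ^ t)%:R / 3)
         + ((p k)%:R / (m k)%:R) `^ ((2 ^ t.-1)%:R / 3)
           * ((p k)%:R / (n k)%:R) `^ (alpha.-1%:R / (2 * alpha + 1)%:R)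
           * Num.sqrt (ln (n k)%:R)).
Proof.
have alpha2 := hH.1; have [K hK] := kernel_boundsP hH.
have hM k := regular_modelP hK alpha2 (hp k) hc1 heta (hiid k) (hident k) (hrho k) (hF k)
  (hV k) (hZ k).
pose u k : R := ((p k)%:R / (n k)%:R) `^ (2 * alpha + 1)%:R^-1.
pose v k : R := ((p k)%:R / (m k)%:R) `^ (1 / 3).
(* The induction starts at [t = 0], where [error_rate] is the rate [v] of the initial estimator; for
   [t >= 1] the powers of [u] and [v] are rewritten as real powers of [p/n] and [p/m]. *)
have main t : is_OP (fun k => br_prob (M k))
    (fun k w => l2norm (msm_estimator H (bandwidth R alpha (n k) (m k) (p k)) t w
                        - br_beta (M k)))
    (fun k => error_rate alpha (u k) (v k) (ln (n k)%:R) t).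
  elim: t => [|t IH]; first exact: hinit.
  apply: (iterate_OP hH hM _ IH) => e e0.
  exact: (asymptotic_regime hn hm hnmL hL hc2 hpm alpha2 e0).
case=> // t _; have := main t.+1; congr (is_OP _ _ _); apply/funext => k.
have up (j : nat) : u k ^+ j = ((p k)%:R / (n k)%:R) `^ (j%:R / (2 * alpha + 1)%:R).
  by rewrite /u -powR_mulrn ?powR_ge0// -powRrM [X in _ `^ X]mulrC.
have vp (j : nat) : v k ^+ j = ((p k)%:R / (m k)%:R) `^ (j%:R / 3).
  by rewrite /v -powR_mulrn ?powR_ge0// -powRrM [X in _ `^ X]mulrC mulrA mulr1.
by rewrite /error_rate !up !vp.
Qed.
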